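(* Let $\mathbb{O}$ be a compact quantum space such that the C*-algebra $C(\mathbb{O})$ is residually finite dimensional and let $\mathbb{P}$ be a finite quantum space. Then the C*-algebra $C(\mathbb{M}_{\mathbb{P},\mathbb{O}})$ is residually finite dimensional.
   Context: A quantum space $\mathbb{X}$ is an object of the category dual to the category of C*-algebras; the corresponding C*-algebra is denoted $C_0(\mathbb{X})$, or $C(\mathbb{X})$ when it is unital. $\mathbb{X}$ is compact if $C(\mathbb{X})$ is unital and finite if $C(\mathbb{X})$ is finite-dimensional. For C*-algebras $A,B$, $\mathrm{Mor}(A,B)$ is the set of non-degenerate $*$-homomorphisms from $A$ to the multiplier algebra $M(B)$ (unital $*$-homomorphisms $A\to B$ if both are unital). $\otimes$ is the minimal tensor product. For $\mathbb{P}$ finite and $\mathbb{O}$ compact, $(C(\mathbb{M}_{\mathbb{P},\mathbb{O}}),\boldsymbol{\Phi}_{\mathbb{P},\mathbb{O}})$ denotes the (existing, unique up to isomorphism) pair consisting of a unital C*-algebra and a unital $*$-homomorphism $\boldsymbol{\Phi}_{\mathbb{P},\mathbb{O}}\colon C(\mathbb{O})\to C(\mathbb{P})\otimes C(\mathbb{M}_{\mathbb{P},\mathbb{O}})$ with the universal property: for every quantum space $\mathbb{X}$ and every $\Psi\in\mathrm{Mor}(C(\mathbb{O}),C(\mathbb{P})\otimes C_0(\mathbb{X}))$ there is a unique $\Lambda\in\mathrm{Mor}(C(\mathbb{M}_{\mathbb{P},\mathbb{O}}),C_0(\mathbb{X}))$ with $\Psi=(\mathrm{id}\otimes\Lambda)\circ\boldsymbol{\Phi}_{\mathbb{P},\mathbb{O}}$.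 The C*-algebra $C(\mathbb{M}_{\mathbb{P},\mathbb{O}})$ is generated by $\{(\omega\otimes\mathrm{id})\boldsymbol{\Phi}_{\mathbb{P},\mathbb{O}}(a) : a\in C(\mathbb{O}),\ \omega\in C(\mathbb{P})^*\}$. *)

(* Defs.v *)
From HB Require Import structures.
From mathcomp Require Import all_boot all_order all_algebra.
From mathcomp Require Import all_classical all_reals all_analysis.
From mathcomp Require Export complex.

Set Implicit Arguments.
Unset Strict Implicit.
Unset Printing Implicit Defensive.

Import Order.TTheory GRing.Theory Num.Theory.
Import numFieldNormedType.Exports.
Local Open Scope classical_set_scope.
Local Open Scope ring_scope.

Declare Scope cstar_scope.
Delimit Scope cstar_scope with CS.
Local Open Scope cstar_scope.

(* *-algebras over R[i], not assumed to have a unit; MathComp's ring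
   structures all carry a unit, so the product is a separate operation. *)
HB.mixin Record Lmodule_isStarAlg (R : realType) A of GRing.Lmodule R[i] A := {
  smul : A -> A -> A;
  star : A -> A;
  smulA : forall a b c, smul a (smul b c) = smul (smul a b) c;
  smulDl : forall a b c, smul (a + b) c = smul a c + smul b c;
  smulDr : forall a b c, smul a (b + c) = smul a b + smul a c;
  smulZl : forall (k : R[i]) a b, smul (k *: a) b = k *: smul a b;
  smulZr : forall (k : R[i]) a b, smul a (k *: b) = k *: smul a b;
  starK : forall a, star (star a) = a;
  starD : forall a b, star (a + b) = star a + star b;
  starZ : forall (k : R[i]) a, star (k *: a) = Num.conj k *: star a;
  starM : forall a b, star (smul a b) = smul (star b) (star a)
}.

#[short(type="starAlgType")]
HB.structure Definition StarAlg (R : realType) :=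
  { A of GRing.Lmodule R[i] A & Lmodule_isStarAlg R A }.

Notation "a ** b" := (smul a b) (at level 40, left associativity) : cstar_scope.

HB.mixin Record StarAlg_isCStarAlg (R : realType) A
    of StarAlg R A & CompleteNormedModule R[i] A := {
  normMle : forall a b : A, `|a ** b| <= `|a| * `|b|;
  norm_cstar : forall a : A, `|star a ** a| = `|a| ^+ 2
}.

#[short(type="cstarAlgType")]
HB.structure Definition CStarAlg (R : realType) :=
  { A of StarAlg R A & CompleteNormedModule R[i] A & StarAlg_isCStarAlg R A }.

Record starhom (R : realType) (A B : starAlgType R) := StarHom {
  starhom_fun :> A -> B;
  starhomD : forall a b, starhom_fun (a + b) = starhom_fun a + starhom_fun b;
  starhomZ : forall (k : R[i]) a, starhom_fun (k *: a) = k *: starhom_fun a;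
  starhomM : forall a b, starhom_fun (a ** b) = starhom_fun a ** starhom_fun b;
  starhom_star : forall a, starhom_fun (star a) = star (starhom_fun a)
}.

Definition is_unit (R : realType) (A : starAlgType R) (e : A) :=
  forall a, e ** a = a /\ a ** e = a.

Definition unital (R : realType) (A : starAlgType R) := exists e : A, is_unit e.

Definition unital_hom (R : realType) (A B : starAlgType R) (f : starhom A B) :=
  forall e : A, is_unit e -> is_unit (f e).

Definition finite_dimensional (R : realType) (A : lmodType R[i]) :=
  exists n (e : 'I_n -> A),
    forall a, exists c : 'I_n -> R[i], a = \sum_i c i *: e i.

Definition lin_indep (R : realType) (A : lmodType R[i]) n (a : 'I_n -> A) :=
  forall c : 'I_n -> R[i], \sum_i c i *: a i = 0 -> forall i, c i = 0.

Definition lin_span (R : realType) (A : lmodType R[i]) (S : set A) : set A :=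
  [set x | exists n (c : 'I_n -> R[i]) (v : 'I_n -> A),
     (forall i, S (v i)) /\ x = \sum_i c i *: v i].

Section MatrixStarAlg.
Variables (R : realType) (n : nat).
Implicit Types (a b c : 'M[R[i]]_n) (k : R[i]).

Definition mxadj a : 'M[R[i]]_n := map_mx Num.conj (a^T).

Fact mxadjK a : mxadj (mxadj a) = a.
Proof. by apply/matrixP => i j; rewrite !mxE conjCK. Qed.

Fact mxadjD a b : mxadj (a + b) = mxadj a + mxadj b.
Proof. by apply/matrixP => i j; rewrite !mxE rmorphD. Qed.

Fact mxadjZ k a : mxadj (k *: a) = Num.conj k *: mxadj a.
Proof. by apply/matrixP => i j; rewrite !mxE rmorphM. Qed.

Fact mxadjM a b : mxadj (a *m b) = mxadj b *m mxadj a.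
Proof. by rewrite /mxadj trmx_mul map_mxM. Qed.

HB.instance Definition _ := Lmodule_isStarAlg.Build R 'M[R[i]]_n
  (@mulmxA _ n n n n) (@mulmxDl _ n n n) (@mulmxDr _ n n n)
  (fun k a b => esym (scalemxAl k a b)) (fun k a b => esym (scalemxAr k a b))
  mxadjK mxadjD mxadjZ mxadjM.

End MatrixStarAlg.

(* A *-homomorphism into 'M_n is a representation on the Hilbert space C^n. *)
Definition residually_finite_dimensional (R : realType) (A : cstarAlgType R) :=
  forall a : A, a != 0 ->
    exists n (pi : starhom A 'M[R[i]]_n), pi a != 0.

(* M(B) as the double centralizers of B.  Linearity (and boundedness) of the
   two maps follows from the centralizer identity. *)
Record multiplier (R : realType) (B : cstarAlgType R) := Multiplier {
  lmult : B -> B;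
  rmult : B -> B;
  multP : forall a b, a ** lmult b = rmult a ** b
}.

Section MultiplierStarAlg.
Variables (R : realType) (B : cstarAlgType R).
Implicit Types (a b c : B) (m : multiplier B) (k : R[i]).

Lemma smul0l b : 0 ** b = 0.
Proof. by rewrite -(scale0r (0 : B)) smulZl !scale0r. Qed.

Lemma smul0r b : b ** 0 = 0.
Proof. by rewrite -(scale0r (0 : B)) smulZr !scale0r. Qed.

Lemma smulNl a b : (- a) ** b = - (a ** b).
Proof. by rewrite -scaleN1r smulZl scaleN1r. Qed.

Lemma smulNr a b : a ** (- b) = - (a ** b).
Proof. by rewrite -scaleN1r smulZr scaleN1r. Qed.

Lemma star_cancel0 b : star b ** b = 0 -> b = 0.
Proof.
move=> h; apply/eqP; rewrite -normr_eq0 -sqrf_eq0 -norm_cstar h.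
by rewrite normr0.
Qed.

Lemma smul_injl b c : (forall a, a ** b = a ** c) -> b = c.
Proof.
move=> h; apply: subr0_eq; apply: star_cancel0.
by rewrite smulDr smulNr h subrr.
Qed.

Lemma smul_injr b c : (forall a, b ** a = c ** a) -> b = c.
Proof.
move=> h; rewrite -(starK b) -(starK c); congr (star _).
by apply: smul_injl => a; rewrite -(starK a) -!starM h.
Qed.

Lemma lmultD m a b : lmult m (a + b) = lmult m a + lmult m b.
Proof. by apply: smul_injl => c; rewrite smulDr !multP smulDr. Qed.

Lemma lmultZ m k a : lmult m (k *: a) = k *: lmult m a.
Proof. by apply: smul_injl => c; rewrite smulZr !multP smulZr. Qed.

Lemma rmultD m a b : rmult m (a + b) = rmult m a + rmult m b.
Proof. by apply: smul_injr => c; rewrite smulDl -!multP smulDl. Qed.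

Lemma rmultZ m k a : rmult m (k *: a) = k *: rmult m a.
Proof. by apply: smul_injr => c; rewrite smulZl -!multP smulZl. Qed.

Lemma mult_ext m1 m2 : lmult m1 =1 lmult m2 -> rmult m1 =1 rmult m2 -> m1 = m2.
Proof.
case: m1 m2 => l1 r1 p1 [l2 r2 p2] /= /funext el /funext er.
by subst l2 r2; congr Multiplier; exact: Prop_irrelevance.
Qed.

HB.instance Definition _ := gen_eqMixin (multiplier B).
HB.instance Definition _ := gen_choiceMixin (multiplier B).

Fact mult0_subproof a b : a ** (0 : B) = 0 ** b.
Proof. by rewrite smul0l smul0r. Qed.
Definition mult0 : multiplier B :=
  @Multiplier R B (fun=> 0) (fun=> 0) mult0_subproof.

Fact multD_subproof m1 m2 a b :
  a ** (lmult m1 b + lmult m2 b) = (rmult m1 a + rmult m2 a) ** b.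
Proof. by rewrite smulDl smulDr !multP. Qed.
Definition multD m1 m2 : multiplier B := Multiplier (multD_subproof m1 m2).

Fact multN_subproof m a b : a ** (- lmult m b) = (- rmult m a) ** b.
Proof. by rewrite smulNl smulNr multP. Qed.
Definition multN m : multiplier B := Multiplier (multN_subproof m).

Fact multZ_subproof k m a b : a ** (k *: lmult m b) = (k *: rmult m a) ** b.
Proof. by rewrite smulZl smulZr multP. Qed.
Definition multZ k m : multiplier B := Multiplier (multZ_subproof k m).

Fact multM_subproof m1 m2 a b :
  a ** lmult m1 (lmult m2 b) = rmult m2 (rmult m1 a) ** b.
Proof. by rewrite !multP. Qed.
Definition multM m1 m2 : multiplier B := Multiplier (multM_subproof m1 m2).

Fact mult_star_subproof m a b :
  a ** star (rmult m (star b)) = star (lmult m (star a)) ** b.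
Proof. by rewrite -[a in LHS]starK -[b in RHS]starK -!starM multP. Qed.
Definition mult_star m : multiplier B := Multiplier (mult_star_subproof m).

Fact multDA : associative multD.
Proof. by move=> x y z; apply: mult_ext => b /=; rewrite addrA. Qed.
Fact multDC : commutative multD.
Proof. by move=> x y; apply: mult_ext => b /=; rewrite addrC. Qed.
Fact mult0D : left_id mult0 multD.
Proof. by move=> x; apply: mult_ext => b /=; rewrite add0r. Qed.
Fact multND : left_inverse mult0 multN multD.
Proof. by move=> x; apply: mult_ext => b /=; rewrite addNr. Qed.

HB.instance Definition _ :=
  GRing.isZmodule.Build (multiplier B) multDA multDC mult0D multND.

Fact multZA k l m : multZ k (multZ l m) = multZ (k * l) m.
Proof. by apply: mult_ext => b /=; rewrite scalerA. Qed.
Fact mult1Z : left_id 1 multZ.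
Proof. by move=> m; apply: mult_ext => b /=; rewrite scale1r. Qed.
Fact multZDr : right_distributive multZ +%R.
Proof. by move=> k x y; apply: mult_ext => b /=; rewrite scalerDr. Qed.
Fact multZDl m : {morph multZ^~ m : k l / k + l}.
Proof. by move=> k l; apply: mult_ext => b /=; rewrite scalerDl. Qed.

HB.instance Definition _ := GRing.Zmodule_isLmodule.Build R[i] (multiplier B)
  multZA mult1Z multZDr multZDl.

Fact multMA x y z : multM x (multM y z) = multM (multM x y) z.
Proof. exact: mult_ext. Qed.
Fact multMDl x y z : multM (x + y) z = multM x z + multM y z.
Proof. by apply: mult_ext => b //=; rewrite rmultD. Qed.
Fact multMDr x y z : multM x (y + z) = multM x y + multM x z.
Proof. by apply: mult_ext => b //=; rewrite lmultD. Qed.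
Fact multMZl k x y : multM (k *: x) y = k *: multM x y.
Proof. by apply: mult_ext => b //=; rewrite rmultZ. Qed.
Fact multMZr k x y : multM x (k *: y) = k *: multM x y.
Proof. by apply: mult_ext => b //=; rewrite lmultZ. Qed.
Fact mult_starK x : mult_star (mult_star x) = x.
Proof. by apply: mult_ext => b /=; rewrite !starK. Qed.
Fact mult_starD x y : mult_star (x + y) = mult_star x + mult_star y.
Proof. by apply: mult_ext => b /=; rewrite starD. Qed.
Fact mult_starZ k x : mult_star (k *: x) = Num.conj k *: mult_star x.
Proof. by apply: mult_ext => b /=; rewrite starZ. Qed.
Fact mult_starM x y : mult_star (multM x y) = multM (mult_star y) (mult_star x).
Proof. by apply: mult_ext => b /=; rewrite starK. Qed.

HB.instance Definition _ := Lmodule_isStarAlg.Build R (multiplier B)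
  multMA multMDl multMDr multMZl multMZr
  mult_starK mult_starD mult_starZ mult_starM.

End MultiplierStarAlg.

(* Mor(A, B); a *-homomorphism into M(B) needs only the *-algebra structure of
   M(B), its norm plays no role. *)
Record Mor (R : realType) (A B : cstarAlgType R) := MkMor {
  mor_hom :> starhom A (multiplier B);
  mor_nondegenerate :
    dense (lin_span [set x | exists a b, x = lmult (mor_hom a) b])
}.

(* Completions of the algebraic tensor product of A and B in a C*-norm.
   [tens_inj] is the injectivity of the linear map induced by [tens] on the
   algebraic tensor product. *)
Record cstar_tensor (R : realType) (A B : cstarAlgType R) := CstarTensor {
  tensor_alg :> cstarAlgType R;
  tens : A -> B -> tensor_alg;
  tensDl : forall a a' b, tens (a + a') b = tens a b + tens a' b;
  tensDr : forall a b b', tens a (b + b') = tens a b + tens a b';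
  tensZl : forall (k : R[i]) a b, tens (k *: a) b = k *: tens a b;
  tensZr : forall (k : R[i]) a b, tens a (k *: b) = k *: tens a b;
  tensM : forall a a' b b', tens a b ** tens a' b' = tens (a ** a') (b ** b');
  tens_star : forall a b, star (tens a b) = tens (star a) (star b);
  tens_inj : forall n (a : 'I_n -> A) (b : 'I_n -> B), lin_indep a ->
    \sum_i tens (a i) (b i) = 0 -> forall i, b i = 0;
  tens_dense : dense (lin_span [set x | exists a b, x = tens a b])
}.

(* The minimal tensor product: the completion in the least C*-norm. *)
Definition is_min_tensor (R : realType) (A B : cstarAlgType R)
    (T : cstar_tensor A B) :=
  forall (T' : cstar_tensor A B) n (a : 'I_n -> A) (b : 'I_n -> B),
    `|\sum_i tens T (a i) (b i)| <= `|\sum_i tens T' (a i) (b i)|.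

(* [idL] is id (x) L, where the multiplier p (x) L(m) of the tensor product of
   P and X is determined by its products with elementary tensors. *)
Definition is_id_tensor (R : realType) (P M X : cstarAlgType R)
    (T : cstar_tensor P M) (TX : cstar_tensor P X)
    (L : Mor M X) (idL : Mor T TX) :=
  forall (p q : P) (m : M) (x : X),
    lmult (idL (tens T p m)) (tens TX q x) = tens TX (p ** q) (lmult (L m) x) /\
    rmult (idL (tens T p m)) (tens TX q x) = tens TX (q ** p) (rmult (L m) x).

(* (M, Phi) is the quantum space of all maps from P to O; P, O, M and X stand
   for C(P), C(O), C(M_{P,O}) and C_0(X). *)
Definition is_quantum_space_of_maps (R : realType) (P O M : cstarAlgType R)
    (T : cstar_tensor P M) (Phi : starhom O T) :=
  [/\ unital M, is_min_tensor T, unital_hom Phi &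
    forall (X : cstarAlgType R) (TX : cstar_tensor P X), is_min_tensor TX ->
    forall Psi : Mor O TX,
    exists! L : Mor M X,
    exists2 idL : Mor T TX, is_id_tensor L idL & forall a, Psi a = idL (Phi a)].

(* Main.v *)
Require Import Defs.
From HB Require Import structures.
From mathcomp Require Import all_boot all_order all_algebra.
From mathcomp Require Import all_classical all_reals all_analysis.
From mathcomp Require Import ring lra.

Set Implicit Arguments.
Unset Strict Implicit.
Unset Printing Implicit Defensive.

Import Order.TTheory GRing.Theory Num.Theory.
Import numFieldNormedType.Exports.
Local Open Scope classical_set_scope.
Local Open Scope complex_scope.
Local Open Scope ring_scope.
Local Open Scope cstar_scope.

(* For [x0 != 0] in C(M_{P,O}), Hahn-Banach gives a positive functional [phi]
   with [phi (x0^* x0) > 0]. Let [mu o] be the matrix of [Phi o] in matrix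
   units of C(P). On a finite orthonormal family of vectors of the
   representation of [phi], the maps [(j, i) |-> mu o (i, j)] assemble into a
   completely positive map on C(O). Since C(O) is residually finite
   dimensional, separation from the convex cone of functionals of
   finite-dimensional representations shows that it is approximated by
   compressions of such representations; a small correction makes the
   compressing family exactly orthonormal. Conjugating [1 (x) sigma] by a
   reflection that exchanges this family with the standard one, indexed by
   (matrix unit, vector), turns the compression into a unital *-homomorphism
   from C(O) to C(P) (x) M_N, and the universal property yields a
   representation of C(M_{P,O}) on C^N which approximates the coefficients of
   [mu o] on the chosen vectors. Applying this to [o] and to [o^* o] controls
   the vectors [mu o (i, j) w] in norm, not only in coefficients, so these
   representations asymptotically intertwine the action of the generators,
   hence that of the closed subalgebra they generate, which by uniqueness in
   the universal property is everything. Hence [x0] is not in the kernel of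
   all of them. *)

(** * Norms and completeness *)

(** The universal property only accepts *-homomorphisms, whereas compressions of representations are
    merely completely positive; the reflection turns such a compression into a corner of a genuine
    representation, provided there is room for both families to be orthogonal. It must also respect
    the decomposition of C(P) into full matrix blocks, so the vectors to be exchanged are stored in
    one distinguished row of each block. Minimality of the concrete tensor products fed to the
    universal property comes from the fact that C(P) (x) X carries a single C*-norm. No GNS Hilbert
    space is built: C(M_{P,O}) with the possibly degenerate form of [phi] is enough, since only
    finitely many vectors matter at a time. Order theory rests on square roots obtained by a
    convergent iteration instead of the spectrum. Its decisive use is that positivity of a matrix
    over C(O) is detected by finite-dimensional representations, which lets a separating functional
    be treated as a positive matrix. *)

Lemma half_gt0 (F : numFieldType) (x : F) : 0 < x -> 0 < x / 2.
Proof. by move=> x0; rewrite divr_gt0. Qed.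

Section RealNorm.
Variables (R : realType) (V : normedZmodType R[i]).
Implicit Types (v w : V) (e : R).

(** Norms of [R[i]]-modules take values in [R[i]]; the real part lives in the totally ordered field
    [R], where suprema and linear arithmetic are available. *)
Definition nrm v : R := complex.Re `|v|.

Lemma normE v : `|v| = (nrm v)%:C.
Proof. by rewrite /nrm RRe_real // normr_real. Qed.

Lemma nrm_le v e : (`|v| <= e%:C) = (nrm v <= e).
Proof. by rewrite normE lecR. Qed.

Lemma nrm_ge0 v : 0 <= nrm v.
Proof. by rewrite -ler0c -normE. Qed.

Lemma nrm0 : nrm (0 : V) = 0.
Proof. by rewrite /nrm normr0. Qed.

Lemma nrm0_eq0 v : nrm v = 0 -> v = 0.
Proof. by move=> h; apply/eqP; rewrite -normr_eq0 normE h. Qed.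

Lemma nrm_eq0 v : (nrm v == 0) = (v == 0).
Proof. by apply/eqP/eqP => [/nrm0_eq0 //|->]; rewrite nrm0. Qed.

Lemma nrm_gt0 v : (0 < nrm v) = (v != 0).
Proof. by rewrite lt_neqAle nrm_ge0 eq_sym nrm_eq0 andbT. Qed.

Lemma nrmD v w : nrm (v + w) <= nrm v + nrm w.
Proof. by rewrite -lecR rmorphD /= -!normE ler_normD. Qed.

Lemma nrmN v : nrm (- v) = nrm v.
Proof. by rewrite /nrm normrN. Qed.

Lemma nrmB v w : nrm (v - w) = nrm (w - v).
Proof. by rewrite /nrm distrC. Qed.

Lemma nrm_small v : (forall e, 0 < e -> nrm v <= e) -> v = 0.
Proof.
move=> h; apply: nrm0_eq0; apply/eqP; rewrite eq_le nrm_ge0 andbT.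
by apply/ler_addgt0Pl => e /h; rewrite addr0.
Qed.

Definition cvs (u : nat -> V) v :=
  forall e, 0 < e -> exists N, forall n, (N <= n)%N -> nrm (u n - v) <= e.

Lemma cvs_cst v : cvs (fun=> v) v.
Proof. by move=> e e0; exists 0%N => n _; rewrite subrr nrm0 ltW. Qed.

Lemma cvsD (u u' : nat -> V) v v' : cvs u v -> cvs u' v' ->
  cvs (fun n => u n + u' n) (v + v').
Proof.
move=> hu hu' e e0; have [N hN] := hu _ (half_gt0 e0).
have [N' hN'] := hu' _ (half_gt0 e0).
exists (maxn N N') => n; rewrite geq_max => /andP[/hN h /hN' h'].
rewrite opprD addrACA (le_trans (nrmD _ _)) //.
by rewrite (splitr e) lerD.
Qed.

Lemma cvsN (u : nat -> V) v : cvs u v -> cvs (fun n => - u n) (- v).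
Proof.
by move=> h e /h [N hN]; exists N => n /hN; rewrite -opprD nrmN.
Qed.

Lemma cvs_uniq (u : nat -> V) v w : cvs u v -> cvs u w -> v = w.
Proof.
move=> hv hw; apply: subr0_eq; apply: nrm_small => e e0.
have [N hN] := cvsD hv (cvsN hw) e0.
by have := hN N (leqnn _); rewrite subrr add0r nrmN.
Qed.

Lemma cvs_nrm_le (u : nat -> V) v e :
  cvs u v -> (forall n, nrm (u n) <= e) -> nrm v <= e.
Proof.
move=> h hu; apply/ler_addgt0Pl => d /h [N /(_ N (leqnn _)) hN].
rewrite -(subrK (u N) v); apply: le_trans (nrmD _ _) _.
by rewrite nrmB lerD.
Qed.

Lemma cvs_shift (u : nat -> V) v : cvs u v -> cvs (fun n => u n.+1) v.
Proof. by move=> h e /h [N hN]; exists N => n Nn; apply: hN; rewrite leqW. Qed.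

Lemma cvs_ext (u u' : nat -> V) v : u =1 u' -> cvs u v -> cvs u' v.
Proof. by move=> /funext ->. Qed.

Definition cauchys (u : nat -> V) := forall e, 0 < e ->
  exists N, forall m n, (N <= m)%N -> (N <= n)%N -> nrm (u m - u n) <= e.

Lemma cvs_cauchys (u : nat -> V) v : cvs u v -> cauchys u.
Proof.
move=> h e e0; have [N hN] := h _ (half_gt0 e0).
exists N => m n /hN hm /hN hn; rewrite -(subrKA v) (splitr e).
by apply: le_trans (nrmD _ _) _; rewrite lerD // nrmB.
Qed.

End RealNorm.

Section NormedModule.
Variables (R : realType).

Lemma nrm_realC (t : R) : nrm (t%:C : R[i]) = `|t|.
Proof. by rewrite /nrm normc_def /= expr0n addr0 sqrtr_sqr. Qed.

Lemma nrmM_C (x y : R[i]) : nrm (x * y) = nrm x * nrm y.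
Proof. by apply: (@complexI R); rewrite rmorphM /= -!normE normrM. Qed.

Lemma nrmZ (V : normedModType R[i]) (k : R[i]) (v : V) :
  nrm (k *: v) = nrm k * nrm v.
Proof. by apply: (@complexI R); rewrite rmorphM /= -!normE normrZ. Qed.

Lemma nrmZr (V : normedModType R[i]) (t : R) (v : V) :
  nrm (t%:C *: v) = `|t| * nrm v.
Proof. by rewrite nrmZ nrm_realC. Qed.

Lemma cvsZ (V : normedModType R[i]) (k : R[i]) (u : nat -> V) v :
  cvs u v -> cvs (fun n => k *: u n) (k *: v).
Proof.
move=> h e e0; have k0 : 0 < nrm k + 1 by rewrite ltr_wpDl ?nrm_ge0.
have [N hN] := h _ (divr_gt0 e0 k0); exists N => n /hN hn.
rewrite -scalerBr nrmZ (le_trans (ler_wpM2l (nrm_ge0 _) hn)) //.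
rewrite mulrCA -[leRHS]mulr1 ler_wpM2l ?(ltW e0) //.
by rewrite ler_pdivrMr // mul1r lerDl.
Qed.

Lemma cauchys_cvs (V : completeNormedModType R[i]) (u : nat -> V) :
  cauchys u -> exists v, cvs u v.
Proof.
move=> hu.
have cu : cauchy (u @ \oo).
  apply/cauchyP => e e0.
  have [r er] : exists r : R, e = r%:C.
    by apply/complex_realP; apply: gtr0_real.
  have r0 : 0 < r by rewrite -ltcR -er.
  have [N hN] := hu (r / 2) (half_gt0 r0).
  exists (u N); exists N => // n /= Nn; rewrite -ball_normE /= normE er ltcR.
  by rewrite (le_lt_trans (hN _ _ (leqnn _) Nn)) // ltr_pdivrMr // ltr_pMr // ltr1n.
have /cvg_ex [v /cvgrPdist_le hv] : cvg (u @ \oo) by apply/cauchy_cvgP.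
exists v => e e0; have /hv [N _ hN] : 0 < e%:C by rewrite ltcR.
by exists N => n Nn; have := hN n Nn; rewrite /= nrm_le nrmB.
Qed.

Lemma invS_small (e : R) : 0 < e ->
  exists N, forall n, (N <= n)%N -> n.+1%:R^-1 <= e.
Proof.
move=> e0; exists (Num.trunc e^-1) => n Nn.
rewrite -[leRHS]invrK lef_pV2 ?posrE ?invr_gt0 //.
by rewrite ltW // (lt_le_trans (truncnS_gt _)) // ler_nat ltnS.
Qed.

(** Balls of radius [1/(n+1)] that belong to a Cauchy filter pairwise meet, so their centres form a
    Cauchy sequence, whose limit is a limit of the filter. The C*-algebras constructed below are
    shown complete by sequences only. *)
Lemma complete_of_cauchys (V : normedModType R[i]) :
  (forall u : nat -> V, cauchys u -> exists v, cvs u v) ->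
  forall F : set_system V, ProperFilter F -> cauchy F -> cvg F.
Proof.
move=> h F FF /cauchyP cF.
have r0 n : 0 < (n.+1%:R^-1 : R) by rewrite invr_gt0.
have /choice[u hu] : forall n, exists x : V, F (ball x (n.+1%:R^-1)%:C).
  by move=> n; apply: cF; rewrite ltcR.
have key m n : nrm (u m - u n) <= m.+1%:R^-1 + n.+1%:R^-1.
  have [x [/= xm xn]] := filter_ex (filterI (hu m) (hu n)).
  move: xm xn; rewrite -!ball_normE /= !normE !ltcR => /ltW xm /ltW xn.
  by rewrite -(subrKA x) (le_trans (nrmD _ _)) // lerD // nrmB.
have [|v hv] := h u.
  move=> e e0; have [N hN] := invS_small (half_gt0 e0).
  exists N => m n /hN hm /hN hn; apply: le_trans (key m n) _.
  by rewrite (splitr e) lerD.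
apply/cvg_ex; exists v; apply/cvgrPdist_le => e e0.
have [r er] : exists r : R, e = r%:C by apply/complex_realP; apply: gtr0_real.
have r2 : 0 < r / 2 by rewrite divr_gt0 // -ltcR -er.
have [N hN] := hv _ r2; have [N' hN'] := invS_small r2.
pose n := maxn N N'.
apply: filterS (hu n) => x; rewrite -ball_normE /= normE ltcR => /ltW hx.
rewrite er nrm_le -(subrKA (u n)) (le_trans (nrmD _ _)) // (splitr r) lerD //.
  by rewrite nrmB hN // leq_maxl.
by rewrite (le_trans hx) // hN' // leq_maxr.
Qed.

Lemma dense_nrm (V : normedModType R[i]) (S : set V) : dense S <->
  forall v (e : R), 0 < e -> exists2 w, S w & nrm (v - w) <= e.
Proof.
split=> [dS v e e0|h].
  have [|//|w [/= wb wS]] := dS (ball v e%:C).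
  - by exists v; apply: ballxx; rewrite ltcR.
  - by apply: ball_open; rewrite ltcR.
  by exists w => //; move: wb; rewrite -ball_normE /= normE ltcR => /ltW.
move=> O [v Ov] oO.
have /nbhs_ballP [e /= e0 he] : nbhs v O by apply: open_nbhs_nbhs.
have [r er] : exists r : R, e = r%:C by apply/complex_realP; apply: gtr0_real.
have r0 : 0 < r by rewrite -ltcR -er.
have [w Sw hw] := h v (r / 2) (half_gt0 r0).
exists w; split=> //; apply: he; rewrite -ball_normE /= normE er ltcR.
by rewrite (le_lt_trans hw) // ltr_pdivrMr // ltr_pMr // ltr1n.
Qed.

End NormedModule.

(** * *-algebras *)

Section StarAlgTheory.
Variables (R : realType) (A : starAlgType R).
Implicit Types (a b c x y : A) (k : R[i]) (t : R).

Lemma mulr0s b : 0 ** b = 0 :> A.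
Proof. by rewrite -(scale0r (0 : A)) smulZl !scale0r. Qed.

Lemma muls0 b : b ** 0 = 0 :> A.
Proof. by rewrite -(scale0r (0 : A)) smulZr !scale0r. Qed.

Lemma mulNs a b : (- a) ** b = - (a ** b).
Proof. by rewrite -scaleN1r smulZl scaleN1r. Qed.

Lemma mulsN a b : a ** (- b) = - (a ** b).
Proof. by rewrite -scaleN1r smulZr scaleN1r. Qed.

Lemma mulsBl a b c : (a - b) ** c = a ** c - b ** c.
Proof. by rewrite smulDl mulNs. Qed.

Lemma mulsBr a b c : a ** (b - c) = a ** b - a ** c.
Proof. by rewrite smulDr mulsN. Qed.

Lemma star0 : star (0 : A) = 0.
Proof. by rewrite -(scale0r (0 : A)) starZ conjC0 !scale0r. Qed.

Lemma starN a : star (- a) = - star a.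
Proof. by rewrite -scaleN1r starZ rmorphN1 scaleN1r. Qed.

Lemma starB a b : star (a - b) = star a - star b.
Proof. by rewrite starD starN. Qed.

Lemma conj_realC t : Num.conj (t%:C : R[i]) = t%:C.
Proof. by rewrite conj_Creal //; apply/complex_realP; exists t. Qed.

Lemma starZr t a : star (t%:C *: a) = t%:C *: star a.
Proof. by rewrite starZ conj_realC. Qed.

Lemma star_sum I (r : seq I) (P : pred I) (F : I -> A) :
  star (\sum_(i <- r | P i) F i) = \sum_(i <- r | P i) star (F i).
Proof. by apply: (big_morph _ starD star0). Qed.

Lemma muls_suml I (r : seq I) (P : pred I) (F : I -> A) b :
  (\sum_(i <- r | P i) F i) ** b = \sum_(i <- r | P i) (F i ** b).
Proof.
by apply: (big_morph (fun a => a ** b)) => [x y|]; rewrite ?smulDl ?mulr0s.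
Qed.

Lemma muls_sumr I (r : seq I) (P : pred I) (F : I -> A) b :
  b ** (\sum_(i <- r | P i) F i) = \sum_(i <- r | P i) (b ** F i).
Proof. by apply: (big_morph (smul b)) => [x y|]; rewrite ?smulDr ?muls0. Qed.

(** Positivity is purely algebraic here, so that it makes sense in every *-algebra. *)
Definition Pos a := exists2 s, star s = s & a = s ** s.

Lemma Pos_sa a : Pos a -> star a = a.
Proof. by case=> s hs ->; rewrite starM hs. Qed.

Lemma half_double a : (2^-1)%:C *: (a + a) = a.
Proof.
rewrite scalerDr -scalerDl -rmorphD /=.
by rewrite (_ : 2^-1 + 2^-1 = 1) ?scale1r //; lra.
Qed.

Definition repart a := (2^-1)%:C *: (a + star a).
Definition impart a := (2^-1)%:C *: ('i *: (star a - a)).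

Lemma repart_sa a : star (repart a) = repart a.
Proof. by rewrite starZr starD starK addrC. Qed.

Lemma impart_sa a : star (impart a) = impart a.
Proof.
by rewrite starZr starZ starB starK conjCi scaleNr -scalerN opprB.
Qed.

Lemma cartesian_sq a :
  repart a ** repart a + impart a ** impart a
  = (2^-1)%:C *: (a ** star a + star a ** a).
Proof.
pose c : R[i] := (2^-1)%:C.
have ii : c * 'i * (c * 'i) = - (c * c) by rewrite mulrACA -['i * 'i]expr2 sqrCi mulrN1.
rewrite /repart /impart -/c !smulZl !smulZr !scalerA -mulrA ii.
rewrite scaleNr -scalerBr mulsBl !mulsBr !smulDl !smulDr.
set u := a ** a; set v := a ** star a; set w := star a ** a.
set z := star a ** star a.
have -> : u + v + (w + z) - (z - w - (v - u)) = (v + w) + (v + w).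
  have -> : u + v + (w + z) = (v + w) + (u + z) by rewrite [u + v]addrC addrACA.
  have -> : - (z - w - (v - u)) = (v + w) - (u + z).
    by rewrite !opprB addrACA opprD.
  by rewrite addrACA addrN addr0.
by rewrite -scalerA half_double.
Qed.

Lemma star_uniq_unit (e : A) : is_unit e -> star e = e.
Proof.
move=> he; have h : star e = star e ** e by case: (he (star e)).
by rewrite [LHS]h -{2}(starK e) -[RHS]starK [in RHS]h starM starK.
Qed.

Lemma unit_uniq (e e' : A) : is_unit e -> is_unit e' -> e = e'.
Proof. by move=> /(_ e') [h _] /(_ e) [_ <-]. Qed.

End StarAlgTheory.

Section StarHomTheory.
Variables (R : realType) (A B : starAlgType R) (f : starhom A B).

Lemma starhom0 : f 0 = 0.
Proof. by rewrite -(scale0r (0 : A)) starhomZ scale0r. Qed.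

Lemma starhomN a : f (- a) = - f a.
Proof. by rewrite -scaleN1r starhomZ scaleN1r. Qed.

Lemma starhomB a b : f (a - b) = f a - f b.
Proof. by rewrite starhomD starhomN. Qed.

Lemma starhom_sum I (r : seq I) (P : pred I) (F : I -> A) :
  f (\sum_(i <- r | P i) F i) = \sum_(i <- r | P i) f (F i).
Proof. by apply: (big_morph _ (starhomD f) starhom0). Qed.

End StarHomTheory.

Section CStarNorm.
Variables (R : realType) (A : cstarAlgType R).
Implicit Types (a b c h x y : A) (t : R).

Lemma nrmM a b : nrm (a ** b) <= nrm a * nrm b.
Proof. by rewrite -lecR rmorphM /= -!normE normMle. Qed.

Lemma nrm_cstar a : nrm (star a ** a) = nrm a ^+ 2.
Proof. by apply: (@complexI R); rewrite rmorphXn /= -!normE norm_cstar. Qed.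

Lemma nrm_star a : nrm (star a) = nrm a.
Proof.
suff le b : nrm b <= nrm (star b) by apply/eqP; rewrite eq_le le -{2}(starK a) le.
have [->|b0] := eqVneq b 0; first by rewrite star0.
have bp : 0 < nrm b by rewrite nrm_gt0 b0.
by rewrite -(ler_pM2r bp) -expr2 -nrm_cstar nrmM.
Qed.

Lemma nrm_sq a : star a = a -> nrm (a ** a) = nrm a ^+ 2.
Proof. by move=> ha; rewrite -{1}ha nrm_cstar. Qed.

Lemma sa_sq0 a : star a = a -> a ** a = 0 -> a = 0.
Proof. by move=> ha aa; apply: star_cancel0; rewrite ha. Qed.

Lemma cvsM (u u' : nat -> A) v v' : cvs u v -> cvs u' v' ->
  cvs (fun n => u n ** u' n) (v ** v').
Proof.
move=> hu hu' e e0.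
have [K K0 eK] : exists2 K, 0 < K & K = nrm v + nrm v' + 1.
  by exists (nrm v + nrm v' + 1); rewrite // ltr_wpDl // addr_ge0 // nrm_ge0.
(* This value gives both [d <= 1] and [d * (K + K) <= e]. *)
pose d := e / (K + K + e).
have Ke0 : 0 < K + K + e := addr_gt0 (addr_gt0 K0 K0) e0.
have d0 : 0 < d by rewrite divr_gt0.
have de : d * (K + K + e) = e by rewrite divfK ?gt_eqF.
have d1 : d <= 1 by rewrite ler_pdivrMr // mul1r lerDr ltW // addr_gt0.
have [N hN] := hu d d0; have [N' hN'] := hu' d d0.
exists (maxn N N') => n; rewrite geq_max => /andP[/hN h /hN' h'].
have -> : u n ** u' n - v ** v' = (u n - v) ** u' n + v ** (u' n - v').
  by rewrite mulsBl mulsBr addrA subrK.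
have hu'n : nrm (u' n) <= nrm v' + 1.
  rewrite -(subrK v' (u' n)) addrC (le_trans (nrmD _ _)) // lerD2l.
  by rewrite (le_trans h').
apply: le_trans (nrmD _ _) _.
apply: (@le_trans _ _ (d * (nrm v' + 1) + nrm v * d)).
  by rewrite lerD //; apply: le_trans (nrmM _ _) _;
    [rewrite ler_pM ?nrm_ge0|rewrite ler_wpM2l ?nrm_ge0].
apply: (@le_trans _ _ (d * (K + K))).
  have v0 := nrm_ge0 v; have v'0 := nrm_ge0 v'.
  by rewrite eK; nra.
by rewrite -[leRHS]de ler_wpM2l ?(ltW d0) // lerDl ltW.
Qed.

Lemma cvs_star (u : nat -> A) v : cvs u v -> cvs (star \o u) (star v).
Proof.
by move=> h e /h [N hN]; exists N => n /hN; rewrite /= -starB nrm_star.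
Qed.

(** * Square roots of [1 - h] *)

Section SquareRoot.
Variable h : A.
Hypotheses (h_sa : star h = h) (h_le1 : nrm h <= 1).

Let y_ := fix y n : A := if n is m.+1 then (2^-1)%:C *: (h + y m ** y m) else 0.
Let t_ := fix t n : R := if n is m.+1 then 2^-1 * (1 + t m ^+ 2) else 0.

Let y_S n : y_ n.+1 = (2^-1)%:C *: (h + y_ n ** y_ n). Proof. by []. Qed.
Let t_S n : t_ n.+1 = 2^-1 * (1 + t_ n ^+ 2). Proof. by []. Qed.

Let t_itv n : 0 <= t_ n <= 1.
Proof. by elim: n => [|n /andP[t0 t1]] /=; [rewrite lexx ler01|nra]. Qed.

Let y_comm n c : c ** h = h ** c -> c ** y_ n = y_ n ** c.
Proof.
move=> hc; elim: n => [|n IH] /=; first by rewrite muls0 mulr0s.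
by rewrite smulZl smulZr smulDl smulDr hc smulA IH -smulA IH smulA.
Qed.

Let y_nrm n : nrm (y_ n) <= t_ n.
Proof.
elim: n => [|n IH] /=; first by rewrite nrm0.
rewrite nrmZr ger0_norm ?invr_ge0 // ler_wpM2l ?invr_ge0 //.
rewrite (le_trans (nrmD _ _)) // lerD // (le_trans (nrmM _ _)) //.
by rewrite expr2 ler_pM ?nrm_ge0.
Qed.

(** The iterates commute, so an increment of [y_] is half the product of the previous increment with
    the sum of the two iterates; the increments of [t_] obey the same identity in the scalars. *)
Let y_step n : nrm (y_ n.+1 - y_ n) <= t_ n.+1 - t_ n.
Proof.
elim: n => [|n IH].
  rewrite /= !subr0 mulr0s addr0 nrmZr ger0_norm ?invr_ge0 //.
  by rewrite expr0n /= addr0 ler_wpM2l ?invr_ge0.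
have -> : y_ n.+2 - y_ n.+1 =
    (2^-1)%:C *: ((y_ n.+1 - y_ n) ** (y_ n.+1 + y_ n)).
  have cy : y_ n.+1 ** y_ n = y_ n ** y_ n.+1.
    by apply: y_comm; symmetry; apply: y_comm.
  rewrite mulsBl !smulDr -cy opprD addrA addrK.
  rewrite (y_S n.+1) [X in _ - X]y_S -scalerBr opprD addrACA subrr.
  by rewrite add0r.
have -> : t_ n.+2 - t_ n.+1 = 2^-1 * ((t_ n.+1 - t_ n) * (t_ n.+1 + t_ n)).
  by rewrite (t_S n.+1) [X in _ - X]t_S; ring.
rewrite nrmZr ger0_norm ?invr_ge0 // ler_wpM2l ?invr_ge0 //.
rewrite (le_trans (nrmM _ _)) // ler_pM ?nrm_ge0 //.
by rewrite (le_trans (nrmD _ _)) // lerD.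
Qed.

Let y_dist n d : nrm (y_ (d + n) - y_ n) <= t_ (d + n) - t_ n.
Proof.
elim: d => [|d IH]; first by rewrite !subrr nrm0.
rewrite -(subrKA (y_ (d + n))) -[leRHS](subrKA (t_ (d + n))).
by rewrite (le_trans (nrmD _ _)) // lerD // addSn y_step.
Qed.

(** The dominating scalar sequence increases and is bounded by 1. *)
Let y_cauchy : cauchys y_.
Proof.
have nd d n : t_ n <= t_ (d + n).
  by rewrite -subr_ge0 (le_trans _ (y_dist n d)) ?nrm_ge0.
pose T := [set t_ n | n in setT].
have supT : has_sup T.
  split; first by exists (t_ 0%N), 0%N.
  by exists 1 => _ [n _ <-]; case/andP: (t_itv n).
move=> e e0; have [_ [N _ <-] hN] := sup_adherent (half_gt0 e0) supT.
have key n : (N <= n)%N -> nrm (y_ n - y_ N) <= e / 2.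
  move=> Nn; rewrite -(subnK Nn); apply: le_trans (y_dist _ _) _.
  rewrite lerBlDr -lerBlDl (le_trans _ (ltW hN)) // lerB //.
  by apply: sup_upper_bound => //; exists (n - N + N)%N.
exists N => m n Nm Nn; rewrite -(subrKA (y_ N)) (splitr e).
by rewrite (le_trans (nrmD _ _)) // lerD ?key // nrmB key.
Qed.

(* [1 - y] is the limit of the Newton-type iteration for the square root of
   [1 - h]; the same iteration for the scalar [h = 1] dominates it. *)
Lemma sqrt1B : exists y, [/\ star y = y, y ** y = y + y - h, nrm y <= 1 &
  forall c, c ** h = h ** c -> c ** y = y ** c].
Proof.
have [y hy] := cauchys_cvs y_cauchy; exists y; split.
- apply: (cvs_uniq _ hy); apply: (cvs_ext _ (cvs_star hy)) => n /=.
  elim: n => [|n IH] /=; first by rewrite star0.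
  by rewrite starZr starD h_sa starM IH.
- have ey : y = (2^-1)%:C *: (h + y ** y).
    apply: (cvs_uniq (cvs_shift hy)).
    by apply: cvsZ; apply: cvsD; [apply: cvs_cst|apply: cvsM].
  have -> : y + y = h + y ** y by rewrite -[RHS]half_double scalerDr -ey.
  by rewrite addrC addKr.
- by apply: (cvs_nrm_le hy) => n; apply: le_trans (y_nrm n) _; case/andP: (t_itv n).
- move=> c hc; apply: (cvs_uniq (cvsM (cvs_cst c) hy)).
  by apply: (cvs_ext _ (cvsM hy (cvs_cst c))) => n; rewrite y_comm.
Qed.

End SquareRoot.

End CStarNorm.

(** * Positivity in unital C*-algebras *)

Lemma subr_double_cancel (V : zmodType) (e y q : V) :
  e - y - (y - (y + y - q)) = e - q.
Proof. by rewrite opprB [y + y - q - y]addrAC addrK subrKA. Qed.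

Section Positivity.
Variables (R : realType) (A : cstarAlgType R) (e : A) (he : is_unit e).
Implicit Types (a b c h k q r s x y z : A) (t : R).

Let mul1s a : e ** a = a. Proof. by case: (he a). Qed.
Let muls1 a : a ** e = a. Proof. by case: (he a). Qed.
Let star_e : star e = e := star_uniq_unit he.

Lemma nrm_unit : nrm e <= 1.
Proof.
have := nrm_sq star_e; rewrite mul1s; have := nrm_ge0 e; nra.
Qed.

(** For commuting self-adjoint [x] and [y], the element [u = x + i y] satisfies
    [u^* u = x^2 + y^2 = t], and [x] is the real part of [u]. This estimate takes the place of the
    functional calculus. *)
Lemma nrm_le_sum_sq x y t : 0 <= t -> star x = x -> star y = y ->
  x ** y = y ** x -> x ** x + y ** y = t%:C *: e -> nrm x ^+ 2 <= t.
Proof.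
move=> t0 hx hy xy xxyy; pose u := x + 'i *: y.
have su : star u = x - 'i *: y by rewrite starD starZ hx hy conjCi scaleNr.
have uu : star u ** u = t%:C *: e.
  rewrite su mulsBl !smulDr -xxyy smulZr !smulZl smulZr scalerA.
  by rewrite -expr2 sqrCi scaleN1r xy opprD addrA addrK opprK.
have nu : nrm u ^+ 2 <= t.
  rewrite -nrm_cstar uu nrmZr ger0_norm //.
  by rewrite -[leRHS]mulr1 ler_wpM2l // nrm_unit.
have : nrm x <= nrm u.
  have -> : x = (2^-1)%:C *: (u + star u).
    by rewrite su addrACA subrr addr0 half_double.
  rewrite nrmZr ger0_norm ?invr_ge0 //.
  have := nrmD u (star u); rewrite nrm_star; lra.
have := nrm_ge0 x; nra.
Qed.

(** The root [e - y] of [e - h^2] commutes with [h], and the two squares add up to [e]. *)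
Lemma nrm_1Bsq h : star h = h -> nrm h <= 1 -> nrm (e - h ** h) <= 1.
Proof.
move=> hh h1.
have [||y [sy yy _ cy]] := @sqrt1B R A (h ** h).
- by rewrite starM hh.
- by rewrite nrm_sq // exprn_ile1 ?nrm_ge0.
have rr : (e - y) ** (e - y) = e - h ** h.
  rewrite mulsBl !mulsBr !mul1s muls1 yy.
  exact: subr_double_cancel.
have sr : star (e - y) = e - y by rewrite starB star_e sy.
rewrite -rr nrm_sq //; apply: (@nrm_le_sum_sq _ h) => //.
- by rewrite mulsBl mulsBr mul1s muls1 cy // smulA.
- by rewrite rr scale1r subrK.
Qed.

(* [a] is positive in the sense of the norm; that this is the same as being a
   square makes the squares a convex cone. *)
Definition npos a := star a = a /\ exists2 t, 0 < t & nrm (t%:C *: e - a) <= t.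

Lemma Pos_npos a : Pos a -> npos a.
Proof.
move=> [s ss ->]; split; first by rewrite starM ss.
pose c := (nrm s + 1)^-1.
have n0 := nrm_ge0 s.
have c0 : 0 < c by rewrite invr_gt0 ltr_wpDl.
exists (c ^- 2); first by rewrite invr_gt0 exprn_gt0.
have cs : nrm (c%:C *: s) <= 1.
  by rewrite nrmZr gtr0_norm // mulrC ler_pdivrMr ?mul1r ?lerDl ?ltr_wpDl.
have -> : (c ^- 2)%:C *: e - s ** s =
    (c ^- 2)%:C *: (e - (c%:C *: s) ** (c%:C *: s)).
  have cc : (c ^- 2)%:C * (c%:C * c%:C) = 1 :> R[i].
    by rewrite -!rmorphM /= -expr2 mulVf // expf_neq0 // gt_eqF.
  by rewrite smulZl smulZr scalerBr !scalerA cc scale1r.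
rewrite nrmZr gtr0_norm ?invr_gt0 ?exprn_gt0 // -[leRHS]mulr1.
rewrite ler_wpM2l ?invr_ge0 ?exprn_ge0 ?(ltW c0) //.
by rewrite nrm_1Bsq // starZr ss.
Qed.

(** With [a = t (e - h)] and [|h| <= 1], the root is [sqrt t (e - y)], where [e - y] is the root of
    [e - h]; [|y| <= 1] makes this root positive in turn. *)
Lemma npos_root a : npos a -> exists r, [/\ npos r, r ** r = a &
  forall c, c ** a = a ** c -> c ** r = r ** c].
Proof.
move=> [sa [t t0 ta]]; pose h := e - t^-1%:C *: a.
have aE : a = t%:C *: (e - h).
  by rewrite subKr scalerA -rmorphM mulfV ?scale1r // gt_eqF.
have [||y [sy yy y1 cy]] := @sqrt1B R A h.
- by rewrite starB star_e starZr sa.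
- have -> : h = t^-1%:C *: (t%:C *: e - a).
    by rewrite scalerBr scalerA -rmorphM mulVf ?scale1r // gt_eqF.
  rewrite nrmZr gtr0_norm ?invr_gt0 // mulrC ler_pdivrMr //.
  by rewrite mul1r.
pose w := Num.sqrt t; have w0 : 0 < w by rewrite sqrtr_gt0.
have ww : w * w = t by rewrite -expr2 sqr_sqrtr // ltW.
exists (w%:C *: (e - y)); split.
- split; first by rewrite starZr starB star_e sy.
  exists w => //; rewrite -scalerBr subKr nrmZr gtr0_norm //.
  by rewrite -[leRHS]mulr1 ler_wpM2l // ltW.
- rewrite smulZl smulZr scalerA -rmorphM ww aE; congr (_ *: _).
  rewrite mulsBl !mulsBr !mul1s muls1 yy.
  exact: subr_double_cancel.
- move=> c ca; rewrite smulZl smulZr mulsBl mulsBr mul1s muls1 cy //.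
  by rewrite mulsBl mulsBr mul1s muls1 smulZl smulZr ca.
Qed.

Lemma npos_Pos a : npos a -> Pos a.
Proof. by move=> /npos_root[r [[sr _] <- _]]; exists r. Qed.

Lemma Pos_root a : Pos a -> exists r, [/\ Pos r, star r = r, r ** r = a &
  forall c, c ** a = a ** c -> c ** r = r ** c].
Proof.
move=> /Pos_npos /npos_root [r [nr ra cr]]; exists r; split=> //.
  exact: npos_Pos.
by case: nr.
Qed.

Lemma PosD a b : Pos a -> Pos b -> Pos (a + b).
Proof.
move=> /Pos_npos[sa [t t0 ta]] /Pos_npos[sb [u u0 ub]]; apply: npos_Pos.
split; first by rewrite starD sa sb.
exists (t + u); first by rewrite addr_gt0.
rewrite rmorphD scalerDl opprD addrACA (le_trans (nrmD _ _)) //.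
by rewrite lerD.
Qed.

Lemma Pos0 : Pos (0 : A).
Proof. by exists 0; rewrite ?star0 ?muls0. Qed.

Lemma PosZ t a : 0 <= t -> Pos a -> Pos (t%:C *: a).
Proof.
move=> t0 [s ss ->]; exists ((Num.sqrt t)%:C *: s); first by rewrite starZr ss.
by rewrite smulZl smulZr scalerA -rmorphM -expr2 sqr_sqrtr.
Qed.

(** Since [q = - s^2] commutes with [s], so does its root [m]; then [s^2 + m^2 = 0] is the case
    [t = 0] of [nrm_le_sum_sq]. *)
Lemma sq_Pos_eq0 s q : star s = s -> Pos q -> s ** s + q = 0 -> s = 0.
Proof.
move=> ss /Pos_root[m [_ sm mm cm]] sq.
have sm_comm : s ** m = m ** s.
  apply: cm; have -> : q = - (s ** s) by apply/eqP; rewrite -addr_eq0 addrC sq.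
  by rewrite mulsN mulNs smulA.
have n0 : nrm s ^+ 2 <= 0.
  by apply: (@nrm_le_sum_sq s m) => //; rewrite scale0r mm.
apply: nrm0_eq0; apply/eqP; rewrite -sqrf_eq0; apply/eqP/le_anti.
by rewrite n0 exprn_ge0 ?nrm_ge0.
Qed.

Lemma Pos_add_eq0 a b : Pos a -> Pos b -> a + b = 0 -> a = 0.
Proof.
by move=> [s ss ->] pb /(sq_Pos_eq0 ss pb) ->; rewrite muls0.
Qed.

(* Kelley-Vaught.  With [h = x^* x] and [n = |h| - h] (twice the negative part
   of [h]), [y = x n] satisfies [y^* y = - k^2]; for [z = y k] both [z^* z] and
   [z z^*] are then negatives of squares, while their sum is a sum of squares. *)
Lemma Pos_star_mul x : Pos (star x ** x).
Proof.
set h := star x ** x.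
have sh : star h = h by rewrite starM starK.
have [|r [pr sr rr cr]] := @Pos_root (h ** h); first by exists h.
have hr : h ** r = r ** h by apply: cr; rewrite smulA.
have [s [_ ss s2 cs]] := Pos_root pr.
pose n := r - h.
have sn : star n = n by rewrite starB sr sh.
have hn : h ** n = - (r ** n) by rewrite !mulsBr hr -rr opprB.
have nn : n ** n = r ** n + r ** n by rewrite {1}/n mulsBl hn opprK.
have nr : n ** r = r ** n by rewrite mulsBl mulsBr hr.
have sn_comm : n ** s = s ** n by apply: cs.
pose k := s ** n.
have sk : star k = k by rewrite starM ss sn sn_comm.
have kk : k ** k = r ** n ** n.
  by rewrite /k smulA -[s ** n ** s]smulA sn_comm smulA s2.
pose y := x ** n.
have yy : star y ** y = - (k ** k).
  rewrite [star y]starM sn /y smulA -[n ** star x ** x]smulA -/h -smulA hn.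
  by rewrite mulsN smulA nr kk.
pose z := y ** k; pose w := y ** star y.
have zz : star z ** z = - ((k ** k) ** (k ** k)).
  by rewrite [star z]starM sk /z smulA -[k ** star y ** y]smulA yy mulsN mulNs !smulA.
have zz' : z ** star z = - (w ** w).
  rewrite [star z]starM sk /z smulA -[y ** k ** k]smulA.
  have -> : k ** k = - (star y ** y) by rewrite yy opprK.
  by rewrite mulsN mulNs /w !smulA.
have sw : star w = w by rewrite starM starK.
have pa : Pos (repart z ** repart z) by exists (repart z); rewrite ?repart_sa.
have pb : Pos (impart z ** impart z) by exists (impart z); rewrite ?impart_sa.
have pw : Pos (w ** w) by exists w.
have pab := PosD pa pb.
have kk0 : k ** k = 0.
  apply: (@sq_Pos_eq0 _ _ _ (PosD pw (PosD pab pab))); first by rewrite starM sk.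
  rewrite cartesian_sq -scalerDr half_double zz zz'.
  by rewrite addrA addrA addrK addrN.
have k0 : k = 0 by apply: sa_sq0.
have n0 : n = 0.
  apply: sa_sq0 => //; apply: sa_sq0; first by rewrite starM sn.
  by rewrite {1}nn smulDl !smulA -kk k0 muls0 mulr0s addr0.
by move/eqP: n0; rewrite subr_eq0 => /eqP <-.
Qed.

Lemma Pos_conj a x : Pos a -> Pos (star x ** a ** x).
Proof.
move=> [s ss ->]; have := Pos_star_mul (s ** x).
by rewrite starM ss !smulA.
Qed.

Lemma Pos_nrm_sub a t : star a = a -> nrm a <= t -> Pos (t%:C *: e - a).
Proof.
move=> sa; have [/eqP|n0] := eqVneq (nrm a) 0.
  rewrite nrm_eq0 => /eqP ->; rewrite nrm0 subr0 => t0; apply: PosZ => //.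
  by exists e => //; rewrite mul1s.
move=> nt; apply: npos_Pos; split; first by rewrite starB starZr star_e sa.
exists t; last by rewrite subKr.
by apply: lt_le_trans nt; rewrite lt_neqAle nrm_ge0 eq_sym n0.
Qed.

(** The roots of [h] and of [t - h] commute, and their squares add up to [t]. *)
Lemma nrm_le_Pos h t : 0 <= t -> Pos h -> Pos (t%:C *: e - h) -> nrm h <= t.
Proof.
move=> t0 /Pos_root[r [_ sr rr cr]] /Pos_root[s [_ ss s2 cs]].
have hr : h ** r = r ** h by apply: cr.
rewrite -rr nrm_sq //; apply: (@nrm_le_sum_sq _ s) => //.
  by apply: cs; rewrite mulsBl mulsBr smulZl smulZr mul1s muls1 hr.
by rewrite rr s2 addrC subrK.
Qed.

(* The hypothesis on [f i k] is the part of positivity which is common to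
   C*-algebras and to matrix algebras. *)
Lemma Pos_detect (I : Type) (B : I -> starAlgType R)
    (f : forall i, starhom A (B i)) k :
  star k = k ->
  (forall a, (forall i, f i a = 0) -> a = 0) ->
  (forall i (d z : B i), star d = d ->
    d ** f i k ** d + star z ** z = 0 -> star z ** z = 0) ->
  Pos k.
Proof.
move=> sk finj fk.
have [|r [pr sr rr cr]] := @Pos_root (k ** k); first by exists k.
have kr : k ** r = r ** k by apply: cr; rewrite smulA.
have [q sq rE] := pr.
(* [r] is the absolute value of [k] and [d] is twice its negative part. From [d (r + k) = 0] and
   [r = q q] follows [d k d = - (q d)^* (q d)], and the hypothesis then makes every [f i] vanish on
   the right-hand side. *)
have [d dE] : exists d, d = r - k by exists (r - k).
have sd : star d = d by rewrite dE starB sr sk.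
have rk : d ** (r + k) = 0.
  by rewrite dE mulsBl !smulDr rr kr [r ** k + _]addrC subrr.
have drk : d ** k ** d + star (q ** d) ** (q ** d) = 0.
  rewrite starM sq sd -[d ** q ** _]smulA [q ** (q ** d)]smulA -rE smulA.
  by rewrite -smulDl -smulDr [k + r]addrC rk mulr0s.
have qd : star (q ** d) ** (q ** d) = 0.
  apply: finj => i; rewrite starhomM starhom_star.
  apply: (fk i (f i d)); first by rewrite -starhom_star sd.
  by rewrite -starhom_star -!starhomM -starhomD drk starhom0.
have dkd : d ** k ** d = 0 by move: drk; rewrite qd addr0.
have d3 : d ** d ** d = 0.
  have -> : d ** d ** d = d ** r ** d - d ** k ** d.
    by rewrite -mulsBl -mulsBr -dE.
  by rewrite dkd subr0 rE !smulA -[RHS]qd starM sq sd !smulA.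
have d0 : d = 0.
  apply: sa_sq0 => //; apply: sa_sq0; first by rewrite starM sd.
  by rewrite smulA d3 mulr0s.
by move/eqP: d0; rewrite dE subr_eq0 => /eqP <-.
Qed.

End Positivity.

(** * The Hahn-Banach theorem and states *)

Section HahnBanach.
Variables (R : realType) (V : lmodType R[i]).
Implicit Types (v w x : V) (t : R) (p q : V -> R).

Definition sublinear p := (forall v w, p (v + w) <= p v + p w) /\
  (forall t v, 0 <= t -> p (t%:C *: v) <= t * p v).

Definition real_linear (f : V -> R) := (forall v w, f (v + w) = f v + f w) /\
  (forall t v, f (t%:C *: v) = t * f v).

Lemma sublinear0 p : sublinear p -> p 0 = 0.
Proof.
move=> [pD pZ]; apply/le_anti/andP; split.
  by have := pZ 0 0 (lexx _); rewrite scale0r mul0r.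
by have := pD 0 0; rewrite addr0; lra.
Qed.

Lemma sublinearZ p t v : sublinear p -> 0 <= t -> p (t%:C *: v) = t * p v.
Proof.
move=> sp; rewrite le_eqVlt => /predU1P[<-|t0].
  by rewrite scale0r sublinear0 // mul0r.
apply/le_anti; rewrite sp.2 ?(ltW t0) //=.
have := sp.2 t^-1 (t%:C *: v); rewrite invr_ge0 => /(_ (ltW t0)).
by rewrite scalerA -rmorphM /= mulVf ?gt_eqF // scale1r ler_pdivlMl.
Qed.

Lemma sublinear_lb p v w : sublinear p -> p v - p (- w) <= p (v + w).
Proof. by move=> [pD _]; have := pD (v + w) (- w); rewrite addrK; lra. Qed.

(* The infimal functional below is the largest sublinear [q <= p] whose value
   at [- x] is at most [- p x]. *)
Definition tilt p x v := inf [set p (v + t%:C *: x) - t * p x | t in [set t | 0 <= t]].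

Lemma tilt_le p x v t : sublinear p -> 0 <= t ->
  tilt p x v <= p (v + t%:C *: x) - t * p x.
Proof.
move=> sp t0; apply: ge_inf; last by exists t.
exists (- p (- v)) => _ [u /= u0 <-].
by have := sublinear_lb (u%:C *: x) v sp; rewrite sublinearZ // [_ + v]addrC; lra.
Qed.

Lemma le_tilt p x v c :
  (forall t, 0 <= t -> c <= p (v + t%:C *: x) - t * p x) -> c <= tilt p x v.
Proof.
move=> h; apply: lb_le_inf; first by exists (p (v + 0%:C *: x) - 0 * p x), 0 => /=.
by move=> _ [t t0 <-]; apply: h.
Qed.

Lemma tilt_sublinear p x : sublinear p -> sublinear (tilt p x).
Proof.
move=> sp; split=> [v w|s v s0].
- rewrite -lerBlDr; apply: le_tilt => t t0; rewrite lerBlDr -lerBlDl.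
  apply: le_tilt => u u0; rewrite lerBlDl.
  apply: le_trans (tilt_le x (v + w) sp (addr_ge0 t0 u0)) _.
  rewrite rmorphD /= scalerDl addrACA.
  have := sp.1 (v + t%:C *: x) (w + u%:C *: x); lra.
- move: s0; rewrite le_eqVlt => /predU1P[<-|s0].
    rewrite scale0r mul0r (le_trans (tilt_le x 0 sp (lexx _))) //.
    by rewrite scale0r addr0 sublinear0 // mul0r subr0.
  rewrite mulrC -ler_pdivrMr //; apply: le_tilt => t t0.
  rewrite ler_pdivrMr //.
  apply: le_trans (tilt_le x _ sp (mulr_ge0 (ltW s0) t0)) _.
  rewrite rmorphM /= -scalerA -scalerDr sublinearZ ?(ltW s0) //; lra.
Qed.

(** By Zorn's lemma. Every sublinear functional below [p] is at least [- p (- v)] at [v], so the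
    pointwise infimum of a chain is finite; it stays subadditive because any two members of the
    chain are comparable. *)
Lemma minimal_sublinear p : sublinear p -> exists q, [/\ sublinear q,
  forall v, q v <= p v &
  forall q', sublinear q' -> (forall v, q' v <= q v) -> forall v, q v <= q' v].
Proof.
move=> sp.
pose T := {q | sublinear q /\ forall v, q v <= p v}.
have tp : sublinear p /\ forall v, p v <= p v by [].
pose rl (q q' : T) := `[< forall v, sval q' v <= sval q v >].
have [||C totC|[q [sq qp]] qmin] := @ZL_preorder T (exist _ p tp) rl.
- by move=> q; apply/asboolP.
- move=> r s t /asboolP sr /asboolP ts; apply/asboolP => v.
  exact: le_trans (ts v) (sr v).
- have [C0|/set0P[q0 Cq0]] := eqVneq C set0.
    by exists (exist _ p tp) => s; rewrite C0.
  pose m v := inf [set sval q v | q in C].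
  have m_le (q : T) v : C q -> m v <= sval q v.
    move=> Cq; apply: ge_inf; last by exists q.
    exists (- p (- v)) => _ [r _ <-]; case: r => r [sr rp] /=.
    have := sr.1 v (- v); rewrite subrr sublinear0 //.
    by have := rp (- v); lra.
  have le_inf_m c v : (forall q : T, C q -> c <= sval q v) -> c <= m v.
    move=> h; apply: lb_le_inf; first by exists (sval q0 v), q0.
    by move=> _ [r Cr <-]; apply: h.
  have sm : sublinear m.
    split=> [v w|t v t0].
      rewrite -lerBlDr; apply: (le_inf_m) => q Cq; rewrite lerBlDr -lerBlDl.
      apply: (le_inf_m) => r Cr; rewrite lerBlDl.
      have [/asboolP qr|/asboolP qr] := totC _ _ Cq Cr.
        apply: le_trans (m_le _ _ Cr) _.
        apply: le_trans ((svalP r).1.1 v w) _.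
        by rewrite lerD2r.
      apply: le_trans (m_le _ _ Cq) _.
      apply: le_trans ((svalP q).1.1 v w) _.
      by rewrite lerD2l.
    move: t0; rewrite le_eqVlt => /predU1P[<-|t0].
      rewrite scale0r mul0r (le_trans (m_le _ _ Cq0)) //.
      by rewrite sublinear0 //; exact: (svalP q0).1.
    rewrite mulrC -ler_pdivrMr //; apply: (le_inf_m) => q Cq.
    rewrite ler_pdivrMr // (le_trans (m_le _ _ Cq)) // mulrC.
    by apply: (svalP q).1.2; apply: ltW.
  have tm : sublinear m /\ forall v, m v <= p v.
    split=> // v; apply: le_trans (m_le _ _ Cq0) _.
    exact: (svalP q0).2.
  exists (exist _ m tm) => q Cq; apply/asboolP => v /=; exact: m_le.
- exists q; split=> // q' sq' q'q.
  have t' : sublinear q' /\ forall v, q' v <= p v.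
    by split=> // v; apply: le_trans (q'q v) (qp v).
  by have /asboolP := qmin (exist _ q' t') (asboolT q'q).
Qed.

(* A minimal sublinear functional is linear, because tilting cannot decrease
   it. *)
Lemma hahn_banach p v0 : sublinear p -> exists f : V -> R,
  [/\ real_linear f, forall v, f v <= p v & f v0 = p v0].
Proof.
move=> sp; have [f [sf fp fmin]] := minimal_sublinear (tilt_sublinear v0 sp).
have tilt1 q x v : sublinear q -> tilt q x v <= q v.
  move=> sq; apply: le_trans (tilt_le x v sq (lexx _)) _.
  by rewrite scale0r addr0 mul0r subr0.
have fD v w : f (v + w) = f v + f w.
  apply/le_anti; rewrite sf.1 /=.
  have := fmin _ (tilt_sublinear w sf) (fun v => tilt1 f w v sf) v.
  have := tilt_le w v sf ler01; rewrite scale1r mul1r; lra.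
have fN v : f (- v) = - f v.
  by apply/eqP; rewrite -addr_eq0 -fD addNr sublinear0.
have fle v : f v <= p v by apply: le_trans (fp v) (tilt1 _ _ _ sp).
exists f; split=> //.
  split=> // t v; have [t0|t0] := leP 0 t; first exact: sublinearZ.
  apply/eqP; rewrite -eqr_opp -fN -mulNr -scaleNr -rmorphN /=.
  by rewrite sublinearZ // oppr_ge0 ltW.
apply/le_anti; rewrite fle /= -[leRHS]opprK -fN lerNr.
have := le_trans (fp (- v0)) (tilt_le v0 (- v0) sp ler01).
by rewrite scale1r addNr sublinear0 // mul1r add0r.
Qed.

(** The [N]-distance to [S] is sublinear, lies below [N], is at most 0 on [S] and at least [e] at
    [w0]; Hahn-Banach gives a linear functional below it with the same value at [w0]. *)
Lemma cone_separation (N : V -> R) (S : set V) w0 e :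
  sublinear N -> (forall v, 0 <= N v) ->
  S 0 -> (forall v w, S v -> S w -> S (v + w)) ->
  (forall t v, 0 < t -> S v -> S (t%:C *: v)) ->
  0 < e -> (forall s, S s -> e <= N (w0 - s)) ->
  exists f : V -> R, [/\ real_linear f, forall v, f v <= N v,
    forall s, S s -> f s <= 0 & 0 < f w0].
Proof.
move=> sN N0 S0 SD SZ e0 hw.
pose p v := inf [set N (v - s) | s in S].
have p_le v s : S s -> p v <= N (v - s).
  by move=> Ss; apply: ge_inf; [exists 0 => _ [u _ <-]|exists s].
have le_p c v : (forall s, S s -> c <= N (v - s)) -> c <= p v.
  move=> h; apply: lb_le_inf; first by exists (N (v - 0)), 0.
  by move=> _ [s Ss <-]; apply: h.
have sp : sublinear p.
  split=> [v w|t v].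
    rewrite -lerBlDr; apply: (le_p) => s Ss; rewrite lerBlDr -lerBlDl.
    apply: (le_p) => u Su; rewrite lerBlDl (le_trans (p_le _ _ (SD _ _ Ss Su))) //.
    by rewrite opprD addrACA sN.1.
  rewrite le_eqVlt => /predU1P[<-|t0].
    by rewrite scale0r mul0r (le_trans (p_le _ _ S0)) // subr0 sublinear0.
  rewrite mulrC -ler_pdivrMr //; apply: (le_p) => s Ss; rewrite ler_pdivrMr //.
  rewrite (le_trans (p_le _ _ (SZ _ _ t0 Ss))) // -scalerBr mulrC.
  exact/sN.2/ltW.
have [f [lf fp f0]] := hahn_banach w0 sp.
exists f; split=> //.
- by move=> v; rewrite (le_trans (fp v)) // (le_trans (p_le v 0 S0)) // subr0.
- by move=> s Ss; rewrite (le_trans (fp s)) // (le_trans (p_le s s Ss)) // subrr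
    sublinear0.
- by rewrite f0 (lt_le_trans e0) // le_p.
Qed.

End HahnBanach.

Section Complexification.
Variables (R : realType) (V : lmodType R[i]) (f : V -> R).
Hypothesis lf : real_linear f.

Definition complexify (v : V) : R[i] := (f v)%:C - 'i * (f ('i *: v))%:C.

Lemma real_linearN v : f (- v) = - f v.
Proof. by have := lf.2 (- 1) v; rewrite rmorphN1 scaleN1r mulN1r. Qed.

Lemma Re_complexify v : complex.Re (complexify v) = f v.
Proof.
by rewrite /complexify -complexiE /= !mul0r !mulr0 subrr oppr0 addr0.
Qed.

Lemma complexifyD v w : complexify (v + w) = complexify v + complexify w.
Proof. by rewrite /complexify scalerDr !lf.1 !rmorphD /= mulrDr opprD addrACA. Qed.

Lemma complexifyZ k v : complexify (k *: v) = k * complexify v.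
Proof.
have real (t : R) w : complexify (t%:C *: w) = t%:C * complexify w.
  have e : 'i *: (t%:C *: w) = t%:C *: ('i *: w) by rewrite !scalerA mulrC.
  by rewrite /complexify e !lf.2 !rmorphM /= mulrBr mulrCA.
have imag w : complexify ('i *: w) = 'i * complexify w.
  rewrite /complexify scalerA -expr2 sqrCi scaleN1r real_linearN rmorphN /=.
  by rewrite mulrBr mulrA -expr2 sqrCi mulN1r mulrN !opprK addrC.
have -> : k = (complex.Re k)%:C + 'i * (complex.Im k)%:C.
  by rewrite {1}(complexE k) complexiE.
by rewrite scalerDl complexifyD -scalerA imag !real mulrDl mulrA.
Qed.

End Complexification.

(** For positive [q] one has [|h + q| >= |h|] with [h = x^* x], so [h] stays at distance at least
    [|h|] from the negatives of positive elements, and a functional separating it from them is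
    positive. It is not normalised. *)
Lemma exists_state (R : realType) (A : cstarAlgType R) (e : A) (he : is_unit e)
    (x : A) : x != 0 -> exists phi : A -> R[i],
  [/\ forall a b, phi (a + b) = phi a + phi b,
      forall k a, phi (k *: a) = k * phi a,
      forall a, phi (star a) = Num.conj (phi a),
      forall a, 0 <= phi (star a ** a) & 0 < phi (star x ** x)].
Proof.
move=> x0; pose h := star x ** x.
have h0 : 0 < nrm h.
  by rewrite nrm_cstar exprn_gt0 // nrm_gt0 x0.
have sh : star h = h by rewrite starM starK.
have ph : Pos h by apply: Pos_star_mul he _.
have [|||||f [lf fle fS fh]] := @cone_separation R A (@nrm R A)
    [set - q | q in @Pos R A] h (nrm h) _ (@nrm_ge0 R A) _ _ _ h0.
- by split=> [v w|t v t0]; rewrite ?nrmD // nrmZr ger0_norm.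
- by exists 0; rewrite ?oppr0 //; exact: Pos0.
- move=> _ _ [a pa <-] [b pb <-]; exists (a + b); first exact: PosD he _ _ pa pb.
  by rewrite opprD.
- move=> t _ t0 [a pa <-]; exists (t%:C *: a); last by rewrite scalerN.
  by apply: PosZ => //; exact: ltW.
- move=> _ [q pq <-]; rewrite opprK.
  apply: (nrm_le_Pos he (nrm_ge0 _) ph).
  have -> : (nrm (h + q))%:C *: e - h = (nrm (h + q))%:C *: e - (h + q) + q.
    by rewrite opprD addrA subrK.
  apply: (PosD he) => //; apply: (Pos_nrm_sub he) => //.
  by rewrite starD sh (Pos_sa pq).
(* Invariance under [star] makes the complexified functional hermitian. *)
pose g a := f a + f (star a).
have lg : real_linear g.
  split=> [a b|t a]; rewrite /g; first by rewrite starD !lf.1 addrACA.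
  by rewrite starZr !lf.2 mulrDr.
have gE a : star a = a -> complexify g a = (f a + f a)%:C.
  move=> sa; rewrite /complexify /g sa starZ sa conjCi scaleNr real_linearN //.
  by rewrite subrr mulr0 subr0.
exists (complexify g); split.
- exact: complexifyD.
- exact: complexifyZ.
- move=> a; have gs b : g (star b) = g b by rewrite /g starK addrC.
  rewrite /complexify rmorphB rmorphM /= !conj_realC conjCi gs mulNr opprK.
  rewrite -(gs ('i *: star a)) starZ starK conjCi scaleNr real_linearN //.
  by rewrite rmorphN mulrN opprK.
- move=> a; rewrite gE ?starM ?starK // ler0c.
  have pa : Pos (star a ** a) by apply: Pos_star_mul he _.
  have : f (- (star a ** a)) <= 0 by apply: fS; exists (star a ** a).
  by rewrite real_linearN //; lra.
- by rewrite gE // ltcR; move: fh; lra.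
Qed.

(** * Positive semidefinite Hermitian forms *)

Section SemiInner.
Variables (R : realType) (V : lmodType R[i]) (B : V -> V -> R[i]).
Hypotheses (BD : forall u v w, B (u + v) w = B u w + B v w)
  (BZ : forall k u v, B (k *: u) v = k * B u v)
  (BC : forall u v, B u v = Num.conj (B v u)) (B0 : forall u, 0 <= B u u).
Implicit Types (u v w : V).

(** The form may be degenerate: [sqn v = 0] takes the place of [v = 0], and no quotient is
    formed. *)
Definition sqn v : R := complex.Re (B v v).
Definition sn v : R := Num.sqrt (sqn v).

Lemma sqnE v : B v v = (sqn v)%:C.
Proof. by rewrite /sqn RRe_real // ger0_real. Qed.

Lemma sqn_ge0 v : 0 <= sqn v.
Proof. by rewrite -ler0c -sqnE. Qed.

Lemma sn_ge0 v : 0 <= sn v. Proof. exact: sqrtr_ge0. Qed.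

Lemma sn_sqr v : sn v ^+ 2 = sqn v.
Proof. by rewrite sqr_sqrtr ?sqn_ge0. Qed.

Lemma semi_Dr u v w : B u (v + w) = B u v + B u w.
Proof. by rewrite BC BD rmorphD /= -!BC. Qed.

Lemma semi_Zr k u v : B u (k *: v) = Num.conj k * B u v.
Proof. by rewrite BC BZ rmorphM /= -BC. Qed.

Lemma semi_0l v : B 0 v = 0.
Proof. by rewrite -(scale0r 0) BZ mul0r. Qed.

Lemma semi_0r v : B v 0 = 0.
Proof. by rewrite BC semi_0l conjC0. Qed.

Lemma semi_Nl u v : B (- u) v = - B u v.
Proof. by rewrite -scaleN1r BZ mulN1r. Qed.

Lemma semi_Nr u v : B u (- v) = - B u v.
Proof. by rewrite BC semi_Nl rmorphN /= -BC. Qed.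

Lemma semi_suml I (r : seq I) (P : pred I) (F : I -> V) v :
  B (\sum_(i <- r | P i) F i) v = \sum_(i <- r | P i) B (F i) v.
Proof.
by apply: (big_morph (fun u => B u v)) => [u w|]; rewrite ?BD ?semi_0l.
Qed.

Lemma semi_sumr I (r : seq I) (P : pred I) (F : I -> V) v :
  B v (\sum_(i <- r | P i) F i) = \sum_(i <- r | P i) B v (F i).
Proof. by apply: (big_morph (B v)) => [u w|]; rewrite ?semi_Dr ?semi_0r. Qed.

Lemma sqn0 : sqn 0 = 0. Proof. by rewrite /sqn semi_0l. Qed.

Lemma sqnZ k v : sqn (k *: v) = nrm k ^+ 2 * sqn v.
Proof.
apply: (@complexI R); rewrite -sqnE BZ semi_Zr rmorphM rmorphXn /= -normE -sqnE.
by rewrite mulrA normCK.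
Qed.

Lemma snZ k v : sn (k *: v) = nrm k * sn v.
Proof. by rewrite /sn sqnZ sqrtrM ?sqr_ge0 // sqrtr_sqr ger0_norm ?nrm_ge0. Qed.

Lemma snN v : sn (- v) = sn v.
Proof. by rewrite /sn /sqn semi_Nl semi_Nr opprK. Qed.

Lemma cauchy_schwarz v w : nrm (B v w) <= sn v * sn w.
Proof.
pose c := B v w; have [n nE] : exists n, n = nrm c ^+ 2 by exists (nrm c ^+ 2).
have cc : c * Num.conj c = n%:C by rewrite -normCK normE nE rmorphXn.
have key (t : R) : 0 <= sqn v - 2 * t * n + t ^+ 2 * n * sqn w.
  have := sqn_ge0 (v - (t%:C * c) *: w).
  rewrite -ler0c -sqnE BD semi_Dr semi_Nl !semi_Nr semi_Dr semi_Nr !BZ !semi_Zr.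
  rewrite opprB !sqnE (BC w v) -/c rmorphM /= conj_realC => h.
  rewrite -ler0c; apply: le_trans h _.
  rewrite le_eqVlt; apply/orP; left; apply/eqP.
  rewrite !(rmorphD, rmorphN, rmorphM, rmorphXn) /= -cc.
  ring.
have n0 : 0 <= n by rewrite nE sqr_ge0.
have nle : n <= sqn v * sqn w.
  have := sqn_ge0 w; rewrite le_eqVlt => /predU1P[w0|w0].
    rewrite -w0 mulr0 leNgt; apply/negP => np.
    (* For [sqn w = 0] the inequality is affine in [t], and this [t] gives its right-hand side the
       value -1. Otherwise the minimiser [1 / sqn w] is used. *)
    have := key ((sqn v + 1) / (2 * n)); rewrite -w0 mulr0 addr0.
    rewrite (_ : 2 * _ * n = sqn v + 1); first lra.
    by field; rewrite gt_eqF.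
  have := key (sqn w)^-1; rewrite (_ : _ + _ = sqn v - n / sqn w); last first.
    by field; rewrite gt_eqF.
  by rewrite subr_ge0 ler_pdivrMr.
rewrite -(@ler_pXn2r _ 2) ?nnegrE ?nrm_ge0 ?mulr_ge0 ?sn_ge0 //.
by rewrite -/c -nE exprMn !sn_sqr.
Qed.

Lemma snD v w : sn (v + w) <= sn v + sn w.
Proof.
rewrite -(@ler_pXn2r _ 2) ?nnegrE ?addr_ge0 ?sn_ge0 // sn_sqr sqrrD !sn_sqr.
have -> : sqn (v + w) = sqn v + 2 * complex.Re (B v w) + sqn w.
  apply: (@complexI R); rewrite -sqnE BD !semi_Dr !sqnE (BC w v).
  rewrite !rmorphD rmorphM /= (_ : 2%:C = 2) ?rmorph_nat //.
  rewrite -addcJ addrA; congr (_ + _); rewrite -!addrA; congr (_ + _).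
have : complex.Re (B v w) <= sn v * sn w.
  apply: le_trans (cauchy_schwarz v w); rewrite -lecR -normE.
  by apply: le_trans (normc_ge_Re _); rewrite lecR ler_norm.
by rewrite mulr2n; lra.
Qed.

Definition orthonormal_family (I : finType) (f : I -> V) :=
  forall i j, B (f i) (f j) = (i == j)%:R.

Lemma sqn_proj (I : finType) (f : I -> V) v : orthonormal_family f ->
  sqn (v - \sum_i B v (f i) *: f i) = sqn v - \sum_i nrm (B v (f i)) ^+ 2.
Proof.
move=> of_; set p := \sum_i _.
have pf i : B p (f i) = B v (f i).
  rewrite semi_suml (bigD1 i) //= big1 => [|j ji].
    by rewrite BZ of_ eqxx mulr1 addr0.
  by rewrite BZ of_ (negPf ji) mulr0.
have vp : B v p = (\sum_i nrm (B v (f i)) ^+ 2)%:C.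
  rewrite semi_sumr rmorph_sum /=; apply: eq_bigr => i _.
  by rewrite semi_Zr mulrC -normCK normE rmorphXn.
have pp : B p p = B v p.
  by rewrite !semi_sumr; apply: eq_bigr => i _; rewrite !semi_Zr pf.
apply: (@complexI R); rewrite -sqnE BD !semi_Dr !semi_Nl !semi_Nr opprK.
have pv : B p v = B v p by rewrite BC vp conj_realC.
by rewrite pv pp addNr addr0 rmorphB /= -sqnE vp.
Qed.

Lemma bessel (I : finType) (f : I -> V) v : orthonormal_family f ->
  \sum_i nrm (B v (f i)) ^+ 2 <= sqn v.
Proof. by move=> of_; rewrite -subr_ge0 -sqn_proj // sqn_ge0. Qed.

(** A vector whose remainder is null is not added to the family; hence each vector of [s] equals its
    expansion only up to a null vector. *)
Lemma gram_schmidt (s : seq V) : exists q (f : 'I_q -> V),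
  orthonormal_family f /\
  forall v, v \in s -> sqn (v - \sum_i B v (f i) *: f i) = 0.
Proof.
elim: s => [|v s [q [f [of_ sf]]]].
  by exists 0%N, (fun=> 0); split=> [[]|].
pose w := v - \sum_i B v (f i) *: f i.
have wf i : B w (f i) = 0.
  rewrite BD semi_Nl semi_suml (bigD1 i) //= big1 => [|j ji].
    by rewrite BZ of_ eqxx mulr1 addr0 subrr.
  by rewrite BZ of_ (negPf ji) mulr0.
have [w0|w0] := eqVneq (sqn w) 0.
  exists q, f; split=> // u; rewrite inE => /predU1P[-> //|]; exact: sf.
have wp : 0 < sqn w by rewrite lt_neqAle eq_sym w0 sqn_ge0.
have swp : 0 < sn w by rewrite sqrtr_gt0.
pose u := (sn w)^-1%:C *: w.
pose g (i : 'I_q.+1) := if unlift ord0 i is Some j then f j else u.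
have g0 : g ord0 = u by rewrite /g unlift_none.
have gS j : g (lift ord0 j) = f j by rewrite /g liftK.
have uu : B u u = 1.
  rewrite sqnE sqnZ nrm_realC gtr0_norm ?invr_gt0 // -sn_sqr -exprMn mulVf.
    by rewrite expr1n.
  by rewrite gt_eqF.
have uf j : B u (f j) = 0 by rewrite BZ wf mulr0.
have og : orthonormal_family g.
  move=> i j; case: (unliftP ord0 i) => [i'|] ->; case: (unliftP ord0 j) => [j'|] ->.
  - by rewrite !gS of_ (inj_eq lift_inj).
  - by rewrite gS g0 BC uf conjC0.
  - by rewrite gS g0 uf.
  - by rewrite g0 uu eqxx.
exists q.+1, g; split=> // x; rewrite inE => /predU1P[->|xs].
  suff -> : v - \sum_i B v (g i) *: g i = 0 by rewrite sqn0.
  rewrite big_ord_recl g0 (eq_bigr (fun i => B v (f i) *: f i)) => [|i _]; last first.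
    by rewrite gS.
  rewrite opprD addrCA -/w.
  have vE : v = w + \sum_i B v (f i) *: f i by rewrite subrK.
  have -> : B v u = (sn w)%:C.
    rewrite vE BD semi_suml big1 ?addr0 => [|i _]; last first.
      by rewrite BZ (BC (f i)) uf conjC0 mulr0.
    rewrite semi_Zr conj_realC sqnE -rmorphM -sn_sqr expr2 mulrA mulVf ?mul1r //.
    by rewrite gt_eqF.
  by rewrite scalerA -rmorphM mulfV ?gt_eqF // scale1r addNr.
(* By the formula for the residual, enlarging the family can only decrease it. *)
have sx := sf x xs.
apply/le_anti; rewrite sqn_ge0 andbT -[leRHS]sx !sqn_proj // lerB //.
rewrite big_ord_recl [X in _ <= _ + X](eq_bigr (fun i => nrm (B x (f i)) ^+ 2)) => [|i _].
  by rewrite lerDr sqr_ge0.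
by rewrite gS.
Qed.

End SemiInner.

(** * Scalars, matrices and vectors *)

Lemma real_cauchy_cvg (R : realType) (u : nat -> R) :
  (forall e, 0 < e -> exists N, forall m n, (N <= m)%N -> (N <= n)%N ->
    `|u m - u n| <= e) ->
  exists l, forall e, 0 < e -> exists N, forall n, (N <= n)%N -> `|u n - l| <= e.
Proof.
move=> hu.
have cu : cauchy (u @ \oo).
  apply/cauchyP => e e0; have [N hN] := hu (e / 2) (half_gt0 e0).
  exists (u N); exists N => // n /= Nn; rewrite -ball_normE /=.
  by rewrite (le_lt_trans (hN _ _ (leqnn _) Nn)) // ltr_pdivrMr // ltr_pMr // ltr1n.
have /cvg_ex [l /cvgrPdist_le hl] : cvg (u @ \oo) by apply/cauchy_cvgP.
by exists l => e /hl [N _ hN]; exists N => n Nn; rewrite distrC; apply: hN.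
Qed.

Lemma nrm_Re (R : realType) (z : R[i]) : `|complex.Re z| <= nrm z.
Proof. by rewrite -lecR -normE normc_ge_Re. Qed.

Lemma nrm_Im (R : realType) (z : R[i]) : `|complex.Im z| <= nrm z.
Proof.
rewrite /nrm normc_def /= -sqrtr_sqr ler_wsqrtr //.
by rewrite lerDr sqr_ge0.
Qed.

Lemma nrm_le_ReIm (R : realType) (z : R[i]) :
  nrm z <= `|complex.Re z| + `|complex.Im z|.
Proof.
rewrite {1}(complexE z) (le_trans (nrmD _ _)) // nrmM_C !nrm_realC lerD //.
suff -> : nrm ('i%C : R[i]) = 1 by rewrite mul1r.
by rewrite /nrm normc_def /= expr0n add0r expr1n sqrtr1.
Qed.

Lemma ReB (R : realType) (z w : R[i]) :
  complex.Re (z - w) = complex.Re z - complex.Re w.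
Proof. by case: z w => [a b] []. Qed.

Lemma ImB (R : realType) (z w : R[i]) :
  complex.Im (z - w) = complex.Im z - complex.Im w.
Proof. by case: z w => [a b] []. Qed.

Lemma complex_cauchy_cvg (R : realType) (u : nat -> R[i]) :
  cauchys u -> exists l, cvs u l.
Proof.
move=> hu.
have [|a ha] := @real_cauchy_cvg R (fun n => complex.Re (u n)).
  move=> e /hu [N hN]; exists N => m n Nm Nn /=.
  by rewrite -ReB (le_trans (nrm_Re _)) // hN.
have [|b hb] := @real_cauchy_cvg R (fun n => complex.Im (u n)).
  move=> e /hu [N hN]; exists N => m n Nm Nn /=.
  by rewrite -ImB (le_trans (nrm_Im _)) // hN.
exists (Complex a b) => e e0.
have [N hN] := ha _ (half_gt0 e0); have [N' hN'] := hb _ (half_gt0 e0).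
exists (maxn N N') => n; rewrite geq_max => /andP[/hN h /hN' h'].
rewrite (le_trans (nrm_le_ReIm _)) // (splitr e) ReB ImB /= lerD //.
Qed.

(** The scalars under a name of their own, which carries the structure of a C*-algebra over
    [R[i]]. *)
Definition scal (R : realType) := R[i].

Section Scalars.
Variable R : realType.

HB.instance Definition _ := NormedModule.copy (scal R) R[i]^o.

HB.instance Definition _ := Uniform_isComplete.Build (scal R)
  (@complete_of_cauchys R (scal R) (@complex_cauchy_cvg R)).

Implicit Types (a b c : R[i]).

Fact scal_conjD a b : Num.conj (a + b) = Num.conj a + Num.conj b.
Proof. exact: rmorphD. Qed.
Fact scal_conjZ (k a : R[i]) : Num.conj (k * a) = Num.conj k * Num.conj a.
Proof. exact: rmorphM. Qed.
Fact scal_conjM a b : Num.conj (a * b) = Num.conj b * Num.conj a.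
Proof. by rewrite rmorphM mulrC. Qed.
Fact scalZl (k a b : R[i]) : k * a * b = k * (a * b).
Proof. by rewrite mulrA. Qed.
Fact scalZr (k a b : R[i]) : a * (k * b) = k * (a * b).
Proof. exact: mulrCA. Qed.

HB.instance Definition _ := @Lmodule_isStarAlg.Build R (scal R)
  *%R Num.conj (@mulrA R[i]) (@mulrDl R[i]) (@mulrDr R[i]) scalZl scalZr
  conjCK scal_conjD scal_conjZ scal_conjM.

Fact scal_normM (a b : scal R) : `|a ** b| <= `|a| * `|b|.
Proof. by rewrite -[`|a ** b|]/(`|(a : R[i]) * b|) normrM. Qed.

Fact scal_norm_cstar (a : scal R) : `|star a ** a| = `|a| ^+ 2.
Proof.
by rewrite -[LHS]/(`|Num.conj (a : R[i]) * a|) normrM norm_conjC expr2.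
Qed.

HB.instance Definition _ := StarAlg_isCStarAlg.Build R (scal R)
  scal_normM scal_norm_cstar.

End Scalars.

(** Products and sums of index types occur throughout, so matrices are indexed by arbitrary finite
    types, and their entries come from a *-algebra that may lack a unit. *)
Definition fmat (I : finType) (A : Type) := {ffun I * I -> A}.

Section FMat.
Variables (R : realType) (I : finType) (A : starAlgType R).

HB.instance Definition _ := GRing.Lmodule.copy (fmat I A) {ffun I * I -> A}.

Implicit Types (a b c : fmat I A).

Definition fmat_mul a b : fmat I A :=
  [ffun p => \sum_k a (p.1, k) ** b (k, p.2)].
Definition fmat_star a : fmat I A := [ffun p => star (a (p.2, p.1))].

Fact fmat_mulA a b c : fmat_mul a (fmat_mul b c) = fmat_mul (fmat_mul a b) c.
Proof.
apply/ffunP => p; rewrite !ffunE /=.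
under eq_bigr do rewrite ffunE muls_sumr.
under [RHS]eq_bigr do rewrite ffunE muls_suml.
rewrite exchange_big; apply: eq_bigr => k _; apply: eq_bigr => l _ /=.
by rewrite smulA.
Qed.

Fact fmat_mulDl a b c : fmat_mul (a + b) c = fmat_mul a c + fmat_mul b c.
Proof.
by apply/ffunP => p; rewrite !ffunE -big_split; apply: eq_bigr => k _;
  rewrite ffunE smulDl.
Qed.

Fact fmat_mulDr a b c : fmat_mul a (b + c) = fmat_mul a b + fmat_mul a c.
Proof.
by apply/ffunP => p; rewrite !ffunE -big_split; apply: eq_bigr => k _;
  rewrite ffunE smulDr.
Qed.

Fact fmat_mulZl (k : R[i]) a b : fmat_mul (k *: a) b = k *: fmat_mul a b.
Proof.
by apply/ffunP => p; rewrite !ffunE scaler_sumr; apply: eq_bigr => l _;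
  rewrite ffunE smulZl.
Qed.

Fact fmat_mulZr (k : R[i]) a b : fmat_mul a (k *: b) = k *: fmat_mul a b.
Proof.
by apply/ffunP => p; rewrite !ffunE scaler_sumr; apply: eq_bigr => l _;
  rewrite ffunE smulZr.
Qed.

Fact fmat_starK a : fmat_star (fmat_star a) = a.
Proof. by apply/ffunP => -[i j]; rewrite !ffunE starK. Qed.

Fact fmat_starD a b : fmat_star (a + b) = fmat_star a + fmat_star b.
Proof. by apply/ffunP => -[i j]; rewrite !ffunE starD. Qed.

Fact fmat_starZ (k : R[i]) a : fmat_star (k *: a) = Num.conj k *: fmat_star a.
Proof. by apply/ffunP => -[i j]; rewrite !ffunE starZ. Qed.

Fact fmat_starM a b :
  fmat_star (fmat_mul a b) = fmat_mul (fmat_star b) (fmat_star a).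
Proof.
apply/ffunP => -[i j]; rewrite !ffunE star_sum; apply: eq_bigr => k _.
by rewrite !ffunE starM.
Qed.

HB.instance Definition _ := Lmodule_isStarAlg.Build R (fmat I A)
  fmat_mulA fmat_mulDl fmat_mulDr fmat_mulZl fmat_mulZr
  fmat_starK fmat_starD fmat_starZ fmat_starM.

Lemma fmatM a b i j : (a ** b) (i, j) = \sum_k a (i, k) ** b (k, j).
Proof. by rewrite ffunE. Qed.

Lemma fmat_starE a i j : star a (i, j) = star (a (j, i)).
Proof. by rewrite ffunE. Qed.

Lemma fmatD a b p : (a + b) p = a p + b p. Proof. by rewrite ffunE. Qed.
Lemma fmatN a p : (- a) p = - a p. Proof. by rewrite ffunE. Qed.
Lemma fmatZ (k : R[i]) a p : (k *: a) p = k *: a p. Proof. by rewrite ffunE. Qed.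
Lemma fmat0 p : (0 : fmat I A) p = 0. Proof. by rewrite ffunE. Qed.

Definition fmat1 (e : A) : fmat I A := [ffun p => if p.1 == p.2 then e else 0].

Lemma fmat1_unit e : is_unit e -> is_unit (fmat1 e).
Proof.
move=> he a; split; apply/ffunP => -[i j]; rewrite fmatM.
  rewrite (bigD1 i) //= big1 ?addr0 => [|k ki]; rewrite ffunE /=.
    by rewrite eqxx; case: (he (a (i, j))).
  by rewrite eq_sym (negPf ki) mulr0s.
rewrite (bigD1 j) //= big1 ?addr0 => [|k kj]; rewrite [fmat1 _ _]ffunE /=.
  by rewrite eqxx; case: (he (a (i, j))).
by rewrite (negPf kj) muls0.
Qed.

End FMat.

Section Vectors.
Variables (R : realType) (I : finType).
Implicit Types (u v w : I -> R[i]) (a b : fmat I (scal R)) (k : R[i]).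

Definition ip v w : R[i] := \sum_i v i * Num.conj (w i).

Lemma ipD u v w : ip (u + v) w = ip u w + ip v w.
Proof. by rewrite /ip -big_split; apply: eq_bigr => i _; exact: mulrDl. Qed.

Lemma ipZ k u v : ip (k *: u) v = k * ip u v.
Proof. by rewrite /ip mulr_sumr; apply: eq_bigr => i _; rewrite mulrA. Qed.

Lemma ipC u v : ip u v = Num.conj (ip v u).
Proof.
rewrite /ip rmorph_sum /=; apply: eq_bigr => i _.
by rewrite rmorphM /= conjCK mulrC.
Qed.

Lemma ip_ge0 u : 0 <= ip u u.
Proof. by apply: sumr_ge0 => i _; rewrite mul_conjC_ge0. Qed.

Lemma ip_Dr u v w : ip u (v + w) = ip u v + ip u w.
Proof. exact: (semi_Dr ipD ipC). Qed.
Lemma ip_Zr k u v : ip u (k *: v) = Num.conj k * ip u v.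
Proof. exact: (semi_Zr ipZ ipC). Qed.
Lemma ip_0l v : ip 0 v = 0. Proof. exact: (semi_0l ipZ). Qed.
Lemma ip_0r v : ip v 0 = 0. Proof. exact: (semi_0r ipZ ipC). Qed.
Lemma ip_Nl u v : ip (- u) v = - ip u v. Proof. exact: (semi_Nl ipZ). Qed.
Lemma ip_Nr u v : ip u (- v) = - ip u v. Proof. exact: (semi_Nr ipZ ipC). Qed.

Lemma ip_suml J (r : seq J) (P : pred J) (F : J -> I -> R[i]) v :
  ip (\sum_(j <- r | P j) F j) v = \sum_(j <- r | P j) ip (F j) v.
Proof. exact: (semi_suml ipD ipZ). Qed.

Lemma ip_sumr J (r : seq J) (P : pred J) (F : J -> I -> R[i]) v :
  ip v (\sum_(j <- r | P j) F j) = \sum_(j <- r | P j) ip v (F j).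
Proof. exact: (semi_sumr ipD ipZ ipC). Qed.

Definition vn v : R := sn ip v.

Lemma ip_vn v : ip v v = (vn v ^+ 2)%:C.
Proof. by rewrite (sqnE ip_ge0) (sn_sqr ip_ge0). Qed.

Lemma vn_ge0 v : 0 <= vn v. Proof. exact: sn_ge0. Qed.
Lemma vnD v w : vn (v + w) <= vn v + vn w.
Proof. exact: (snD ipD ipZ ipC ip_ge0). Qed.
Lemma vnZ k v : vn (k *: v) = nrm k * vn v.
Proof. exact: (snZ ipZ ipC ip_ge0). Qed.
Lemma vn0 : vn 0 = 0. Proof. by rewrite /vn /sn (sqn0 ipZ) sqrtr0. Qed.

Lemma ip_cs v w : nrm (ip v w) <= vn v * vn w.
Proof. exact: (cauchy_schwarz ipD ipZ ipC ip_ge0). Qed.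

Lemma vn_sum J (r : seq J) (P : pred J) (F : J -> I -> R[i]) :
  vn (\sum_(j <- r | P j) F j) <= \sum_(j <- r | P j) vn (F j).
Proof.
elim/big_rec2: _ => [|j x v _ h]; first by rewrite vn0.
by rewrite (le_trans (vnD _ _)) // lerD2l.
Qed.

Lemma vn_eq0 v : vn v = 0 -> v = 0.
Proof.
move=> v0; have : ip v v = 0 by rewrite ip_vn v0 expr0n.
move=> /eqP; rewrite psumr_eq0 => [/allP h|i _]; last by rewrite mul_conjC_ge0.
apply/funext => i; apply/eqP; have := h i (mem_index_enum i).
by rewrite /= mul_conjC_eq0.
Qed.

Definition delta (j : I) : I -> R[i] := fun i => (i == j)%:R.

Lemma ip_delta v j : ip v (delta j) = v j.
Proof.
rewrite /ip (bigD1 j) //= big1 ?addr0 => [|i ij].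
  by rewrite /delta eqxx conjC1 mulr1.
by rewrite /delta (negPf ij) conjC0 mulr0.
Qed.

Lemma delta_orthonormal : orthonormal_family ip delta.
Proof. by move=> i j; rewrite ip_delta /delta eq_sym. Qed.

Lemma vn_delta j : vn (delta j) = 1.
Proof. by rewrite /vn /sn /sqn delta_orthonormal eqxx /= sqrtr1. Qed.

Definition mv a v : I -> R[i] := fun i => \sum_j (a (i, j) : R[i]) * v j.

Lemma mvD a v w : mv a (v + w) = mv a v + mv a w.
Proof.
by apply/funext => i; rewrite /mv -[RHS]/(_ + _) -big_split; apply: eq_bigr =>
  j _; exact: mulrDr.
Qed.

Lemma mvZ a k v : mv a (k *: v) = k *: mv a v.
Proof.
apply/funext => i; rewrite -[RHS]/(k * _) mulr_sumr; apply: eq_bigr => j _.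
by rewrite -[(k *: v) j]/(k * v j) mulrCA.
Qed.

Lemma mv0 a : mv a 0 = 0.
Proof. by rewrite -(scale0r 0) mvZ !scale0r. Qed.

Lemma mv_sum a J (r : seq J) (P : pred J) (F : J -> I -> R[i]) :
  mv a (\sum_(j <- r | P j) F j) = \sum_(j <- r | P j) mv a (F j).
Proof. by apply: (big_morph _ (mvD a) (mv0 a)). Qed.

Lemma mvDl a b v : mv (a + b) v = mv a v + mv b v.
Proof.
apply/funext => i; rewrite /mv -[RHS]/(_ + _) -big_split; apply: eq_bigr => j _.
by rewrite fmatD; exact: mulrDl.
Qed.

Lemma mvZl k a v : mv (k *: a) v = k *: mv a v.
Proof.
apply/funext => i; rewrite -[RHS]/(k * _) mulr_sumr; apply: eq_bigr => j _.
by rewrite fmatZ mulrA.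
Qed.

Lemma mv0l v : mv 0 v = 0.
Proof. by rewrite -(scale0r 0) mvZl !scale0r. Qed.

Lemma mvNl a v : mv (- a) v = - mv a v.
Proof. by rewrite -scaleN1r mvZl scaleN1r. Qed.

Lemma mvM a b v : mv (a ** b) v = mv a (mv b v).
Proof.
apply/funext => i; rewrite /mv; under eq_bigr do rewrite fmatM mulr_suml.
rewrite exchange_big; apply: eq_bigr => j _; rewrite mulr_sumr.
by apply: eq_bigr => k _; rewrite mulrA.
Qed.

Lemma ip_mv a v w : ip (mv a v) w = ip v (mv (star a) w).
Proof.
rewrite /ip /mv; under eq_bigr do rewrite mulr_suml.
under [RHS]eq_bigr do rewrite rmorph_sum mulr_sumr.
rewrite exchange_big; apply: eq_bigr => i _; apply: eq_bigr => j _ /=.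
by rewrite fmat_starE rmorphM /= [star _]/(Num.conj _) conjCK mulrCA mulrA.
Qed.

Lemma mv_delta a i j : mv a (delta j) i = a (i, j).
Proof.
rewrite /mv (bigD1 j) //= big1 ?addr0 => [|k kj].
  by rewrite /delta eqxx mulr1.
by rewrite /delta (negPf kj) mulr0.
Qed.

Lemma mv_inj a b : (forall v, mv a v = mv b v) -> a = b.
Proof. by move=> h; apply/ffunP => -[i j]; rewrite -!mv_delta h. Qed.

Lemma ip_mv_star_mul a v : ip (mv (star a ** a) v) v = (vn (mv a v) ^+ 2)%:C.
Proof. by rewrite mvM ip_mv starK ip_vn. Qed.

Definition psd a := forall v, 0 <= ip (mv a v) v.

(** The numbers [<a d v, d v>] and [|z v|^2] are nonnegative with sum zero. This supplies the
    positivity hypothesis of [Pos_detect] for matrix algebras. *)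
Lemma psd_detect a d z : psd a -> star d = d ->
  d ** a ** d + star z ** z = 0 -> star z ** z = 0.
Proof.
move=> pa sd dz; suff z0 : z = 0 by rewrite z0 muls0.
apply: mv_inj => v; rewrite mv0l; apply: vn_eq0.
have /eqP : ip (mv (d ** a ** d + star z ** z) v) v = 0.
  by rewrite dz mv0l ip_0l.
rewrite mvDl ipD ip_mv_star_mul -smulA mvM ip_mv sd mvM.
rewrite paddr_eq0 ?pa ?ler0c ?sqr_ge0 // => /andP[_].
by rewrite -(rmorph0 (real_complex R)) (inj_eq (@complexI R)) sqrf_eq0 => /eqP.
Qed.

End Vectors.

(** * Finite-dimensional representations *)

Section Representations.
Variables (R : realType) (O : cstarAlgType R).

(** For [|x| <= 1] and [h = x^* x], let [1 - y] be the root of [1 - h]. Then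
    [|v - s(y) v|^2 = |v|^2 - |s(x) v|^2], and the left-hand side is nonnegative. *)
Lemma rep_contr (J : finType) (s : starhom O (fmat J (scal R))) (o : O) v :
  vn (mv (s o) v) <= nrm o * vn v.
Proof.
have [->|o0] := eqVneq o 0; first by rewrite starhom0 mv0l vn0 nrm0 mul0r.
have n0 : 0 < nrm o by rewrite nrm_gt0 o0.
pose x := (nrm o)^-1%:C *: o; pose h := star x ** x.
suff hx : vn (mv (s x) v) <= vn v.
  have -> : o = (nrm o)%:C *: x.
    by rewrite scalerA -rmorphM mulfV ?scale1r // gt_eqF.
  by rewrite starhomZ mvZl vnZ nrmZr nrm_realC gtr0_norm // nrmZr
    gtr0_norm ?invr_gt0 // mulVf ?gt_eqF // mulr1 ler_wpM2l // ltW.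
have [||y [sy yy _ _]] := @sqrt1B R O h; first by rewrite starM starK.
  by rewrite nrm_cstar nrmZr gtr0_norm ?invr_gt0 // mulVf ?gt_eqF.
have : 0 <= ip (v - mv (s y) v) (v - mv (s y) v) by apply: ip_ge0.
rewrite ipD !ip_Dr !ip_Nl !ip_Nr opprK.
have -> : ip v (mv (s y) v) = ip (mv (s y) v) v.
  by rewrite ip_mv -starhom_star sy.
have -> : ip (mv (s y) v) (mv (s y) v) = ip (mv (s y) v) v + ip (mv (s y) v) v
    - ip (mv (s h) v) v.
  rewrite -{2}sy starhom_star -ip_mv -mvM -starhomM yy starhomB starhomD.
  by rewrite mvDl mvNl mvDl !ipD ip_Nl.
set p := ip (mv (s y) v) v.
have -> : ip v v - p + (- p + (p + p - ip (mv (s h) v) v))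
  = ip v v - ip (mv (s h) v) v by ring.
rewrite starhomM starhom_star ip_mv_star_mul ip_vn.
rewrite -rmorphB ler0c subr_ge0 ler_pXn2r ?nnegrE ?vn_ge0 //.
Qed.

Definition separated := forall o : O,
  (forall n (s : starhom O (fmat 'I_n (scal R))), s o = 0) -> o = 0.

(** A jointly injective family of representations is jointly isometric: it detects the positivity of
    [c^2 - o^* o]. *)
Lemma rep_nrm_le (e : O) (he : is_unit e) (sep : separated) (o : O) c :
  0 <= c ->
  (forall n (s : starhom O (fmat 'I_n (scal R))) v,
    vn (mv (s o) v) <= c * vn v) -> nrm o <= c.
Proof.
move=> c0 hc.
suff : nrm (star o ** o) <= c ^+ 2.
  by rewrite nrm_cstar ler_pXn2r ?nnegrE ?nrm_ge0.
apply: (nrm_le_Pos he (sqr_ge0 _)); first exact: Pos_star_mul he _.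
apply: (Pos_detect he (I := {n & starhom O (fmat 'I_n (scal R))})
  (B := fun i => fmat 'I_(tag i) (scal R)) (f := fun i => tagged i)).
- by rewrite starB starZr (star_uniq_unit he) starM starK.
- by move=> a ha; apply: sep => n s; apply: (ha (existT _ n s)).
- move=> [n s] d z /=; apply: psd_detect => v.
  (* [s e] may be a proper projection, so the estimate is used on the vectors [s(e) v]. *)
  have -> : (c ^+ 2)%:C *: e - star o ** o
      = (c ^+ 2)%:C *: (star e ** e) - star (o ** e) ** (o ** e).
    by have [_ ->] := he o; rewrite (star_uniq_unit he); case: (he e) => ->.
  rewrite starhomB starhomZ !starhomM !starhom_star starhomM mvDl mvNl mvZl.
  rewrite ipD ipZ ip_Nl !ip_mv_star_mul -rmorphM -rmorphB ler0c.
  rewrite subr_ge0 -exprMn ler_pXn2r ?nnegrE ?mulr_ge0 ?vn_ge0 //.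
  by rewrite mvM.
Qed.

End Representations.

(** * The C*-algebra of matrices over a residually finite dimensional C*-algebra *)

Section Slices.
Variables (R : realType) (I J : finType).
Implicit Types (v : I * J -> R[i]) (w : J -> R[i]).

Definition slice v i : J -> R[i] := fun x => v (i, x).
Definition unslice i w : I * J -> R[i] := fun p => if p.1 == i then w p.2 else 0.

Lemma ip_slice v v' : ip v v' = \sum_i ip (slice v i) (slice v' i).
Proof. by rewrite /ip pair_bigA; apply: eq_bigr => -[i x]. Qed.

Lemma slice_unslice i w j : slice (unslice i w) j = if j == i then w else 0.
Proof. by rewrite /slice /unslice /=; case: ifP. Qed.

Lemma ip_unslice i w v : ip (unslice i w) v = ip w (slice v i).
Proof.
rewrite ip_slice (bigD1 i) //= big1 ?addr0 => [|j ji].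
  by rewrite slice_unslice eqxx.
by rewrite slice_unslice (negPf ji) ip_0l.
Qed.

Lemma vn_unslice i w : vn (unslice i w) = vn w.
Proof. by rewrite /vn /sn /sqn ip_unslice slice_unslice eqxx. Qed.

Lemma sqn_slice v : vn v ^+ 2 = \sum_i vn (slice v i) ^+ 2.
Proof.
apply: (@complexI R); rewrite -ip_vn ip_slice rmorph_sum.
by apply: eq_bigr => i _; rewrite ip_vn.
Qed.

Lemma vn_slice v i : vn (slice v i) <= vn v.
Proof.
rewrite -(@ler_pXn2r _ 2) ?nnegrE ?vn_ge0 // sqn_slice (bigD1 i) //= lerDl.
by apply: sumr_ge0 => j _; rewrite sqr_ge0.
Qed.

Lemma unslice_sum v : v = \sum_i unslice i (slice v i).
Proof.
apply/funext => -[i x]; rewrite fct_sumE (bigD1 i) //= big1 ?addr0 => [|j ji].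
  by rewrite /unslice eqxx.
by rewrite /unslice /= eq_sym (negPf ji).
Qed.

End Slices.

Section Amplification.
Variables (R : realType) (I J : finType) (O : starAlgType R).
Variable s : starhom O (fmat J (scal R)).

Definition amp_fun (Y : fmat I O) : fmat (I * J)%type (scal R) :=
  [ffun p => s (Y (p.1.1, p.2.1)) (p.1.2, p.2.2)].

Fact amp_funD a b : amp_fun (a + b) = amp_fun a + amp_fun b.
Proof. by apply/ffunP => p; rewrite !ffunE starhomD fmatD. Qed.

Fact amp_funZ (k : R[i]) a : amp_fun (k *: a) = k *: amp_fun a.
Proof. by apply/ffunP => p; rewrite !ffunE starhomZ fmatZ. Qed.

Fact amp_funM a b : amp_fun (a ** b) = amp_fun a ** amp_fun b.
Proof.
apply/ffunP => -[[i x] [j y]]; rewrite fmatM [LHS]ffunE fmatM starhom_sum sum_ffunE.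
transitivity (\sum_k \sum_z amp_fun a ((i, x), (k, z)) **
  amp_fun b ((k, z), (j, y))).
  by apply: eq_bigr => k _; rewrite starhomM fmatM; apply: eq_bigr => z _;
    rewrite !ffunE.
by rewrite pair_bigA; apply: eq_bigr => -[].
Qed.

Fact amp_fun_star a : amp_fun (star a) = star (amp_fun a).
Proof.
by apply/ffunP => -[[i x] [j y]]; rewrite ffunE !fmat_starE starhom_star
  fmat_starE ffunE.
Qed.

Definition amp := StarHom amp_funD amp_funZ amp_funM amp_fun_star.

Lemma slice_mv_amp Y v i :
  slice (mv (amp Y) v) i = \sum_j mv (s (Y (i, j))) (slice v j).
Proof.
apply/funext => x; rewrite fct_sumE /slice /mv pair_bigA.
by apply: eq_bigr => -[j y] _; rewrite ffunE.
Qed.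

Lemma slice_mv_unslice Y j w i :
  slice (mv (amp Y) (unslice j w)) i = mv (s (Y (i, j))) w.
Proof.
rewrite slice_mv_amp (bigD1 j) //= big1 ?addr0 => [|k kj].
  by rewrite slice_unslice eqxx.
by rewrite slice_unslice (negPf kj) mv0.
Qed.

End Amplification.

Definition zero_hom (R : realType) (A B : starAlgType R) : starhom A B :=
  @StarHom R A B (fun=> 0) (fun _ _ => esym (addr0 0))
    (fun k _ => esym (scaler0 B k)) (fun _ _ => esym (muls0 0))
    (fun _ => esym (star0 B)).

(* Matrices over a residually finite dimensional C*-algebra, normed by their
   images in the finite-dimensional representations. *)
Definition rmat (R : realType) (I : finType) (O : cstarAlgType R) (e : O)
  (he : is_unit e) (sep : separated O) := fmat I O.

Section RMat.
Variables (R : realType) (I : finType) (O : cstarAlgType R) (e : O).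
Variables (he : is_unit e) (sep : separated O).
Let M := rmat I he sep.

HB.instance Definition _ := StarAlg.copy M (fmat I O).

Implicit Types (Y Z : M).

Definition rnorm_set Y := [set r : R | exists n
  (s : starhom O (fmat 'I_n (scal R))) v, vn v <= 1 /\ r = vn (mv (amp I s Y) v)].
Definition rnorm Y : R := sup (rnorm_set Y).

Let bound Y : R := \sum_i \sum_j nrm (Y (i, j)).

Let vn_amp_bound Y n (s : starhom O (fmat 'I_n (scal R))) v :
  vn (mv (amp I s Y) v) <= bound Y * vn v.
Proof.
rewrite [X in vn X <= _](unslice_sum (mv _ _)) (le_trans (vn_sum _ _ _)) //.
rewrite mulr_suml ler_sum // => i _; rewrite vn_unslice slice_mv_amp.
rewrite (le_trans (vn_sum _ _ _)) // mulr_suml ler_sum // => j _.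
rewrite (le_trans (rep_contr _ _ _)) // ler_wpM2l ?nrm_ge0 //.
exact: vn_slice.
Qed.

Let bound_ge0 Y : 0 <= bound Y.
Proof. by apply: sumr_ge0 => i _; apply: sumr_ge0 => j _; apply: nrm_ge0. Qed.

Let rnorm_sup Y : has_sup (rnorm_set Y).
Proof.
split.
  by exists (vn (mv (amp I (zero_hom O (fmat 'I_0 (scal R))) Y) 0)), 0%N,
    (zero_hom _ _), 0; rewrite vn0.
exists (bound Y) => _ [n [s [v [v1 ->]]]].
by rewrite (le_trans (vn_amp_bound _ _ _)) // -[leRHS]mulr1 ler_wpM2l.
Qed.

Lemma rnorm_le Y c : (forall n (s : starhom O (fmat 'I_n (scal R))) v,
  vn v <= 1 -> vn (mv (amp I s Y) v) <= c) -> rnorm Y <= c.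
Proof.
move=> h; apply: sup_le_ub; first by case: (rnorm_sup Y).
by move=> _ [n [s [v [v1 ->]]]]; apply: h.
Qed.

Lemma vn_amp_le Y n (s : starhom O (fmat 'I_n (scal R))) v :
  vn (mv (amp I s Y) v) <= rnorm Y * vn v.
Proof.
have [v0|v0] := eqVneq (vn v) 0.
  by rewrite (vn_eq0 v0) mv0 vn0 mulr0.
have vp : 0 < vn v by rewrite lt_neqAle eq_sym v0 vn_ge0.
rewrite -ler_pdivrMr // mulrC.
have -> : (vn v)^-1 * vn (mv (amp I s Y) v)
    = vn (mv (amp I s Y) ((vn v)^-1%:C *: v)).
  by rewrite mvZ vnZ nrm_realC gtr0_norm ?invr_gt0.
apply: sup_upper_bound => //; exists n, s, ((vn v)^-1%:C *: v); split=> //.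
by rewrite vnZ nrm_realC gtr0_norm ?invr_gt0 // mulVf.
Qed.

Lemma rnorm_ge0 Y : 0 <= rnorm Y.
Proof.
apply: sup_upper_bound => //; exists 0%N, (zero_hom _ _), 0.
by rewrite vn0 mv0 vn0.
Qed.

(** Together with [rnorm_bound] this makes [rnorm] equivalent to the entrywise norm, so completeness
    is inherited from [O]. It is here that the norm of [O] must be determined by its
    finite-dimensional representations. *)
Lemma rnorm_entry Y p : nrm (Y p) <= rnorm Y.
Proof.
case: p => i j; apply: (rep_nrm_le he sep (rnorm_ge0 _)) => n s v.
rewrite -(slice_mv_unslice s Y j v i) (le_trans (vn_slice _ _)) //.
by rewrite (le_trans (vn_amp_le _ _ _)) // vn_unslice.
Qed.

Lemma rnorm_bound Y : rnorm Y <= bound Y.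
Proof.
apply: rnorm_le => n s v v1; rewrite (le_trans (vn_amp_bound _ _ _)) //.
by rewrite -[leRHS]mulr1 ler_wpM2l.
Qed.

Fact rnormD Y Z : (rnorm (Y + Z))%:C <= (rnorm Y)%:C + (rnorm Z)%:C.
Proof.
rewrite -rmorphD lecR; apply: rnorm_le => n s v v1; rewrite starhomD mvDl.
have le1 X : vn (mv (amp I s X) v) <= rnorm X.
  by rewrite (le_trans (vn_amp_le _ _ _)) // -[leRHS]mulr1 ler_wpM2l ?rnorm_ge0.
by rewrite (le_trans (vnD _ _)) // lerD.
Qed.

Let rnormZ_le (k : R[i]) Y : rnorm (k *: Y) <= nrm k * rnorm Y.
Proof.
apply: rnorm_le => n s v v1; rewrite starhomZ mvZl vnZ ler_wpM2l ?nrm_ge0 //.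
by rewrite (le_trans (vn_amp_le _ _ _)) // -[leRHS]mulr1 ler_wpM2l ?rnorm_ge0.
Qed.

Fact rnormZ (k : R[i]) Y : (rnorm (k *: Y))%:C = `|k| * (rnorm Y)%:C.
Proof.
rewrite normE -rmorphM; congr _%:C; apply/le_anti; rewrite rnormZ_le /=.
have [->|k0] := eqVneq k 0; first by rewrite nrm0 mul0r rnorm_ge0.
have kp : 0 < nrm k by rewrite nrm_gt0 k0.
rewrite -ler_pdivlMl //; have := rnormZ_le k^-1 (k *: Y).
rewrite scalerA mulVf // scale1r; congr (_ <= _ * _).
apply: (mulfI (x := nrm k)); first by rewrite gt_eqF.
by rewrite -nrmM_C mulfV // mulfV ?gt_eqF // -[RHS](normr1 R) -nrm_realC.
Qed.

Fact rnorm0_eq0 Y : (rnorm Y)%:C = 0 :> R[i] -> Y = 0.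
Proof.
move=> /(@complexI R) Y0; apply/ffunP => p; rewrite fmat0; apply: nrm0_eq0.
by apply/le_anti; rewrite nrm_ge0 -Y0 rnorm_entry.
Qed.

HB.instance Definition _ :=
  @Lmodule_isNormed.Build R[i] M (fun Y => (rnorm Y)%:C) rnormD rnormZ rnorm0_eq0.

Lemma rmat_nrm Y : nrm Y = rnorm Y. Proof. by []. Qed.

Fact rmat_cauchys (u : nat -> M) : cauchys u -> exists Y, cvs u Y.
Proof.
move=> hu.
have /choice[l hl] : forall p, exists l : O, cvs (fun n => u n p) l.
  move=> p; apply: cauchys_cvs => e0 /hu [N hN]; exists N => m n Nm Nn.
  by apply: le_trans (hN _ _ Nm Nn); have := rnorm_entry (u m - u n) p;
    rewrite fmatD fmatN.
pose Y : M := [ffun p => l p].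
exists Y => e0 e00; pose c : R := (#|I|%:R * #|I|%:R + 1).
have c0 : 0 < c by rewrite ltr_wpDl // mulr_ge0.
have [N hN] : exists N, forall n p, (N <= n)%N -> nrm (u n p - l p) <= e0 / c.
  have /choice[N hN] : forall p, exists N, forall n, (N <= n)%N ->
      nrm (u n p - l p) <= e0 / c.
    by move=> p; apply: hl; rewrite divr_gt0.
  exists (\max_p N p)%N => n p le; apply: hN; apply: leq_trans le.
  exact: leq_bigmax.
exists N => n Nn; rewrite rmat_nrm (le_trans (rnorm_bound _)) //.
apply: (@le_trans _ _ (\sum_(i : I) \sum_(j : I) e0 / c)).
  apply: ler_sum => i _; apply: ler_sum => j _.
  by rewrite fmatD fmatN ffunE hN.
rewrite !sumr_const -mulrnA -[leLHS]mulr_natl natrM mulrCA -[leRHS]mulr1.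
by rewrite ler_wpM2l ?(ltW e00) // ler_pdivrMr // mul1r lerDl.
Qed.

HB.instance Definition _ := Uniform_isComplete.Build M
  (@complete_of_cauchys R M rmat_cauchys).

Let rnormM_le Y Z : rnorm (Y ** Z) <= rnorm Y * rnorm Z.
Proof.
apply: rnorm_le => n s v v1; rewrite starhomM mvM.
rewrite (le_trans (vn_amp_le _ _ _)) // ler_wpM2l ?rnorm_ge0 //.
by rewrite (le_trans (vn_amp_le _ _ _)) // -[leRHS]mulr1 ler_wpM2l ?rnorm_ge0.
Qed.

Let rnorm_sq_le Y : rnorm Y ^+ 2 <= rnorm (star Y ** Y).
Proof.
suff h : rnorm Y <= Num.sqrt (rnorm (star Y ** Y)).
  by rewrite -[leRHS]sqr_sqrtr ?rnorm_ge0 // ler_pXn2r ?nnegrE ?rnorm_ge0 ?sqrtr_ge0.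
apply: rnorm_le => n s v v1.
rewrite -[leLHS]ger0_norm ?vn_ge0 // -sqrtr_sqr ler_wsqrtr //.
rewrite -lecR -ip_mv_star_mul -starhom_star -starhomM.
rewrite -[leLHS]ger0_norm; last first.
  by rewrite starhomM starhom_star ip_mv_star_mul ler0c sqr_ge0.
rewrite normE lecR (le_trans (ip_cs _ _)) //.
rewrite -/(vn _) -/(vn _) (le_trans (ler_wpM2l (vn_ge0 _) v1)) // mulr1.
by rewrite (le_trans (vn_amp_le _ _ _)) // -[leRHS]mulr1 ler_wpM2l ?rnorm_ge0.
Qed.

Fact rmat_normM Y Z : `|Y ** Z| <= `|Y| * `|Z|.
Proof. by rewrite !normE -rmorphM lecR !rmat_nrm. Qed.

Let rnorm_star_le Y : rnorm Y <= rnorm (star Y).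
Proof.
have := le_trans (rnorm_sq_le Y) (rnormM_le (star Y) Y).
have := rnorm_ge0 Y; rewrite le_eqVlt => /predU1P[<- _|Y0].
  exact: rnorm_ge0.
by rewrite expr2 ler_pM2r.
Qed.

Fact rmat_norm_cstar Y : `|star Y ** Y| = `|Y| ^+ 2.
Proof.
rewrite !normE -rmorphXn !rmat_nrm; congr _%:C; apply/le_anti.
rewrite rnorm_sq_le andbT (le_trans (rnormM_le _ _)) // expr2.
by rewrite ler_wpM2r ?rnorm_ge0 // -{2}(starK Y) rnorm_star_le.
Qed.

HB.instance Definition _ := StarAlg_isCStarAlg.Build R M
  rmat_normM rmat_norm_cstar.

End RMat.

(** * Closed *-subalgebras *)

Record csubalg (R : realType) (A : cstarAlgType R) := CSubAlg {
  csub_set : set A;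
  csub0 : csub_set 0;
  csubD : forall a b, csub_set a -> csub_set b -> csub_set (a + b);
  csubZ : forall (k : R[i]) a, csub_set a -> csub_set (k *: a);
  csubM : forall a b, csub_set a -> csub_set b -> csub_set (a ** b);
  csub_star : forall a, csub_set a -> csub_set (star a);
  csub_closed : forall u l, (forall n, csub_set (u n)) -> cvs u l -> csub_set l
}.

Section CSubAlg.
Variables (R : realType) (A : cstarAlgType R) (S : csubalg A).

Record csub := CSub { csval : A; csvalP : csub_set S csval }.

Lemma csval_inj : injective csval.
Proof. by case=> x px [y py] /= xy; subst y; congr CSub; exact: Prop_irrelevance. Qed.

HB.instance Definition _ := gen_eqMixin csub.
HB.instance Definition _ := gen_choiceMixin csub.

Implicit Types (x y z : csub) (k : R[i]).

Fact csubN a : csub_set S a -> csub_set S (- a).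
Proof. by move=> h; rewrite -scaleN1r; apply: csubZ. Qed.

Definition csub_zero := CSub (csub0 S).
Definition csub_add x y := CSub (csubD (csvalP x) (csvalP y)).
Definition csub_opp x := CSub (csubN (csvalP x)).
Definition csub_scale k x := CSub (csubZ k (csvalP x)).
Definition csub_mul x y := CSub (csubM (csvalP x) (csvalP y)).
Definition csub_st x := CSub (csub_star (csvalP x)).

Fact csub_addA : associative csub_add.
Proof. by move=> x y z; apply: csval_inj; rewrite /= addrA. Qed.
Fact csub_addC : commutative csub_add.
Proof. by move=> x y; apply: csval_inj; rewrite /= addrC. Qed.
Fact csub_add0 : left_id csub_zero csub_add.
Proof. by move=> x; apply: csval_inj; rewrite /= add0r. Qed.
Fact csub_addN : left_inverse csub_zero csub_opp csub_add.
Proof. by move=> x; apply: csval_inj; rewrite /= addNr. Qed.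

HB.instance Definition _ :=
  GRing.isZmodule.Build csub csub_addA csub_addC csub_add0 csub_addN.

Fact csub_scaleA k l x : csub_scale k (csub_scale l x) = csub_scale (k * l) x.
Proof. by apply: csval_inj; rewrite /= scalerA. Qed.
Fact csub_scale1 : left_id 1 csub_scale.
Proof. by move=> x; apply: csval_inj; rewrite /= scale1r. Qed.
Fact csub_scaleDr : right_distributive csub_scale +%R.
Proof. by move=> k x y; apply: csval_inj; rewrite /= scalerDr. Qed.
Fact csub_scaleDl x : {morph csub_scale^~ x : k l / k + l}.
Proof. by move=> k l; apply: csval_inj; rewrite /= scalerDl. Qed.

HB.instance Definition _ := GRing.Zmodule_isLmodule.Build R[i] csub
  csub_scaleA csub_scale1 csub_scaleDr csub_scaleDl.

Fact csub_smulA x y z : csub_mul x (csub_mul y z) = csub_mul (csub_mul x y) z.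
Proof. by apply: csval_inj; rewrite /= smulA. Qed.
Fact csub_smulDl x y z : csub_mul (x + y) z = csub_mul x z + csub_mul y z.
Proof. by apply: csval_inj; rewrite /= smulDl. Qed.
Fact csub_smulDr x y z : csub_mul x (y + z) = csub_mul x y + csub_mul x z.
Proof. by apply: csval_inj; rewrite /= smulDr. Qed.
Fact csub_smulZl k x y : csub_mul (k *: x) y = k *: csub_mul x y.
Proof. by apply: csval_inj; rewrite /= smulZl. Qed.
Fact csub_smulZr k x y : csub_mul x (k *: y) = k *: csub_mul x y.
Proof. by apply: csval_inj; rewrite /= smulZr. Qed.
Fact csub_stK x : csub_st (csub_st x) = x.
Proof. by apply: csval_inj; rewrite /= starK. Qed.
Fact csub_stD x y : csub_st (x + y) = csub_st x + csub_st y.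
Proof. by apply: csval_inj; rewrite /= starD. Qed.
Fact csub_stZ k x : csub_st (k *: x) = Num.conj k *: csub_st x.
Proof. by apply: csval_inj; rewrite /= starZ. Qed.
Fact csub_stM x y : csub_st (csub_mul x y) = csub_mul (csub_st y) (csub_st x).
Proof. by apply: csval_inj; rewrite /= starM. Qed.

HB.instance Definition _ := Lmodule_isStarAlg.Build R csub
  csub_smulA csub_smulDl csub_smulDr csub_smulZl csub_smulZr
  csub_stK csub_stD csub_stZ csub_stM.

Fact csub_normD x y : `|csval (x + y)| <= `|csval x| + `|csval y|.
Proof. exact: ler_normD. Qed.
Fact csub_normZ k x : `|csval (k *: x)| = `|k| * `|csval x|.
Proof. exact: normrZ. Qed.
Fact csub_norm0_eq0 x : `|csval x| = 0 -> x = 0.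
Proof. by move=> /normr0_eq0 h; apply: csval_inj. Qed.

HB.instance Definition _ := @Lmodule_isNormed.Build R[i] csub
  (fun x => `|csval x|) csub_normD csub_normZ csub_norm0_eq0.

Fact csub_cauchys (u : nat -> csub) : cauchys u -> exists x, cvs u x.
Proof.
move=> hu; have [|l hl] := @cauchys_cvs R A (fun n => csval (u n)).
  by move=> e /hu [N hN]; exists N => m n Nm Nn; exact: hN.
have Sl : csub_set S l by apply: csub_closed hl => n; exact: csvalP.
by exists (CSub Sl) => e /hl [N hN]; exists N => n /hN.
Qed.

HB.instance Definition _ := Uniform_isComplete.Build csub
  (@complete_of_cauchys R csub csub_cauchys).

Fact csub_normM x y : `|x ** y| <= `|x| * `|y|.
Proof. exact: normMle. Qed.
Fact csub_norm_cstar x : `|star x ** x| = `|x| ^+ 2.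
Proof. exact: norm_cstar. Qed.

HB.instance Definition _ := StarAlg_isCStarAlg.Build R csub
  csub_normM csub_norm_cstar.

Lemma csval_sum I (r : seq I) (P : pred I) (F : I -> csub) :
  csval (\sum_(i <- r | P i) F i) = \sum_(i <- r | P i) csval (F i).
Proof. exact: (big_morph csval (fun _ _ => erefl) erefl). Qed.

Definition csub_incl : starhom csub A :=
  @StarHom R csub A csval (fun _ _ => erefl) (fun _ _ => erefl)
    (fun _ _ => erefl) (fun _ => erefl).

End CSubAlg.

(** * Matrix units of finite-dimensional C*-algebras *)

Section Powers.
Variables (R : realType) (A : starAlgType R) (c : A).

(* [spow k] is the power [k.+1] of [c], as there may be no unit. *)
Definition spow k : A := iter k (fun x => x ** c) c.

Lemma spowS k : spow k.+1 = spow k ** c. Proof. by []. Qed.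

Lemma spowSl k : spow k.+1 = c ** spow k.
Proof. by elim: k => // k IH; rewrite spowS {1}IH -smulA. Qed.

Lemma spow_mul0 k w : c ** w = 0 -> spow k ** w = 0.
Proof.
by move=> cw; case: k => // k; rewrite spowS -smulA cw muls0.
Qed.

Lemma spow_mul_fix k w : w ** c = c -> w ** spow k = spow k.
Proof. by move=> wc; case: k => // k; rewrite spowSl smulA wc. Qed.

Lemma spow_sa k : star c = c -> star (spow k) = spow k.
Proof. by move=> sc; elim: k => // k IH; rewrite {1}spowS starM IH sc -spowSl. Qed.

End Powers.

Section FiniteDimensional.
Variables (R : realType) (P : cstarAlgType R).
Hypothesis Pfd : finite_dimensional P.
Implicit Types (a b c f g x y : P).

Lemma fd_dependent : exists n, forall m (x : 'I_m -> P), (n < m)%N ->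
  exists2 k : 'I_m -> R[i], exists i, k i != 0 & \sum_i k i *: x i = 0.
Proof.
have [n [g hg]] := Pfd; exists n => m x nm.
pose X : 'M[R[i]]_(m, n) := \matrix_(i, j) sval (cid (hg (x i))) j.
have xE i : x i = \sum_j X i j *: g j.
  rewrite {1}(svalP (cid (hg (x i)))); apply: eq_bigr => j _.
  by rewrite mxE.
have /rowV0Pn [v /sub_kermxP vX v0] : kermx X != 0.
  rewrite kermx_eq0 /row_free neq_ltn (leq_ltn_trans (rank_leq_col X)) //.
exists (v 0).
  by apply/existsP; rewrite -negb_forall; apply: contra v0 => /forallP h;
    apply/eqP/rowP => i; rewrite mxE; apply/eqP.
under eq_bigr do rewrite xE scaler_sumr.
rewrite exchange_big big1 // => j _ /=.
under eq_bigr do rewrite scalerA.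
rewrite -scaler_suml; have := congr1 (fun M : 'rV_n => M 0 j) vX.
by rewrite !mxE => ->; rewrite scale0r.
Qed.

Definition projection g := star g = g /\ g ** g = g.

(** Take a linear relation of least degree between the powers of [c], say [k0 c + c w = 0]. If
    [k0 = 0], then [c w = 0], so [w^* w = 0] and [w = 0] is a shorter relation. Hence [k0] is
    nonzero and [g = - w / k0] satisfies [c g = c]; as [g] is a combination of powers of [c], also
    [g^* g = g]. *)
Lemma support_projection c : star c = c -> exists g d (k : nat -> R[i]),
  [/\ projection g, g ** c = c & g = \sum_(i < d) k i *: spow c i].
Proof.
move=> sc.
pose rel d := `[< exists2 k : nat -> R[i], exists2 i, (i <= d)%N & k i != 0 &
  \sum_(i < d.+1) k i *: spow c i = 0 >].
have [d /asboolP[k [i0 i0d ki0] hk] dmin] : exists2 d, rel d &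
    forall d', rel d' -> (d <= d')%N.
  have [n hn] := fd_dependent.
  have ex : exists d, rel d.
    have [k [i ki] hk] := hn n.+1 (fun i => spow c i) (leqnn _).
    exists n; apply/asboolP; exists (fun j => k (inord j)).
      by exists i; rewrite ?inord_val // -ltnS.
    by rewrite -[RHS]hk; apply: eq_bigr => j _; rewrite inord_val.
  by case: (ex_minnP ex) => d rd h; exists d.
pose w := \sum_(i < d) k i.+1 *: spow c i.
have relE : k 0%N *: c + c ** w = 0.
  rewrite -[RHS]hk big_ord_recl muls_sumr; congr (_ + _).
  by apply: eq_bigr => i _; rewrite smulZr -spowSl.
have w_span x : c ** x = 0 -> star w ** x = 0.
  move=> cx; rewrite star_sum muls_suml big1 // => i _.
  by rewrite starZ spow_sa // smulZl spow_mul0 // scaler0.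
have k0 : k 0%N != 0.
  apply/negP => /eqP k00.
  have w0 : w = 0.
    by apply: star_cancel0; apply: w_span; rewrite -relE k00 scale0r add0r.
  case: i0 i0d ki0 => [|i0]; first by rewrite k00 eqxx.
  case: d hk @w relE w0 w_span dmin => // d hk w _ w0 _ dmin i0d ki0.
  suff : (d.+1 <= d)%N by rewrite ltnn.
  apply: dmin; apply/asboolP; exists (fun i => k i.+1) => //.
  by exists i0.
pose g := - (k 0%N)^-1 *: w.
have cg : c ** g = c.
  rewrite smulZr.
  have -> : c ** w = - (k 0%N *: c) by apply/eqP; rewrite -addr_eq0 addrC relE.
  by rewrite scalerN scaleNr opprK scalerA mulVf // scale1r.
have sgc : star g ** c = c by rewrite -{1}sc -starM cg sc.
have gE : g = \sum_(i < d) (- (k 0%N)^-1 * k i.+1) *: spow c i.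
  by rewrite /g /w scaler_sumr; apply: eq_bigr => i _; rewrite scalerA.
have sgg : star g ** g = g.
  rewrite {2 3}gE muls_sumr; apply: eq_bigr => i _.
  by rewrite smulZr spow_mul_fix.
have sg : star g = g by rewrite -sgg starM starK.
exists g, d, (fun i => - (k 0%N)^-1 * k i.+1); split=> //.
  by split=> //; rewrite -{1}sg.
by rewrite -{1}sg.
Qed.

(** The value of [q] at [a] in the corner with unit [f]: the power [a^0] is read as [f]. *)
Definition peval f a (q : {poly R[i]}) : P :=
  \sum_(i < size q) q`_i *: iter i (smul a) f.

Lemma peval_wide f a (q : {poly R[i]}) n : (size q <= n)%N ->
  peval f a q = \sum_(i < n) q`_i *: iter i (smul a) f.
Proof.
move=> qn; rewrite /peval (big_ord_widen n (fun i => q`_i *: iter i (smul a) f)) //.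
rewrite big_mkcond; apply: eq_bigr => i _; case: ltnP => // qi.
by rewrite nth_default // scale0r.
Qed.

Lemma pevalB f a (q r : {poly R[i]}) :
  peval f a (q - r) = peval f a q - peval f a r.
Proof.
pose n := maxn (size (q - r)) (maxn (size q) (size r)).
rewrite !(@peval_wide f a _ n) ?leq_max ?leqnn ?orbT // -sumrB.
by apply: eq_bigr => i _; rewrite coefB scalerBl.
Qed.

Lemma pevalZ f a k (q : {poly R[i]}) : peval f a (k *: q) = k *: peval f a q.
Proof.
rewrite (@peval_wide f a _ (size q)) ?size_scale_leq // scaler_sumr.
by apply: eq_bigr => i _; rewrite coefZ scalerA.
Qed.

Lemma pevalXM f a (q : {poly R[i]}) : peval f a ('X * q) = a ** peval f a q.
Proof.
rewrite (@peval_wide f a _ (size q).+1); last first.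
  by rewrite (leq_trans (size_polyMleq _ _)) // size_polyX.
rewrite big_ord_recl coefXM /= scale0r add0r muls_sumr.
by apply: eq_bigr => i _; rewrite coefXM /= smulZr.
Qed.

(* A non-scalar element [a] of the corner [f P f] has an eigenvalue, which
   yields a zero divisor and hence a proper subprojection. *)
Lemma split_projection f a : projection f -> f != 0 ->
  f ** a = a -> a ** f = a -> (forall k : R[i], a != k *: f) ->
  exists g, [/\ projection g, f ** g = g, g != 0 & g != f].
Proof.
move=> [sf ff] f0 fa af ak.
pose ann n := `[< exists q : {poly R[i]}, [/\ q != 0, size q = n & peval f a q = 0] >].
have [n /asboolP[q [q0 sq hq]] nmin] : exists2 n, ann n &
    forall n', ann n' -> (n <= n')%N.
  have [n hn] := fd_dependent.
  have ex : exists n, ann n.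
    have [k [i ki] hk] := hn n.+1 (fun i => iter i (smul a) f) (leqnn _).
    pose q := \poly_(i < n.+1) k (inord i).
    exists (size q); apply/asboolP; exists q; split=> //.
      apply: contra ki => /eqP/(congr1 (fun q : {poly _} => q`_i)).
      by rewrite coef_poly ltn_ord inord_val coef0 => ->.
    rewrite (@peval_wide _ _ _ n.+1) ?size_poly // -[RHS]hk.
    by apply: eq_bigr => j _; rewrite coef_poly ltn_ord inord_val.
  by case: (ex_minnP ex) => m rm h; exists m.
have [l ql] : exists l, root q l.
  apply/closed_rootP/eqP => sq1.
  have := hq; rewrite /peval sq1 big_ord1 /= => /eqP; rewrite scaler_eq0 (negPf f0).
  rewrite orbF => q00; move: q0; rewrite (size1_polyC (eq_leq sq1)).
  by rewrite polyC_eq0 q00.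
have [r qE] := factor_theorem _ _ ql; rewrite {}qE in ql q0 sq hq.
have r0 : r != 0 by apply: contraNneq q0 => ->; rewrite mul0r.
(* [v] is nonzero by minimality of the degree and [b] kills it; so the support projection of [b^* b]
   kills [v], while [f] fixes it. *)
pose v := peval f a r; pose b := a - l *: f.
have v0 : v != 0.
  apply/negP => /eqP v0; have /nmin : ann (size r).
    by apply/asboolP; exists r.
  by rewrite -sq size_Mmonic ?monicXsubC // size_XsubC addnC /= ltnn.
have fv : f ** v = v.
  rewrite muls_sumr; apply: eq_bigr => i _; rewrite smulZr; congr (_ *: _).
  by case: (nat_of_ord i) => [|j] //=; rewrite smulA fa.
have bv : b ** v = 0.
  rewrite mulsBl smulZl fv -pevalXM -pevalZ -pevalB -[RHS]hq.
  by congr (peval f a _); rewrite [RHS]mulrC mulrBl mul_polyC.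
have b0 : b != 0 by rewrite subr_eq0 ak.
have bf : b ** f = b by rewrite mulsBl smulZl af ff.
pose c := star b ** b.
have c0 : c != 0 by apply: contraNneq b0 => /star_cancel0 ->.
have [g [d [k [pg gc gE]]]] := @support_projection c ltac:(by rewrite starM starK).
have fc : f ** c = c by rewrite smulA -{1}sf -starM bf.
have gv : g ** v = 0.
  rewrite gE muls_suml big1 // => i _; rewrite smulZl spow_mul0 ?scaler0 //.
  by rewrite -smulA bv muls0.
exists g; split=> //.
- by rewrite gE muls_sumr; apply: eq_bigr => i _; rewrite smulZr spow_mul_fix.
- by apply: contraNneq c0 => g0; rewrite -gc g0 mulr0s.
- by apply: contraNneq v0 => gf; rewrite -fv -gf gv.
Qed.

Definition orth_family r (p : 'I_r -> P) :=
  [/\ forall i, star (p i) = p i,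
      forall i j, p i ** p j = if i == j then p i else 0 &
      forall i, p i != 0].

Lemma orth_extend r (p : 'I_r -> P) g : orth_family p -> projection g ->
  g != 0 -> (forall i, p i ** g = 0) -> exists p' : 'I_r.+1 -> P, orth_family p'.
Proof.
move=> [sp pp p0] [sg gg] g0 pg.
have gp i : g ** p i = 0 by rewrite -sg -(sp i) -starM pg star0.
exists (fun i => if unlift ord0 i is Some j then p j else g); split=> [i|i j|i].
- by case: unliftP.
- case: (unliftP ord0 i) => [i'|] ->; case: (unliftP ord0 j) => [j'|] -> //.
- by case: unliftP.
Qed.

Lemma max_orth_family : exists r (p : 'I_r -> P), orth_family p /\
  forall p' : 'I_r.+1 -> P, ~ orth_family p'.
Proof.
pose fam r := `[< exists p : 'I_r -> P, orth_family p >].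
have ex : exists r, fam r.
  by exists 0%N; apply/asboolP; exists (fun=> 0); split=> -[].
have [n hn] := fd_dependent.
have bnd r : fam r -> (r <= n)%N.
  move=> /asboolP[p [_ pp p0]]; rewrite leqNgt; apply/negP => nr.
  have [k [i /negP ki] hk] := hn r p nr; apply: ki.
  have := congr1 (smul (p i)) hk; rewrite muls0 muls_sumr (bigD1 i) //= big1.
    by rewrite addr0 smulZr pp eqxx => /eqP; rewrite scaler_eq0 (negPf (p0 i)) orbF.
  by move=> j ji; rewrite smulZr pp eq_sym (negPf ji) scaler0.
have [r /asboolP[p op] rmax] := ex_maxnP ex bnd.
exists r, p; split=> // p' op'.
have /rmax : fam r.+1 by apply/asboolP; exists p'.
by rewrite ltnn.
Qed.

Section MaximalFamily.
Variables (r : nat) (p : 'I_r -> P).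
Hypotheses (op : orth_family p) (pmax : forall p' : 'I_r.+1 -> P, ~ orth_family p').

Let sp i : star (p i) = p i. Proof. by case: op. Qed.
Let pp i j : p i ** p j = if i == j then p i else 0. Proof. by case: op. Qed.
Let ppi i : p i ** p i = p i. Proof. by rewrite pp eqxx. Qed.
Let p0 i : p i != 0. Proof. by case: op. Qed.

(** If [z = x - u x] were nonzero, the support projection of [z z^*] would be orthogonal to all
    [p i] and would extend the family. Thus [P] acquires a unit. *)
Lemma orth_sum_unit : is_unit (\sum_i p i).
Proof.
set u := \sum_i p i.
have su : star u = u by rewrite star_sum; apply: eq_bigr.
have pu i : p i ** u = p i.
  rewrite muls_sumr (bigD1 i) //= ppi big1 ?addr0 // => j ji.
  by rewrite pp eq_sym (negPf ji).
suff ux x : u ** x = x.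
  by move=> x; split=> //; rewrite -[x in LHS]starK -su -starM ux starK.
pose z := x - u ** x.
have pz i : p i ** z = 0 by rewrite mulsBr smulA pu subrr.
have [/eqP|z0] := eqVneq z 0; first by rewrite subr_eq0 => /eqP <-.
pose c := z ** star z.
have c0 : c != 0.
  apply: contraNneq z0 => c0; rewrite -(starK z); apply/eqP.
  by rewrite (@star_cancel0 _ _ (star z)) ?star0 // starK.
have [g [d [k [pg gc gE]]]] := @support_projection c ltac:(by rewrite starM starK).
have g0 : g != 0 by apply: contraNneq c0 => g0; rewrite -gc g0 mulr0s.
have [|p' /pmax //] := @orth_extend r p g op pg g0.
move=> i; rewrite gE muls_sumr big1 // => j _; rewrite smulZr.
have -> : p i ** spow c j = 0 by case: (nat_of_ord j) => [|m];
  rewrite ?spowSl /spow /= !smulA pz ?mulr0s.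
by rewrite scaler0.
Qed.

(** Maximality forces each [p i] to be a minimal projection: a subprojection [g] would allow [p i]
    to be replaced by [p i - g] and [g]. *)
Lemma orth_corner i a : p i ** a = a -> a ** p i = a ->
  exists k : R[i], a = k *: p i.
Proof.
move=> pa ap; apply: contrapT => /forallNP h.
have [||g [[sg gg] pg g0 gp]] := @split_projection (p i) a _ (p0 i) pa ap.
- by split.
- by move=> k; apply/eqP.
have gpi : g ** p i = g by rewrite -sg -(sp i) -starM pg.
pose q j := if j == i then p i - g else p j.
have pjg j : j != i -> p j ** g = 0.
  by move=> ji; rewrite -pg smulA pp (negPf ji) mulr0s.
have gpj j : j != i -> g ** p j = 0.
  by move=> ji; rewrite -gpi -smulA pp eq_sym (negPf ji) muls0.
have oq : orth_family q.
  split=> [j|j j'|j]; rewrite /q.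
  - by case: ifP => _; rewrite ?starB ?sg ?sp.
  - have [ji|ji] := boolP (j == i); have [ji'|ji'] := boolP (j' == i).
    + rewrite (eqP ji) (eqP ji') eqxx.
      by rewrite mulsBl !mulsBr ppi gpi pg gg subrr subr0.
    + rewrite (eqP ji) eq_sym (negPf ji') mulsBl pp eq_sym (negPf ji').
      by rewrite gpj // subr0.
    + by rewrite (eqP ji') (negPf ji) mulsBr pp (negPf ji) pjg // subr0.
    + by rewrite pp.
  - by case: ifP => _ //; rewrite subr_eq0 eq_sym.
have [|p' /pmax //] := @orth_extend r q g oq (conj sg gg) g0.
move=> j; rewrite /q; have [_|ji] := eqVneq j i; last exact: pjg.
by rewrite mulsBl pg gg subrr.
Qed.

(** For [y = p i x p j], minimality makes [y^* y] a multiple of [p j], and positivity makes the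
    factor positive; [y] divided by its square root is the partial isometry. *)
Lemma orth_isometry i j x : p i ** x ** p j != 0 -> exists v,
  [/\ p i ** v = v, v ** p j = v, star v ** v = p j & v ** star v = p i].
Proof.
set y := p i ** x ** p j => y0.
have py : p i ** y = y by rewrite !smulA ppi.
have yp : y ** p j = y by rewrite -smulA ppi.
have [||k yk] := @orth_corner j (star y ** y).
- by rewrite smulA -{1}(sp j) -starM yp.
- by rewrite -smulA yp.
have yy0 : star y ** y != 0 by apply: contraNneq y0 => /star_cancel0 ->.
have [t tk] : exists t : R, k = t%:C.
  apply/complex_realP; rewrite CrealE; apply/eqP.
  have := congr1 (@star R P) yk; rewrite starM starK starZ sp {1}yk => /eqP.
  by rewrite -subr_eq0 -scalerBl scaler_eq0 (negPf (p0 j)) orbF subr_eq0 => /eqP.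
have t0 : 0 < t.
  have tn0 : t != 0 by apply: contraNneq yy0 => t0; rewrite yk tk t0 scale0r.
  rewrite lt_neqAle eq_sym tn0 leNgt; apply/negP => tneg.
  have pos1 : Pos (star y ** y) by apply: Pos_star_mul orth_sum_unit _.
  have pos2 : Pos ((- t)%:C *: p j).
    by apply: PosZ; [rewrite oppr_ge0 ltW|exists (p j); rewrite ?ppi].
  have := Pos_add_eq0 orth_sum_unit pos1 pos2.
  rewrite yk tk rmorphN scaleNr subrr => /(_ erefl) h.
  by move: yy0; rewrite yk tk h eqxx.
pose s := (Num.sqrt t)^-1; pose v := s%:C *: y.
have vv : star v ** v = p j.
  rewrite starZr smulZl smulZr scalerA yk tk scalerA -!rmorphM.
  by rewrite -expr2 exprVn sqr_sqrtr ?(ltW t0) // mulVf ?gt_eqF // scale1r.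
have pv : p i ** v = v by rewrite smulZr py.
have vp : v ** p j = v by rewrite smulZl yp.
have [||m vm] := @orth_corner i (v ** star v).
- by rewrite smulA pv.
- by rewrite -smulA -{1}(sp i) -starM pv.
exists v; split=> //.
have vvv : v ** star v ** (v ** star v) = v ** star v.
  by rewrite smulA -[v ** _ ** v]smulA vv vp.
have m0 : m != 0.
  have pj : p j = star v ** (v ** star v) ** v by rewrite smulA vv -smulA vv ppi.
  by apply: contraNneq (p0 j) => m0; rewrite pj vm m0 scale0r muls0 mulr0s.
move: vvv; rewrite vm smulZl smulZr ppi scalerA => /eqP.
rewrite -subr_eq0 -scalerBl scaler_eq0 (negPf (p0 i)) orbF.
rewrite -[X in _ - X]mulr1 -mulrBr mulf_eq0 (negPf m0) subr_eq0 => /eqP ->.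
by rewrite scale1r.
Qed.

End MaximalFamily.

(** Equivalence of minimal projections sorts the indices into the simple blocks of [P], and [c]
    chooses a representative of each class. With [u i] a partial isometry from [p (c i)] onto [p i],
    the matrix units are [u i (u j)^*] inside a block and 0 across blocks. *)
Lemma matrix_units : exists r (c : 'I_r -> 'I_r) (e : 'I_r -> 'I_r -> P),
  [/\ (forall i j, c i != c j -> e i j = 0),
      (forall i j, star (e i j) = e j i),
      (forall i j k l, c i = c j -> c k = c l ->
         e i j ** e k l = if j == k then e i l else 0),
      (forall i, e i i != 0) &
      (forall i, c (c i) = c i) /\
      forall x, exists k : 'I_r -> 'I_r -> R[i],
        x = \sum_i \sum_j k i j *: e i j].
Proof.
have [r [p [op pmax]]] := max_orth_family.
have [sp pp p0] := op.
have ppi i : p i ** p i = p i by rewrite pp eqxx.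
pose rel i j := `[< exists v, [/\ p i ** v = v, v ** p j = v,
  star v ** v = p j & v ** star v = p i] >].
have rel_refl i : rel i i by apply/asboolP; exists (p i); rewrite sp ppi.
have rel_sym i j : rel i j -> rel j i.
  move=> /asboolP[v [pv vp vv vv']]; apply/asboolP; exists (star v).
  by rewrite starK -{1}(sp j) -{1}(sp i) -!starM vp pv.
have rel_trans i j k : rel i j -> rel j k -> rel i k.
  move=> /asboolP[v [pv vp vv vv']] /asboolP[w [pw wp ww ww']].
  apply/asboolP; exists (v ** w); rewrite smulA pv -smulA wp starM.
  by rewrite smulA -[_ ** star v ** v]smulA vv -smulA pw ww smulA
    -[v ** w ** _]smulA ww' vp vv'.
(* The choice depends only on the predicate [rel i], so equivalent indices get the same
   representative. *)
pose c i := odflt i [pick j | rel i j].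
have ci i : rel i (c i).
  by rewrite /c; case: pickP => [j //|/(_ i)]; rewrite rel_refl.
have crel i j : rel i j -> c i = c j.
  move=> ij; rewrite /c (@eq_pick _ (rel i) (rel j)) => [|k].
    by case: pickP => // /(_ j); rewrite rel_refl.
  by apply/idP/idP; apply: rel_trans => //; apply: rel_sym.
have /choice[u hu] : forall i, exists v, [/\ p i ** v = v, v ** p (c i) = v,
    star v ** v = p (c i) & v ** star v = p i].
  by move=> i; have /asboolP := ci i.
pose e i j := if c i == c j then u i ** star (u j) else 0.
exists r, c, e; split.
- by move=> i j /negPf cij; rewrite /e cij.
- move=> i j; rewrite /e eq_sym; case: ifP => _; last by rewrite star0.
  by rewrite starM starK.
- move=> i j k l cij ckl; rewrite /e cij ckl !eqxx.
  have [jk|jk] := eqVneq j k.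
    rewrite -jk; have [_ _ uu _] := hu j; have [_ ui _ _] := hu i.
    rewrite smulA -[u i ** _ ** u j]smulA uu -cij ui.
    by rewrite cij jk ckl eqxx.
  have [pj _ _ _] := hu j; have [pk _ _ _] := hu k.
  rewrite -pj -pk starM sp !smulA -[u i ** _ ** p j ** _]smulA pp (negPf jk).
  by rewrite muls0 !mulr0s.
- by move=> i; rewrite /e eqxx; have [_ _ _ ->] := hu i.
- split=> [i|x]; first by rewrite (crel _ _ (rel_sym _ _ (ci i))).
  have key i j : exists k : R[i], p i ** x ** p j = k *: e i j.
    have [->|y0] := eqVneq (p i ** x ** p j) 0; first by exists 0; rewrite scale0r.
    have cij : c i = c j.
      have [v hv] := @orth_isometry _ _ op pmax _ _ _ y0.
      by apply: crel; apply/asboolP; exists v.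
    have [pi ui uui uui'] := hu i; have [pj uj uuj uuj'] := hu j.
    have [||k hk] := @orth_corner _ _ op pmax (c i) (star (u i) ** x ** u j).
    - by rewrite !smulA -{1}(sp (c i)) -starM ui.
    - by rewrite -smulA cij uj.
    exists k; rewrite /e cij eqxx.
    have -> : p i ** x ** p j = u i ** (star (u i) ** x ** u j) ** star (u j).
      by rewrite -uui' -uuj' !smulA.
    by rewrite hk smulZr ui smulZl.
  pose k i j := sval (cid (key i j)); exists k.
  have [x1 x2] := orth_sum_unit op pmax x.
  rewrite -[LHS]x2 -[x in LHS]x1 muls_sumr; under eq_bigr do rewrite muls_suml muls_suml.
  rewrite exchange_big; apply: eq_bigr => i _; apply: eq_bigr => j _.
  exact: svalP (cid (key i j)).
Qed.

End FiniteDimensional.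

(** * Tensor products with finite-dimensional C*-algebras *)

Section StarHomNorm.
Variables (R : realType) (A B : cstarAlgType R) (f : starhom A B) (b : B).
Hypothesis hb : is_unit b.

(** The root of [1 - z^* z] is carried over: the square of [b - f y] is [b - f(z)^* f(z)], even if
    [f] is not unital. *)
Lemma starhom_contr x : nrm (f x) <= nrm x.
Proof.
have [->|x0] := eqVneq x 0; first by rewrite starhom0 !nrm0.
have n0 : 0 < nrm x by rewrite nrm_gt0 x0.
pose z := (nrm x)^-1%:C *: x; pose h := star z ** z.
have [||y [sy yy _ _]] := @sqrt1B R A h; first by rewrite starM starK.
  by rewrite nrm_cstar nrmZr gtr0_norm ?invr_gt0 // mulVf ?gt_eqF.
have hz : nrm (f z) <= 1.
  rewrite -(@ler_pXn2r _ 2) ?nnegrE ?nrm_ge0 // expr1n -nrm_cstar.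
  apply: (nrm_le_Pos hb ler01); first exact: Pos_star_mul hb _.
  exists (b - f y); first by rewrite starB (star_uniq_unit hb) -starhom_star sy.
  have mul1 v : b ** v = v by case: (hb v).
  have mulr1 v : v ** b = v by case: (hb v).
  rewrite mulsBl !mulsBr !mul1 mulr1 -starhomM yy starhomB starhomD.
  by rewrite subr_double_cancel scale1r starhomM starhom_star.
have -> : x = (nrm x)%:C *: z by rewrite scalerA -rmorphM mulfV ?gt_eqF ?scale1r.
by rewrite starhomZ !nrmZr gtr0_norm // ler_wpM2l ?(ltW n0) // gtr0_norm
  ?invr_gt0 // mulVf ?gt_eqF.
Qed.

(** An injective *-homomorphism reflects positivity, here that of [|f x|^2 - x^* x]. *)
Lemma injective_isometric (e : A) : is_unit e -> (forall a, f a = 0 -> a = 0) ->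
  forall x, nrm x <= nrm (f x).
Proof.
move=> he finj x.
suff : nrm (star x ** x) <= nrm (f x) ^+ 2.
  by rewrite nrm_cstar ler_pXn2r ?nnegrE ?nrm_ge0.
apply: (nrm_le_Pos he (sqr_ge0 _)); first exact: Pos_star_mul he _.
apply: (Pos_detect he (I := unit) (B := fun=> B) (f := fun=> f)).
- by rewrite starB starZr (star_uniq_unit he) starM starK.
- by move=> a /(_ tt); exact: finj.
move=> _ d z sd; rewrite addrC => dz; apply: (Pos_add_eq0 hb _ _ dz).
  exact: Pos_star_mul hb _.
rewrite -{1}sd; apply: (Pos_conj hb).
have -> : (nrm (f x) ^+ 2)%:C *: e - star x ** x
    = (nrm (f x) ^+ 2)%:C *: (star e ** e) - star (x ** e) ** (x ** e).
  by have [_ ->] := he x; rewrite (star_uniq_unit he); case: (he e) => ->.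
rewrite starhomB starhomZ !starhomM !starhom_star !starhomM.
have -> : (nrm (f x) ^+ 2)%:C *: (star (f e) ** f e)
      - star (f x ** f e) ** (f x ** f e)
    = star (f e) ** ((nrm (f x) ^+ 2)%:C *: b - star (f x) ** f x) ** f e.
  rewrite mulsBr mulsBl smulZr smulZl starM !smulA; congr (_ *: (_ ** _) - _).
  by case: (hb (star (f e))) => _ ->.
apply: (Pos_conj hb); apply: (Pos_nrm_sub hb); first by rewrite starM starK.
by rewrite nrm_cstar.
Qed.

End StarHomNorm.

(** A direct sum of full matrix algebras indexed by all pairs of ['I_mu_r]: [mu_c] names the block
    of an index, and matrix units between different blocks are zero. Coefficients are therefore
    unique only for matrices that vanish off the blocks. *)
Record mxunits (R : realType) (P : starAlgType R) := MxUnits {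
  mu_r : nat;
  mu_c : 'I_mu_r -> 'I_mu_r;
  mu_e : 'I_mu_r -> 'I_mu_r -> P;
  mu_off : forall i j, mu_c i != mu_c j -> mu_e i j = 0;
  mu_star : forall i j, star (mu_e i j) = mu_e j i;
  mu_mul : forall i j k l, mu_c i = mu_c j -> mu_c k = mu_c l ->
    mu_e i j ** mu_e k l = if j == k then mu_e i l else 0;
  mu_neq0 : forall i, mu_e i i != 0;
  mu_cc : forall i, mu_c (mu_c i) = mu_c i;
  mu_span : forall x, exists k : 'I_mu_r -> 'I_mu_r -> R[i],
    x = \sum_i \sum_j k i j *: mu_e i j
}.

Section TensorStructure.
Variables (R : realType) (P : cstarAlgType R) (U : mxunits P).
Local Notation r := (mu_r U).
Local Notation c := (@mu_c _ _ U).
Local Notation e := (@mu_e _ _ U).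

Lemma mu_mulE i j k l : e i j ** e k l =
  if [&& j == k, c i == c j & c k == c l] then e i l else 0.
Proof.
have [ij|/mu_off ->] := eqVneq (c i) (c j); last by rewrite /= andbF mulr0s.
have [kl|/mu_off ->] := eqVneq (c k) (c l); last by rewrite /= andbF muls0.
by rewrite mu_mul //= andbT.
Qed.

Lemma mu_unit : is_unit (\sum_i e i i).
Proof.
suff h x : (\sum_i e i i) ** x = x.
  move=> x; split=> //; rewrite -[RHS]starK -[in RHS](h (star x)) starM starK.
  by congr (_ ** _); rewrite star_sum; apply: eq_bigr => i _; rewrite mu_star.
have [k ->] := mu_span U x; rewrite muls_sumr; apply: eq_bigr => i _.
rewrite muls_sumr; apply: eq_bigr => j _; rewrite smulZr; congr (_ *: _).
rewrite muls_suml (bigD1 i) //= big1 ?addr0 => [|l li].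
  by rewrite mu_mulE !eqxx /=; have [//|/mu_off ->] := eqVneq (c i) (c j).
by rewrite mu_mulE (negPf li).
Qed.

Definition isblock (X : Type) (z : X) (Y : 'I_r * 'I_r -> X) :=
  forall i j, c i != c j -> Y (i, j) = z.

Section Tensor.
Variables (X : cstarAlgType R) (u : X) (hu : is_unit u) (T : cstar_tensor P X).
Implicit Types (x : X) (t : T) (Y Z : fmat 'I_r X).

Lemma tens0l x : tens T 0 x = 0.
Proof. by rewrite -(scale0r (0 : P)) tensZl !scale0r. Qed.

Lemma tens0r p : tens T p 0 = 0.
Proof. by rewrite -(scale0r (0 : X)) tensZr !scale0r. Qed.

Lemma tens_suml I (s : seq I) (Q : pred I) (F : I -> P) x :
  tens T (\sum_(i <- s | Q i) F i) x = \sum_(i <- s | Q i) tens T (F i) x.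
Proof.
by apply: (big_morph (fun p => tens T p x)) => [p q|]; rewrite ?tensDl ?tens0l.
Qed.

Lemma tens_sumr I (s : seq I) (Q : pred I) (F : I -> X) p :
  tens T p (\sum_(i <- s | Q i) F i) = \sum_(i <- s | Q i) tens T p (F i).
Proof. by apply: (big_morph (tens T p)) => [x y|]; rewrite ?tensDr ?tens0r. Qed.

Lemma tens_approx t (d : R) : 0 < d -> exists n (p : 'I_n -> P) (x : 'I_n -> X),
  nrm (t - \sum_i tens T (p i) (x i)) <= d.
Proof.
move=> d0; have [w [n [k [v [hv ->]]]] hw] :=
  (dense_nrm _).1 (@tens_dense _ _ _ T) t d d0.
have /choice[px hpx] : forall i, exists px : P * X, v i = tens T px.1 px.2.
  by move=> i; have [p [x ->]] := hv i; exists (p, x).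
exists n, (fun i => k i *: (px i).1), (fun i => (px i).2).
by apply: le_trans hw; rewrite le_eqVlt; apply/orP; left; apply/eqP;
  congr (nrm (_ - _)); apply: eq_bigr => i _; rewrite tensZl hpx.
Qed.

Lemma tens_unit : is_unit (tens T (\sum_i e i i) u).
Proof.
set w := tens T _ u.
have sw : star w = w.
  by rewrite tens_star (star_uniq_unit mu_unit) (star_uniq_unit hu).
suff h t : w ** t = t.
  by move=> t; split=> //; rewrite -[LHS]starK starM sw h starK.
apply: subr0_eq; apply: nrm_small => d d0.
have w1 : 0 < nrm w + 1 by rewrite ltr_wpDl ?nrm_ge0.
have [n [p [x hs]]] := tens_approx t (divr_gt0 d0 w1).
set s := \sum_i _ in hs.
have ws : w ** s = s.
  rewrite muls_sumr; apply: eq_bigr => i _; rewrite tensM.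
  by case: (mu_unit (p i)) => -> _; case: (hu (x i)) => -> _.
have -> : w ** t - t = w ** (t - s) - (t - s).
  by rewrite mulsBr ws opprB addrA subrK.
rewrite (le_trans (nrmD _ _)) // nrmN -[leRHS](divfK (lt0r_neq0 w1)).
have n1 := le_trans (nrmM w (t - s)) (ler_wpM2l (nrm_ge0 w) hs).
by rewrite mulrDr mulr1 lerD // mulrC.
Qed.

Fact tens_homM i x y : tens T (e i i) (x ** y)
  = tens T (e i i) x ** tens T (e i i) y.
Proof. by rewrite tensM mu_mulE !eqxx. Qed.

Fact tens_hom_star i x : tens T (e i i) (star x) = star (tens T (e i i) x).
Proof. by rewrite tens_star mu_star. Qed.

Definition tens_hom i : starhom X T := @StarHom R X T (tens T (e i i))
  (tensDr T (e i i)) (fun k x => tensZr T k (e i i) x)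
  (tens_homM i) (tens_hom_star i).

(** [x |-> e i i (x) x] is an injective *-homomorphism, hence isometric for whichever C*-norm [T]
    carries. *)
Lemma tens_eii_nrm i x : nrm (tens T (e i i) x) = nrm x.
Proof.
apply/le_anti; rewrite (starhom_contr (tens_hom i) tens_unit) /=.
suff finj y : tens_hom i y = 0 -> y = 0.
  exact: (injective_isometric tens_unit hu finj x).
move=> /= hy.
have := @tens_inj _ _ _ T 1 (fun=> e i i) (fun=> y) _ _ ord0; apply.
  move=> k; rewrite big_ord1 => /eqP; rewrite scaler_eq0 (negPf (mu_neq0 i)).
  by rewrite orbF => /eqP h j; rewrite ord1.
by rewrite big_ord1.
Qed.

Definition tmat Y : T := \sum_i \sum_j tens T (e i j) (Y (i, j)).

(** The entry [(i, j)], transported to the diagonal corner of [e i i], where its norm can be read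
    off. *)
Definition tcorner i j t := tens T (e i i) u ** t ** tens T (e j i) u.

Lemma tcorner_tmat i j Y : c i = c j -> tcorner i j (tmat Y) = tens T (e i i) (Y (i, j)).
Proof.
move=> cij; rewrite /tcorner /tmat muls_sumr muls_suml (bigD1 i) //= [X in _ + X]big1.
  rewrite addr0 muls_sumr muls_suml (bigD1 j) //= [X in _ + X]big1.
    rewrite addr0 !tensM !mu_mulE !eqxx cij eqxx /= mu_mulE !eqxx cij eqxx /=.
    by case: (hu (Y (i, j))) => -> ->.
  move=> k kj; rewrite !tensM -smulA mu_mulE (negPf kj) /= muls0.
  by rewrite tens0l.
move=> k ki; rewrite muls_sumr muls_suml big1 // => j' _.
by rewrite !tensM mu_mulE eq_sym (negPf ki) /= mulr0s tens0l.
Qed.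

Lemma nrm_tens_eiju i j : nrm (tens T (e i j) u) <= 1.
Proof.
rewrite -(@ler_pXn2r _ 2) ?nnegrE ?nrm_ge0 // expr1n -nrm_cstar tens_star tensM.
rewrite mu_star mu_mulE eqxx /= (star_uniq_unit hu); case: (hu u) => -> _.
case: ifP => _; last by rewrite tens0l nrm0.
by rewrite tens_eii_nrm (nrm_unit hu).
Qed.

Lemma nrm_tcorner i j t : nrm (tcorner i j t) <= nrm t.
Proof.
rewrite (le_trans (nrmM _ _)) // -[leRHS]mulr1 ler_pM ?nrm_ge0 ?nrm_tens_eiju //.
rewrite (le_trans (nrmM _ _)) // -[leRHS]mul1r ler_pM ?nrm_ge0 ?nrm_tens_eiju //.
Qed.

Lemma nrm_tens_eij i j x : nrm (tens T (e i j) x) <= nrm x.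
Proof.
have [cij|/mu_off ->] := eqVneq (c i) (c j); last by rewrite tens0l nrm0 nrm_ge0.
have -> : tens T (e i j) x = tens T (e i j) u ** tens T (e j j) x.
  by rewrite tensM mu_mulE !eqxx cij eqxx /=; case: (hu x) => ->.
rewrite (le_trans (nrmM _ _)) // -[leRHS]mul1r ler_pM ?nrm_ge0 ?nrm_tens_eiju //.
by rewrite tens_eii_nrm.
Qed.

Lemma tmatD Y Z : tmat (Y + Z) = tmat Y + tmat Z.
Proof.
rewrite /tmat -big_split; apply: eq_bigr => i _; rewrite -big_split.
by apply: eq_bigr => j _; rewrite fmatD tensDr.
Qed.

Lemma tmatZ (k : R[i]) Y : tmat (k *: Y) = k *: tmat Y.
Proof.
rewrite /tmat scaler_sumr; apply: eq_bigr => i _; rewrite scaler_sumr.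
by apply: eq_bigr => j _; rewrite fmatZ tensZr.
Qed.

Lemma tmat_block Y : exists2 Z : fmat 'I_r X, isblock 0 Z & tmat Z = tmat Y.
Proof.
exists [ffun p => if c p.1 == c p.2 then Y p else 0].
  by move=> i j; rewrite ffunE => /negPf /= ->.
apply: eq_bigr => i _; apply: eq_bigr => j _; rewrite ffunE /=.
by have [//|/mu_off ->] := eqVneq (c i) (c j); rewrite !tens0l.
Qed.

Lemma tmat_inj Y Z : isblock 0 Y -> isblock 0 Z -> tmat Y = tmat Z -> Y = Z.
Proof.
move=> bY bZ YZ; apply/ffunP => -[i j].
have [cij|cij] := eqVneq (c i) (c j); last by rewrite bY // bZ.
apply: subr0_eq; apply: nrm0_eq0; rewrite -(tens_eii_nrm i) tensDr.
by rewrite -scaleN1r tensZr scaleN1r -!tcorner_tmat // YZ subrr nrm0.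
Qed.

Lemma tmat_approx t (d : R) : 0 < d -> exists Y, nrm (t - tmat Y) <= d.
Proof.
move=> /(tens_approx t)[n [p [x hx]]].
have [k hk] := choice (fun l => mu_span U (p l)).
exists [ffun q => \sum_l k l q.1 q.2 *: x l].
suff -> : tmat [ffun q => \sum_l k l q.1 q.2 *: x l]
    = \sum_i tens T (p i) (x i) by [].
transitivity (\sum_i \sum_j \sum_l tens T (k l i j *: e i j) (x l)).
  apply: eq_bigr => i _; apply: eq_bigr => j _; rewrite ffunE tens_sumr.
  by apply: eq_bigr => l _; rewrite tensZr tensZl.
under eq_bigr do rewrite exchange_big.
rewrite exchange_big; apply: eq_bigr => l _ /=; rewrite hk tens_suml.
by apply: eq_bigr => i _; rewrite tens_suml.
Qed.

(* The algebraic tensor product is already complete, because the corners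
   [e i i (x) X] are isometric copies of [X]. *)
Lemma tmat_surj t : exists2 Y : fmat 'I_r X, isblock 0 Y & t = tmat Y.
Proof.
have /choice[Y hY] : forall n, exists Y, nrm (t - tmat Y) <= n.+1%:R^-1.
  by move=> n; apply: tmat_approx; rewrite invr_gt0.
have cY : cvs (fun n => tmat (Y n)) t.
  move=> d /invS_small [N hN]; exists N => n /hN; apply: le_trans.
  by rewrite nrmB.
have /choice[l hl] : forall p, exists l, c p.1 = c p.2 ->
    cvs (fun n => Y n p) l.
  move=> [i j] /=.
  have [cij|cij] := eqVneq (c i) (c j); last by exists 0 => h; rewrite h eqxx in cij.
  have [|l hl] := @cauchys_cvs R X (fun n => Y n (i, j)); last by exists l.
  move=> d /(cvs_cauchys cY)[N hN]; exists N => m n Nm Nn.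
  apply: le_trans (hN m n Nm Nn).
  rewrite -(tens_eii_nrm i) tensDr -scaleN1r tensZr scaleN1r -!tcorner_tmat //.
  rewrite -mulsBl -mulsBr -/(tcorner i j (tmat (Y m) - tmat (Y n))).
  exact: nrm_tcorner.
pose Z : fmat 'I_r X := [ffun p => l p].
have [W bW WZ] := tmat_block Z; exists W => //; rewrite WZ.
apply: (cvs_uniq cY).
have cvs_sum (I : Type) (s : seq I) (F : I -> nat -> T) (G : I -> T) :
    (forall i, cvs (F i) (G i)) ->
    cvs (fun n => \sum_(i <- s) F i n) (\sum_(i <- s) G i).
  move=> FG; elim: s => [|i s IH].
    by rewrite big_nil; apply: (cvs_ext _ (cvs_cst 0)) => n; rewrite big_nil.
  rewrite big_cons; apply: (cvs_ext _ (cvsD (FG i) IH)) => n.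
  by rewrite big_cons.
apply: (cvs_sum) => i; apply: (cvs_sum) => j; rewrite ffunE.
have [cij|/mu_off ->] := eqVneq (c i) (c j); last first.
  by apply: (cvs_ext _ (cvs_cst _)) => n; rewrite !tens0l.
move=> d /(hl (i, j) cij)[N hN]; exists N => n /hN; apply: le_trans.
by rewrite -[- tens _ _ _]scaleN1r -tensZr scaleN1r -tensDr nrm_tens_eij.
Qed.

Definition tcoef t : fmat 'I_r X := s2val (cid2 (tmat_surj t)).

Lemma tcoef_block t : isblock 0 (tcoef t).
Proof. exact: s2valP (cid2 (tmat_surj t)). Qed.

Lemma tcoefK t : tmat (tcoef t) = t.
Proof. exact/esym/(s2valP' (cid2 (tmat_surj t))). Qed.

Lemma tmatK Y : isblock 0 Y -> tcoef (tmat Y) = Y.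
Proof. by move=> bY; apply: tmat_inj; rewrite ?tcoefK //; apply: tcoef_block. Qed.

Lemma block_add Y Z : isblock 0 Y -> isblock 0 Z -> isblock 0 (Y + Z).
Proof. by move=> bY bZ i j ij; rewrite fmatD bY // bZ // addr0. Qed.

Lemma block_scale (k : R[i]) Y : isblock 0 Y -> isblock 0 (k *: Y).
Proof. by move=> bY i j ij; rewrite fmatZ bY // scaler0. Qed.

Lemma block_mul Y Z : isblock 0 Y -> isblock 0 Z -> isblock 0 (Y ** Z).
Proof.
move=> bY bZ i j ij; rewrite fmatM big1 // => k _.
have [ik|ik] := eqVneq (c i) (c k); last by rewrite bY // mulr0s.
by rewrite bZ ?muls0 // -ik.
Qed.

Lemma block_star Y : isblock 0 Y -> isblock 0 (star Y).
Proof. by move=> bY i j ij; rewrite fmat_starE bY ?star0 // eq_sym. Qed.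

Lemma tmatM Y Z : isblock 0 Y -> isblock 0 Z -> tmat (Y ** Z) = tmat Y ** tmat Z.
Proof.
move=> bY bZ; rewrite [RHS]muls_suml; apply: eq_bigr => i _.
rewrite muls_suml /tmat.
transitivity (\sum_l \sum_j tens T (e i l) (Y (i, j) ** Z (j, l))).
  by apply: eq_bigr => l _; rewrite fmatM tens_sumr.
rewrite exchange_big; apply: eq_bigr => j _; rewrite muls_sumr.
rewrite [RHS](bigD1 j) //= [X in _ + X]big1 ?addr0 => [|k kj].
  rewrite muls_sumr; apply: eq_bigr => l _; rewrite tensM mu_mulE eqxx /=.
  have [ij|ij] := eqVneq (c i) (c j); last by rewrite bY // mulr0s !tens0r.
  by have [jl|jl] := eqVneq (c j) (c l); last by rewrite bZ // muls0 !tens0r.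
rewrite muls_sumr big1 // => l _.
by rewrite tensM mu_mulE eq_sym (negPf kj) tens0l.
Qed.

Lemma tmat_star Y : tmat (star Y) = star (tmat Y).
Proof.
rewrite /tmat star_sum exchange_big; apply: eq_bigr => i _; rewrite star_sum.
by apply: eq_bigr => j _; rewrite tens_star mu_star fmat_starE.
Qed.

Fact tcoefD s t : tcoef (s + t) = tcoef s + tcoef t.
Proof.
apply: tmat_inj; [exact: tcoef_block|by apply: block_add; apply: tcoef_block|].
by rewrite tmatD !tcoefK.
Qed.

Fact tcoefZ (k : R[i]) t : tcoef (k *: t) = k *: tcoef t.
Proof.
apply: tmat_inj; [exact: tcoef_block|by apply: block_scale; apply: tcoef_block|].
by rewrite tmatZ !tcoefK.
Qed.

Fact tcoefM s t : tcoef (s ** t) = tcoef s ** tcoef t.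
Proof.
apply: tmat_inj; [exact: tcoef_block|by apply: block_mul; apply: tcoef_block|].
by rewrite tmatM ?tcoefK //; apply: tcoef_block.
Qed.

Fact tcoef_star t : tcoef (star t) = star (tcoef t).
Proof.
apply: tmat_inj; [exact: tcoef_block|by apply: block_star; apply: tcoef_block|].
by rewrite tmat_star !tcoefK.
Qed.

Definition tcoef_hom : starhom T (fmat 'I_r X) :=
  StarHom tcoefD tcoefZ tcoefM tcoef_star.

End Tensor.

Lemma tens_tmat (X : cstarAlgType R) (T : cstar_tensor P X)
    (k : 'I_r -> 'I_r -> R[i]) x :
  tens T (\sum_i \sum_j k i j *: e i j) x
  = tmat T [ffun p => k p.1 p.2 *: x].
Proof.
rewrite tens_suml; apply: eq_bigr => i _; rewrite tens_suml.
by apply: eq_bigr => j _; rewrite ffunE tensZl tensZr.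
Qed.

(** Keeping the coefficients defines an injective *-homomorphism from [T] to any other completion
    [T'], hence an isometry: all C*-norms on the algebraic tensor product agree. *)
Lemma min_tensor (X : cstarAlgType R) (u : X) (T : cstar_tensor P X) :
  is_unit u -> is_min_tensor T.
Proof.
move=> hu T' n a b.
pose Jf (t : T) : T' := tmat T' (tcoef hu t).
have JD s t : Jf (s + t) = Jf s + Jf t by rewrite /Jf tcoefD tmatD.
have JZ (k : R[i]) t : Jf (k *: t) = k *: Jf t by rewrite /Jf tcoefZ tmatZ.
have JM s t : Jf (s ** t) = Jf s ** Jf t.
  by rewrite /Jf tcoefM tmatM //; apply: tcoef_block.
have Jstar t : Jf (star t) = star (Jf t) by rewrite /Jf tcoef_star tmat_star.
pose J := StarHom JD JZ JM Jstar.
have Jinj t : J t = 0 -> t = 0.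
  have block0 : isblock (0 : X) (0 : fmat 'I_r X) by move=> i j _; rewrite fmat0.
  have tmat0 (S : cstar_tensor P X) : tmat S (0 : fmat 'I_r X) = 0.
    by rewrite -(scale0r (0 : fmat 'I_r X)) tmatZ scale0r.
  move=> Jt; rewrite -(tcoefK hu t).
  suff -> : tcoef hu t = 0 by apply: tmat0.
  apply: (tmat_inj hu (T := T')) => //; first exact: tcoef_block.
  by rewrite tmat0.
have Jtens p x : J (tens T p x) = tens T' p x.
  have [k ->] := mu_span U p; rewrite !tens_tmat /= /Jf.
  have [Z bZ ZY] := tmat_block T [ffun q => k q.1 q.2 *: x].
  rewrite -ZY tmatK //.
  apply: eq_bigr => i _; apply: eq_bigr => j _.
  have [cij|/mu_off ->] := eqVneq (c i) (c j); last by rewrite !tens0l.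
  congr (tens _ _ _); apply: subr0_eq; apply: nrm0_eq0.
  rewrite -(tens_eii_nrm hu T i) tensDr -scaleN1r tensZr scaleN1r.
  by rewrite -!(tcorner_tmat hu) // ZY subrr nrm0.
rewrite !normE lecR.
have -> : \sum_i tens T' (a i) (b i) = J (\sum_i tens T (a i) (b i)).
  by rewrite starhom_sum; apply: eq_bigr => i _; rewrite Jtens.
exact: (injective_isometric (@tens_unit X u hu T') (@tens_unit X u hu T) Jinj).
Qed.

End TensorStructure.

Lemma lin_span_fin (R : realType) (V : lmodType R[i]) (S : set V) (J : finType)
    (v : J -> V) : (forall j, S (v j)) -> lin_span S (\sum_j v j).
Proof.
move=> Sv; exists #|J|, (fun=> 1), (fun i => v (enum_val i)); split=> //.
by under [RHS]eq_bigr do rewrite scale1r; rewrite -(big_enum_val v); apply: eq_bigl.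
Qed.

Lemma dense_full (R : realType) (V : normedModType R[i]) (S : set V) :
  (forall v, S v) -> dense S.
Proof. by move=> h; apply/dense_nrm => v d d0; exists v; rewrite ?subrr ?nrm0 ?ltW. Qed.

(** * Concrete models of tensor products *)

Section ScalarTensor.
Variables (R : realType) (P : cstarAlgType R).

Fact stens_inj n (a : 'I_n -> P) (b : 'I_n -> scal R) : lin_indep a ->
  \sum_i (b i : R[i]) *: a i = 0 -> forall i, b i = 0.
Proof. by move=> la ha i; apply: la ha i. Qed.

(** [P (x) C = P], so the coefficient map of tensor products also yields the coordinates of elements
    of [P]. *)
Definition scalar_tensor : cstar_tensor P (scal R).
Proof.
refine (@CstarTensor R P (scal R) P (fun p (z : scal R) => (z : R[i]) *: p)
  _ _ _ _ _ _ stens_inj _).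
- by move=> a a' b; rewrite scalerDr.
- by move=> a b b'; rewrite scalerDl.
- by move=> k a b; rewrite !scalerA mulrC.
- by move=> k a b; rewrite scalerA.
- by move=> a a' b b'; rewrite smulZl smulZr scalerA.
- by move=> a b; rewrite starZ.
- apply: dense_full => v; exists 1%N, (fun=> 1), (fun=> v); split.
    by move=> _; exists v, 1; rewrite scale1r.
  by rewrite big_ord1 scale1r.
Defined.

Lemma scal_unit : is_unit (1 : scal R).
Proof. by move=> a; split; [exact: mul1r|exact: mulr1]. Qed.

End ScalarTensor.

Section CoefficientMaps.
Variables (R : realType) (P : cstarAlgType R) (U : mxunits P).
Local Notation r := (mu_r U).
Local Notation c := (@mu_c _ _ U).
Local Notation e := (@mu_e _ _ U).

Definition pcoef : starhom P (fmat 'I_r (scal R)) :=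
  tcoef_hom U (@scal_unit R) (scalar_tensor P).

Lemma pcoef_block p : isblock 0 (pcoef p).
Proof. exact: tcoef_block. Qed.

Lemma pcoefK p : \sum_i \sum_j (pcoef p (i, j) : R[i]) *: e i j = p.
Proof. exact: (tcoefK U (@scal_unit R) (T := scalar_tensor P)). Qed.

Lemma tcoef_tens (X : cstarAlgType R) (u : X) (hu : is_unit u)
    (T : cstar_tensor P X) p x q :
  tcoef U hu (tens T p x) q = (pcoef p q : R[i]) *: x.
Proof.
pose Y : fmat 'I_r X := [ffun q => (pcoef p q : R[i]) *: x].
suff -> : tens T p x = tmat T Y.
  rewrite tmatK; first by rewrite ffunE.
  by move=> i j ij; rewrite ffunE pcoef_block // scale0r.
rewrite -{1}(pcoefK p) tens_suml; apply: eq_bigr => i _; rewrite tens_suml.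
by apply: eq_bigr => j _; rewrite ffunE tensZl tensZr.
Qed.

Section TensMap.
Variables (X X' : cstarAlgType R) (u : X) (hu : is_unit u).
Variables (T : cstar_tensor P X) (T' : cstar_tensor P X') (f : starhom X X').

Definition fmat_map (Y : fmat 'I_r X) : fmat 'I_r X' := [ffun q => f (Y q)].

Fact fmat_map_block (Y : fmat 'I_r X) : isblock 0 Y -> isblock 0 (fmat_map Y).
Proof. by move=> bY i j ij; rewrite ffunE bY // starhom0. Qed.

Definition tens_map_fun (t : T) : T' := tmat T' (fmat_map (tcoef U hu t)).

Fact tens_map_funD s t : tens_map_fun (s + t) = tens_map_fun s + tens_map_fun t.
Proof.
rewrite /tens_map_fun tcoefD -tmatD; congr tmat.
by apply/ffunP => q; rewrite !ffunE starhomD.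
Qed.

Fact tens_map_funZ (k : R[i]) t : tens_map_fun (k *: t) = k *: tens_map_fun t.
Proof.
rewrite /tens_map_fun tcoefZ -tmatZ; congr tmat.
by apply/ffunP => q; rewrite !ffunE starhomZ.
Qed.

Fact tens_map_funM s t : tens_map_fun (s ** t) = tens_map_fun s ** tens_map_fun t.
Proof.
rewrite /tens_map_fun tcoefM -tmatM; first congr tmat.
- apply/ffunP => q; rewrite !ffunE starhom_sum.
  by apply: eq_bigr => k _; rewrite starhomM !ffunE.
- by apply: fmat_map_block; apply: tcoef_block.
- by apply: fmat_map_block; apply: tcoef_block.
Qed.

Fact tens_map_fun_star t : tens_map_fun (star t) = star (tens_map_fun t).
Proof.
rewrite /tens_map_fun tcoef_star -tmat_star; congr tmat.
by apply/ffunP => -[i j]; rewrite ffunE !fmat_starE starhom_star ffunE.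
Qed.

Definition tens_map : starhom T T' :=
  StarHom tens_map_funD tens_map_funZ tens_map_funM tens_map_fun_star.

Lemma tens_map_tens p x : tens_map (tens T p x) = tens T' p (f x).
Proof.
rewrite -{2}(pcoefK p) tens_suml; apply: eq_bigr => i _; rewrite tens_suml.
by apply: eq_bigr => j _; rewrite ffunE tcoef_tens starhomZ tensZl tensZr.
Qed.

End TensMap.

Section BlockTensor.
Variables (X : cstarAlgType R) (u : X) (hu : is_unit u) (sep : separated X).

Fact block_closed (v : nat -> rmat 'I_r hu sep) (l : rmat 'I_r hu sep) :
  (forall n, isblock 0 (v n)) -> cvs v l -> isblock 0 l.
Proof.
move=> bv vl i j ij; apply: nrm_small => d /vl [N /(_ N (leqnn N)) hN].
apply: le_trans hN; rewrite nrmB (le_trans _ (rnorm_entry _ (i, j))) //.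
by rewrite fmatD fmatN bv // subr0.
Qed.

Definition block_csub : csubalg (rmat 'I_r hu sep).
Proof.
refine (@CSubAlg R (rmat 'I_r hu sep) (isblock 0) _ _ _ _ _ block_closed).
- by move=> i j _; rewrite fmat0.
- by move=> a b; apply: block_add.
- by move=> k a; apply: block_scale.
- by move=> a b; apply: block_mul.
- by move=> a; apply: block_star.
Defined.

Definition btens_mat p x : fmat 'I_r X := [ffun q => (pcoef p q : R[i]) *: x].

Fact btens_block p x : csub_set block_csub (btens_mat p x).
Proof. by move=> i j ij; rewrite ffunE pcoef_block // scale0r. Qed.

Definition btens p x : csub block_csub := CSub (btens_block p x).

Fact btens_inj n (a : 'I_n -> P) (b : 'I_n -> X) : lin_indep a ->
  \sum_i btens (a i) (b i) = 0 -> forall i, b i = 0.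
Proof.
move=> la /(congr1 (@csval _ _ _)); rewrite csval_sum /= => h i.
(* Matrix entries of representations separate the points of [X], which reduces injectivity to linear
   independence over the scalars. *)
apply: sep => m s; apply/ffunP => q; rewrite fmat0.
apply: (la (fun i => s (b i) q)).
rewrite (eq_bigr (fun i => \sum_j \sum_k ((s (b i) q : R[i]) * pcoef (a i) (j, k)) *: e j k)).
  rewrite exchange_big big1 // => j _; rewrite exchange_big big1 // => k _.
  rewrite -scaler_suml /=.
  have := congr1 (fun Y : fmat 'I_r X => s (Y (j, k)) q) h.
  rewrite /= sum_ffunE fmat0 starhom0 fmat0 starhom_sum sum_ffunE => hs.
  rewrite (_ : \sum_i0 _ = 0) ?scale0r // -[RHS]hs; apply: eq_bigr => l _.
  by rewrite ffunE starhomZ fmatZ mulrC.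
move=> l _; rewrite -{1}(pcoefK (a l)) scaler_sumr; apply: eq_bigr => j _.
by rewrite scaler_sumr; apply: eq_bigr => k _; rewrite scalerA.
Qed.

Lemma pcoef_e i j q : c i = c j -> pcoef (e i j) q = ((i, j) == q)%:R.
Proof.
move=> cij; pose Y : fmat 'I_r (scal R) := [ffun q => ((i, j) == q)%:R].
have -> : e i j = tmat (scalar_tensor P) Y.
  rewrite /tmat (bigD1 i) //= (bigD1 j) //= ffunE eqxx scale1r.
  rewrite big1 ?addr0 => [|l lj]; last first.
    by rewrite ffunE xpair_eqE [j == l]eq_sym (negPf lj) andbF scale0r.
  rewrite big1 ?addr0 // => k ki; rewrite big1 // => l _.
  by rewrite ffunE xpair_eqE [i == k]eq_sym (negPf ki) scale0r.
rewrite /pcoef /= tmatK ?ffunE // => k l kl; rewrite ffunE xpair_eqE.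
by case: eqP => // ik; case: eqP => // jl; rewrite -ik -jl cij eqxx in kl.
Qed.

(** Block matrices over [X], normed by the representations of [X], are a model of [P (x) X].
    Homomorphisms into it are given by their entries, which is how targets for the universal
    property are produced. *)
Definition block_tensor : cstar_tensor P X.
Proof.
refine (@CstarTensor R P X (csub block_csub) btens _ _ _ _ _ _ btens_inj _).
- move=> a a' b; apply/csval_inj/ffunP => q.
  by rewrite fmatD !ffunE starhomD fmatD scalerDl.
- by move=> a b b'; apply/csval_inj/ffunP => q; rewrite fmatD !ffunE scalerDr.
- move=> k a b; apply/csval_inj/ffunP => q.
  by rewrite fmatZ !ffunE starhomZ fmatZ scalerA.
- move=> k a b; apply/csval_inj/ffunP => q; rewrite fmatZ !ffunE !scalerA.
  by rewrite mulrC.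
- move=> a a' b b'; apply/csval_inj/ffunP => -[i j]; rewrite fmatM ffunE.
  rewrite starhomM fmatM scaler_suml; apply: eq_bigr => k _.
  by rewrite !ffunE smulZl smulZr scalerA.
- move=> a b; apply/csval_inj/ffunP => -[i j].
  by rewrite fmat_starE !ffunE starZ starhom_star fmat_starE.
- apply: dense_full => Y.
  (* Pairs of indices from different blocks contribute [btens 0], so that every term is an
     elementary tensor. *)
  suff -> : Y = \sum_q (if c q.1 == c q.2 then btens (e q.1 q.2) (csval Y q)
      else btens 0 (csval Y q)).
    by apply: lin_span_fin => q; case: ifP => _; eexists; eexists; reflexivity.
  apply/csval_inj/ffunP => q; rewrite csval_sum sum_ffunE.
  rewrite (bigD1 q) //= big1 ?addr0 => [|q' qq'].
    case: eqP => [cq|/eqP cq]; rewrite ffunE.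
      by rewrite pcoef_e // -surjective_pairing eqxx scale1r.
    rewrite starhom0 fmat0 scale0r; case: q cq => i j /= cq.
    exact: (csvalP Y).
  case: eqP => [cq|/eqP cq]; rewrite ffunE.
    by rewrite pcoef_e // -surjective_pairing (negPf qq') scale0r.
  by rewrite starhom0 fmat0 scale0r.
Defined.

End BlockTensor.

Section SubTensor.
Variables (X : cstarAlgType R) (u : X) (hu : is_unit u) (T : cstar_tensor P X).
Variable G : csubalg X.

Definition coef_in (t : T) := forall q, csub_set G (tcoef U hu t q).

Fact csub_sum (I : Type) (s : seq I) (F : I -> X) :
  (forall i, csub_set G (F i)) -> csub_set G (\sum_(i <- s) F i).
Proof.
move=> h; elim/big_ind: _ => [|x y|i _]; [exact: csub0|exact: csubD|exact: h].
Qed.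

Fact coef_in_closed (v : nat -> T) l :
  (forall n, coef_in (v n)) -> cvs v l -> coef_in l.
Proof.
move=> bv vl [i j]; have [cij|cij] := eqVneq (c i) (c j); last first.
  by rewrite tcoef_block //; exact: csub0.
apply: (@csub_closed _ _ G (fun n => tcoef U hu (v n) (i, j))) => [n|].
  exact: bv.
move=> d /vl [N hN]; exists N => n /hN; apply: le_trans.
rewrite -(tens_eii_nrm hu T i) tensDr -scaleN1r tensZr scaleN1r.
rewrite -!(tcorner_tmat hu) // !tcoefK -mulsBl -mulsBr.
exact: (nrm_tcorner hu i j (v n - l)).
Qed.

Definition coef_csub : csubalg T.
Proof.
refine (@CSubAlg R T coef_in _ _ _ _ _ coef_in_closed).
- move=> q; rewrite -(scale0r (0 : T)) tcoefZ scale0r fmat0; exact: csub0.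
- by move=> a b ha hb q; rewrite tcoefD fmatD; apply: csubD.
- by move=> k a ha q; rewrite tcoefZ fmatZ; apply: csubZ.
- move=> a b ha hb [i j]; rewrite tcoefM fmatM; apply: csub_sum => k.
  exact: csubM.
- by move=> a ha [i j]; rewrite tcoef_star fmat_starE; apply: csub_star.
Defined.

Fact sub_tens_in p (x : csub G) : csub_set coef_csub (tens T p (csval x)).
Proof. by move=> q; rewrite tcoef_tens; apply/csubZ/csvalP. Qed.

Definition sub_tens p x : csub coef_csub := CSub (sub_tens_in p x).

Fact sub_tens_inj n (a : 'I_n -> P) (b : 'I_n -> csub G) : lin_indep a ->
  \sum_i sub_tens (a i) (b i) = 0 -> forall i, b i = 0.
Proof.
move=> la /(congr1 (@csval _ _ _)); rewrite csval_sum => /(tens_inj la) h i.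
by apply: csval_inj; rewrite h.
Qed.

(** [P (x) G] inside [P (x) X] for a closed subalgebra [G], cut out by the condition that all
    coefficients lie in [G]; it is the target to which [Phi] is restricted in [generated]. *)
Definition sub_tensor : cstar_tensor P (csub G).
Proof.
refine (@CstarTensor R P (csub G) (csub coef_csub) sub_tens _ _ _ _ _ _ sub_tens_inj _).
- by move=> a a' b; apply/csval_inj/tensDl.
- by move=> a b b'; apply/csval_inj/tensDr.
- by move=> k a b; apply/csval_inj/tensZl.
- by move=> k a b; apply/csval_inj/tensZr.
- by move=> a a' b b'; apply/csval_inj/tensM.
- by move=> a b; apply/csval_inj/tens_star.
- apply: dense_full => t.
  suff -> : t = \sum_q sub_tens (e q.1 q.2) (CSub (csvalP t q)).
    by apply: lin_span_fin => q; eexists; eexists; reflexivity.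
  apply: csval_inj; rewrite csval_sum /= -[LHS](tcoefK U hu) /tmat pair_bigA.
  by apply: eq_bigr => -[].
Defined.

End SubTensor.

End CoefficientMaps.

(** * Morphisms and the universal property *)

Section Composition.
Variables (R : realType) (A B C : starAlgType R).
Variables (g : starhom B C) (f : starhom A B).

Fact comp_homD x y : g (f (x + y)) = g (f x) + g (f y).
Proof. by rewrite !starhomD. Qed.
Fact comp_homZ (k : R[i]) x : g (f (k *: x)) = k *: g (f x).
Proof. by rewrite !starhomZ. Qed.
Fact comp_homM x y : g (f (x ** y)) = g (f x) ** g (f y).
Proof. by rewrite !starhomM. Qed.
Fact comp_hom_star x : g (f (star x)) = star (g (f x)).
Proof. by rewrite !starhom_star. Qed.

Definition comp_hom : starhom A C :=
  StarHom comp_homD comp_homZ comp_homM comp_hom_star.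

End Composition.

Section Corestriction.
Variables (R : realType) (A : starAlgType R) (B : cstarAlgType R).
Variables (S : csubalg B) (f : starhom A B).
Hypothesis fS : forall a, csub_set S (f a).

Definition cores_fun a : csub S := CSub (fS a).

Fact cores_funD x y : cores_fun (x + y) = cores_fun x + cores_fun y.
Proof. by apply: csval_inj; rewrite /= starhomD. Qed.
Fact cores_funZ (k : R[i]) x : cores_fun (k *: x) = k *: cores_fun x.
Proof. by apply: csval_inj; rewrite /= starhomZ. Qed.
Fact cores_funM x y : cores_fun (x ** y) = cores_fun x ** cores_fun y.
Proof. by apply: csval_inj; rewrite /= starhomM. Qed.
Fact cores_fun_star x : cores_fun (star x) = star (cores_fun x).
Proof. by apply: csval_inj; rewrite /= starhom_star. Qed.

Definition cores_hom : starhom A (csub S) :=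
  StarHom cores_funD cores_funZ cores_funM cores_fun_star.

End Corestriction.

Section Morphisms.
Variable R : realType.

Section OfHom.
Variables (A B : cstarAlgType R).

Definition emb (b : B) : multiplier B :=
  @Multiplier R B (smul b) (fun a => a ** b) (fun x y => smulA x b y).

Variables (f : starhom A B) (a : A) (b : B).
Hypotheses (hb : is_unit b) (fab : f a = b).

Fact emb_homD x y : emb (f (x + y)) = emb (f x) + emb (f y).
Proof. by apply: mult_ext => z /=; rewrite starhomD ?smulDl ?smulDr. Qed.

Fact emb_homZ (k : R[i]) x : emb (f (k *: x)) = k *: emb (f x).
Proof. by apply: mult_ext => z /=; rewrite starhomZ ?smulZl ?smulZr. Qed.

Fact emb_homM x y : emb (f (x ** y)) = emb (f x) ** emb (f y).
Proof. by apply: mult_ext => z /=; rewrite starhomM smulA. Qed.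

Fact emb_hom_star x : emb (f (star x)) = star (emb (f x)).
Proof. by apply: mult_ext => z /=; rewrite starhom_star starM starK. Qed.

Definition emb_hom := StarHom emb_homD emb_homZ emb_homM emb_hom_star.

Fact emb_hom_nondegenerate :
  dense (lin_span [set x | exists a b, x = lmult (emb_hom a) b]).
Proof.
apply: dense_full => v; exists 1%N, (fun=> 1), (fun=> v); split.
  by move=> _; exists a, v; rewrite /= fab; case: (hb v).
by rewrite big_ord1 scale1r.
Qed.

Definition mor_of_hom : Mor A B := MkMor emb_hom_nondegenerate.

End OfHom.

Section ToHom.
Variables (A B : cstarAlgType R) (L : Mor A B) (b : B) (hb : is_unit b).

Let unitl x : b ** x = x. Proof. by case: (hb x). Qed.
Let unitr x : x ** b = x. Proof. by case: (hb x). Qed.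

Let lmult_mul m x y : lmult m (x ** y) = lmult m x ** y :> B.
Proof. by apply: smul_injl => z; rewrite multP !smulA multP. Qed.

Let lmultE m x : lmult m x = lmult m b ** x :> B.
Proof. by rewrite -lmult_mul unitl. Qed.

Let rmultb m : rmult m b = lmult m b :> B.
Proof. by have := multP m b b; rewrite unitl unitr. Qed.

(** For unital [B] the multiplier algebra is [B] itself, by evaluation of multipliers at the
    unit. *)
Definition mor_val x := lmult (L x) b.

Fact mor_valD x y : mor_val (x + y) = mor_val x + mor_val y.
Proof. by rewrite /mor_val starhomD. Qed.
Fact mor_valZ (k : R[i]) x : mor_val (k *: x) = k *: mor_val x.
Proof. by rewrite /mor_val starhomZ. Qed.
Fact mor_valM x y : mor_val (x ** y) = mor_val x ** mor_val y.
Proof. by rewrite /mor_val starhomM /= lmultE. Qed.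
Fact mor_val_star x : mor_val (star x) = star (mor_val x).
Proof. by rewrite /mor_val starhom_star /= (star_uniq_unit hb) rmultb. Qed.

Definition hom_of_mor : starhom A B :=
  StarHom mor_valD mor_valZ mor_valM mor_val_star.

Lemma lmult_morE x y : lmult (L x) y = hom_of_mor x ** y.
Proof. exact: lmultE. Qed.

(** The image [q] of the unit fixes the vectors [L(z) w], whose span is dense: non-degeneracy
    amounts to unitality. *)
Lemma hom_of_mor_unit a : is_unit a -> hom_of_mor a = b.
Proof.
move=> ha; set q := hom_of_mor a.
suff qx x : q ** x = x by rewrite -[LHS]unitr qx.
apply: subr0_eq; apply: nrm_small => d d0.
have q1 : 0 < nrm q + 1 by rewrite ltr_wpDl ?nrm_ge0.
have [s [n [k [v [hv ->]]]] hs] := (dense_nrm _).1 (@mor_nondegenerate _ _ _ L) x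
  _ (divr_gt0 d0 q1).
set s' := \sum_i _ in hs.
have qs : q ** s' = s'.
  rewrite muls_sumr; apply: eq_bigr => i _; rewrite smulZr; congr (_ *: _).
  have [z [w ->]] := hv i; rewrite (lmult_morE) smulA -starhomM.
  by case: (ha z) => ->.
have -> : q ** x - x = q ** (x - s') - (x - s').
  by rewrite mulsBr qs opprB addrA subrK.
rewrite (le_trans (nrmD _ _)) // nrmN -[leRHS](divfK (lt0r_neq0 q1)).
have n1 := le_trans (nrmM q (x - s')) (ler_wpM2l (nrm_ge0 q) hs).
by rewrite mulrDr mulr1 lerD // mulrC.
Qed.

End ToHom.

End Morphisms.

Section UniversalProperty.
Variables (R : realType) (P O M : cstarAlgType R) (U : mxunits P).
Variables (T : cstar_tensor P M) (Phi : starhom O T).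
Variables (o1 : O) (ho : is_unit o1) (u : M) (hu : is_unit u).
Hypothesis M_maps : is_quantum_space_of_maps Phi.
Local Notation r := (mu_r U).
Local Notation e := (@mu_e _ _ U).
Local Notation eP := (\sum_i e i i).

Definition Phi_coef : starhom O (fmat 'I_r M) :=
  comp_hom (tcoef_hom U hu T) Phi.

Lemma Phi_unit : is_unit (Phi o1).
Proof. by case: M_maps => _ _ + _; apply. Qed.

(** The universal property in coordinates: [L] carries the entries of [Phi] to those of [psi]. The
    formula for [id (x) L] is recovered by evaluating the multipliers at the unit of [TX]. *)
Lemma universal_ex (X : cstarAlgType R) (v : X) (hv : is_unit v)
    (TX : cstar_tensor P X) (psi : starhom O TX) : is_unit (psi o1) ->
  exists2 L : starhom M X, L u = v &
    forall o q, L (Phi_coef o q) = tcoef U hv (psi o) q.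
Proof.
move=> psi1; case: M_maps => _ _ _.
move=> /(_ X TX (min_tensor U TX hv) (mor_of_hom psi1 (erefl (psi o1)))).
move=> [L [[idL hL hPsi] _]].
have hTX := tens_unit U hv (T := TX).
exists (hom_of_mor L hv); first exact: hom_of_mor_unit.
have tE p m : hom_of_mor idL hTX (tens T p m) = tens TX p (hom_of_mor L hv m).
  have [_ <-] := hTX (hom_of_mor idL hTX (tens T p m)).
  rewrite -(lmult_morE idL hTX); have [-> _] := hL p eP m v.
  by rewrite (lmult_morE L hv); case: (mu_unit U p) => _ ->;
    case: (hv (hom_of_mor L hv m)) => _ ->.
have psiE o : psi o = hom_of_mor idL hTX (Phi o).
  have [_ <-] := hTX (hom_of_mor idL hTX (Phi o)).
  rewrite -(lmult_morE idL hTX) -hPsi /=.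
  by case: (hTX (psi o)) => _ ->.
move=> o q; rewrite psiE -{1}(tcoefK U hu (Phi o)).
suff -> : hom_of_mor idL hTX (tmat T (tcoef U hu (Phi o)))
    = tmat TX (fmat_map (hom_of_mor L hv) (tcoef U hu (Phi o))).
  by rewrite tmatK ?ffunE //; apply: fmat_map_block; apply: tcoef_block.
rewrite starhom_sum; apply: eq_bigr => i _; rewrite starhom_sum.
by apply: eq_bigr => j _; rewrite tE ffunE.
Qed.

(** Such an [L] factors [Phi] through itself, and so does the identity. *)
Lemma universal_uniq (L : starhom M M) : L u = u ->
  (forall o q, L (Phi_coef o q) = Phi_coef o q) -> forall m, L m = m.
Proof.
move=> Lu LPhi; have hT := tens_unit U hu (T := T).
case: M_maps => _ minT _.
move=> /(_ M T minT (mor_of_hom Phi_unit (erefl (Phi o1)))).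
move=> [L0 [_ L0uniq]].
have key (K : starhom M M) (Ku : K u = u) :
    (forall o q, K (Phi_coef o q) = Phi_coef o q) -> L0 = mor_of_hom hu Ku.
  move=> KPhi; apply: L0uniq.
  have K1 : tens_map U hu T T K (tens T eP u) = tens T eP u.
    by rewrite tens_map_tens Ku.
  exists (mor_of_hom hT K1).
    move=> p q m x; split.
      rewrite -[LHS]/(tens_map U hu T T K (tens T p m) ** tens T q x).
      by rewrite tens_map_tens tensM.
    rewrite -[LHS]/(tens T q x ** tens_map U hu T T K (tens T p m)).
    by rewrite tens_map_tens tensM.
  move=> o; apply: mult_ext => z /=.
    congr (_ ** _); rewrite /tens_map_fun -[LHS](tcoefK U hu); congr tmat.
    by apply/ffunP => q; rewrite ffunE -[tcoef U hu (Phi o) q]/(Phi_coef o q) KPhi.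
  congr (_ ** _); rewrite /tens_map_fun -[LHS](tcoefK U hu); congr tmat.
  by apply/ffunP => q; rewrite ffunE -[tcoef U hu (Phi o) q]/(Phi_coef o q) KPhi.
pose id_hom := @StarHom R M M id (fun _ _ => erefl) (fun _ _ => erefl)
  (fun _ _ => erefl) (fun _ => erefl).
have L0id := key id_hom erefl (fun _ _ => erefl).
have := key L Lu LPhi; rewrite L0id => /(congr1 (fun K : Mor M M => K)) h m.
have := congr1 (fun K : Mor M M => lmult (K m) u) h; rewrite /=.
by have [_ ->] := hu m; have [_ ->] := hu (L m).
Qed.

(** [Phi] takes values in [P (x) G], so it induces a homomorphism from [M] to [G]. Followed by the
    inclusion it fixes the entries of [Phi], hence is the identity, and [G] is all of [M]. *)
Lemma generated (G : csubalg M) : csub_set G u ->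
  (forall o q, csub_set G (Phi_coef o q)) -> forall m, csub_set G m.
Proof.
move=> Gu GPhi m.
have PhiG o : csub_set (coef_csub U hu T G) (Phi o) by exact: GPhi.
pose psi : starhom O (sub_tensor U hu T G) := cores_hom PhiG.
have psi1 : is_unit (psi o1).
  move=> t; split; apply: csval_inj; rewrite /=.
    by case: (Phi_unit (csval t)).
  by case: (Phi_unit (csval t)).
pose v := CSub Gu.
have hv : is_unit v by move=> g; split; apply: csval_inj; case: (hu (csval g)).
have [L Lu hL] := universal_ex hv psi1.
pose K := comp_hom (csub_incl G) L.
have <- : K m = m.
  apply: universal_uniq => [|o q]; first by rewrite /= Lu.
  rewrite /= hL.
  pose Y : fmat 'I_r M := [ffun q => csval (tcoef U hv (psi o) q)].
  have -> : csval (tcoef U hv (psi o) q) = Y q by rewrite ffunE.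
  suff -> : Y = tcoef U hu (Phi o) by [].
  apply: (@tmat_inj _ _ _ _ _ hu T); last 1 first.
  - rewrite tcoefK -[RHS]/(csval (psi o)) -(tcoefK U hv (psi o)) csval_sum.
    apply: eq_bigr => i _; rewrite csval_sum; apply: eq_bigr => j _.
    by rewrite ffunE.
  - by move=> i j ij; rewrite ffunE tcoef_block.
  - exact: tcoef_block.
exact: csvalP.
Qed.

End UniversalProperty.

(** * Approximation by finite-dimensional representations *)

Lemma mv_unit (R : realType) (J : finType) (a : fmat J (scal R)) v :
  is_unit a -> mv a v = v.
Proof.
move=> ha.
rewrite (@unit_uniq _ _ _ _ ha (fmat1_unit (I := J) (@scal_unit R))).
apply/funext => x; rewrite /mv (bigD1 x) //= ffunE eqxx big1 ?addr0 => [|y yx].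
  by rewrite mul1r.
by rewrite ffunE /= eq_sym (negPf yx) mul0r.
Qed.

Lemma unit_of_mv (R : realType) (J : finType) (a : fmat J (scal R)) :
  (forall v, mv a v = v) -> is_unit a.
Proof. by move=> h b; split; apply: mv_inj => v; rewrite mvM h. Qed.

Section DirectSums.
Variables (R : realType) (O : starAlgType R).

Section Sum.
Variables (J1 J2 : finType) (s1 : starhom O (fmat J1 (scal R)))
  (s2 : starhom O (fmat J2 (scal R))).

Definition dsum_fun (o : O) : fmat (J1 + J2)%type (scal R) := [ffun p =>
  match p.1, p.2 with
  | inl x, inl y => s1 o (x, y)
  | inr x, inr y => s2 o (x, y)
  | _, _ => 0
  end].

Fact dsum_funD a b : dsum_fun (a + b) = dsum_fun a + dsum_fun b.
Proof.
by apply/ffunP => -[[x|x] [y|y]]; rewrite !ffunE /= ?starhomD ?fmatD ?addr0.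
Qed.

Fact dsum_funZ (k : R[i]) a : dsum_fun (k *: a) = k *: dsum_fun a.
Proof.
by apply/ffunP => -[[x|x] [y|y]]; rewrite !ffunE /= ?starhomZ ?fmatZ ?scaler0.
Qed.

Fact dsum_funM a b : dsum_fun (a ** b) = dsum_fun a ** dsum_fun b.
Proof.
apply/ffunP => -[[x|x] [y|y]]; rewrite fmatM big_sumType /= !ffunE /=.
- rewrite starhomM fmatM [X in _ = _ + X]big1 ?addr0 => [|z _].
    by apply: eq_bigr => z _; rewrite !ffunE.
  by rewrite !ffunE /= mulr0s.
- by rewrite !big1 ?addr0 // => z _; rewrite !ffunE /= ?mulr0s ?muls0.
- by rewrite !big1 ?addr0 // => z _; rewrite !ffunE /= ?mulr0s ?muls0.
- rewrite starhomM fmatM [X in _ = X + _]big1 ?add0r => [|z _].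
    by apply: eq_bigr => z _; rewrite !ffunE.
  by rewrite !ffunE /= mulr0s.
Qed.

Fact dsum_fun_star a : dsum_fun (star a) = star (dsum_fun a).
Proof.
by apply/ffunP => -[[x|x] [y|y]]; rewrite fmat_starE !ffunE /= ?starhom_star
  ?fmat_starE ?star0.
Qed.

Definition dsum := StarHom dsum_funD dsum_funZ dsum_funM dsum_fun_star.

Definition vsum (v1 : J1 -> R[i]) (v2 : J2 -> R[i]) : J1 + J2 -> R[i] :=
  fun p => match p with inl x => v1 x | inr x => v2 x end.

Lemma ip_dsum o v1 v2 w1 w2 : ip (mv (dsum o) (vsum v1 v2)) (vsum w1 w2)
  = ip (mv (s1 o) v1) w1 + ip (mv (s2 o) v2) w2.
Proof.
rewrite /ip big_sumType /=; congr (_ + _); apply: eq_bigr => x _;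
  congr (_ * _); rewrite /mv big_sumType /=.
- rewrite [X in _ + X]big1 ?addr0 => [|y _]; last by rewrite ffunE /= mul0r.
  by apply: eq_bigr => y _; rewrite ffunE.
- rewrite [X in X + _]big1 ?add0r => [|y _]; last by rewrite ffunE /= mul0r.
  by apply: eq_bigr => y _; rewrite ffunE.
Qed.

End Sum.

Section Diagonal.
Variables (L J : finType) (s : starhom O (fmat J (scal R))).

Definition diag_fun (o : O) : fmat (L * J)%type (scal R) :=
  [ffun p => if p.1.1 == p.2.1 then s o (p.1.2, p.2.2) else 0].

Fact diag_funD a b : diag_fun (a + b) = diag_fun a + diag_fun b.
Proof.
by apply/ffunP => p; rewrite !ffunE starhomD fmatD; case: ifP; rewrite ?addr0.
Qed.

Fact diag_funZ (k : R[i]) a : diag_fun (k *: a) = k *: diag_fun a.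
Proof.
by apply/ffunP => p; rewrite !ffunE starhomZ fmatZ; case: ifP; rewrite ?scaler0.
Qed.

Fact diag_funM a b : diag_fun (a ** b) = diag_fun a ** diag_fun b.
Proof.
apply/ffunP => -[[i x] [j y]]; rewrite fmatM ffunE /=.
transitivity (\sum_k \sum_z diag_fun a ((i, x), (k, z)) **
  diag_fun b ((k, z), (j, y))); last first.
  by rewrite pair_bigA; apply: eq_bigr => -[].
rewrite (bigD1 i) //= [X in _ = _ + X]big1 ?addr0 => [|k ki]; last first.
  by rewrite big1 // => z _; rewrite ffunE /= eq_sym (negPf ki) mulr0s.
have [->|ij] := eqVneq i j.
  rewrite starhomM fmatM; apply: eq_bigr => z _.
  by rewrite !ffunE /= eqxx.
by rewrite big1 // => z _; rewrite !ffunE /= (negPf ij) muls0.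
Qed.

Fact diag_fun_star a : diag_fun (star a) = star (diag_fun a).
Proof.
apply/ffunP => -[[i x] [j y]]; rewrite fmat_starE !ffunE /= starhom_star.
by rewrite fmat_starE eq_sym; case: ifP => // _; rewrite star0.
Qed.

Definition diag := StarHom diag_funD diag_funZ diag_funM diag_fun_star.

Lemma slice_mv_diag o v i : slice (mv (diag o) v) i = mv (s o) (slice v i).
Proof.
apply/funext => x; rewrite /slice /mv.
transitivity (\sum_k \sum_z (diag o ((i, x), (k, z)) : R[i]) * v (k, z)).
  by rewrite pair_bigA; apply: eq_bigr => -[].
rewrite (bigD1 i) //= [X in _ + X]big1 ?addr0 => [|k ki].
  by apply: eq_bigr => z _; rewrite ffunE /= eqxx.
by rewrite big1 // => z _; rewrite ffunE /= eq_sym (negPf ki) mul0r.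
Qed.

Lemma diag_unit o : is_unit (s o) -> is_unit (diag o).
Proof.
move=> so; apply: unit_of_mv => v; apply/funext => -[i x].
by rewrite -[LHS]/(slice (mv (diag o) v) i x) slice_mv_diag mv_unit.
Qed.

End Diagonal.

End DirectSums.

Section Approximation.
Variables (R : realType) (O : cstarAlgType R) (o1 : O) (ho : is_unit o1).
Hypothesis sep : separated O.
(** [tau x a b] stands for [<x eta_a, eta_b>]; [tauP] is then complete positivity, which explains
    the exchanged indices [(b, a)]. *)
Variables (I : finType) (tau : O -> I -> I -> R[i]).
Hypotheses (tauD : forall x y a b, tau (x + y) a b = tau x a b + tau y a b)
  (tauZ : forall k x a b, tau (k *: x) a b = k * tau x a b)
  (tauC : forall x a b, tau (star x) a b = Num.conj (tau x b a))
  (tauP : forall Z : fmat I O,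
    0 <= \sum_a \sum_b tau ((star Z ** Z) (b, a)) a b).

Let tau0 a b : tau 0 a b = 0.
Proof. by rewrite -(scale0r 0) tauZ mul0r. Qed.

Let tau_sum (L : finType) (F : L -> O) a b :
  tau (\sum_l F l) a b = \sum_l tau (F l) a b.
Proof.
by apply: (big_morph (fun x => tau x a b)) => [x y|]; rewrite ?tauD ?tau0.
Qed.

(* Otherwise a linear functional separates the target from the cone of all
   values of finite-dimensional representations; read as an element of
   [fmat I O], its real part is positive in every such representation, hence
   positive, which contradicts the complete positivity of [tau]. *)
Lemma fd_approximation (L : finType) (o : L -> O) (d : R) : 0 < d ->
  exists (J : finType) (s : starhom O (fmat J (scal R))) (eta : I -> J -> R[i]),
  forall l a b, nrm (ip (mv (s (o l)) (eta a)) (eta b) - tau (o l) a b) <= d.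
Proof.
move=> d0.
pose W := (L * (I * I))%type -> R[i].
pose val (J : finType) (s : starhom O (fmat J (scal R))) (eta : I -> J -> R[i]) : W :=
  fun p => ip (mv (s (o p.1)) (eta p.2.1)) (eta p.2.2).
pose S : set W := [set w | exists (J : finType) s eta, w = @val J s eta].
pose N (w : W) : R := \sum_p nrm (w p).
pose w0 : W := fun p => tau (o p.1) p.2.1 p.2.2.
apply: contrapT => hno.
have far w : S w -> d <= N (w0 - w).
  move=> [J [s [eta ->]]]; rewrite leNgt; apply/negP => lt; apply: hno.
  exists J, s, eta => l a b; apply: le_trans (ltW lt).
  rewrite /N (bigD1 (l, (a, b))) //= nrmB lerDl.
  by apply: sumr_ge0 => p _; apply: nrm_ge0.
have N0 w : 0 <= N w by apply: sumr_ge0 => p _; apply: nrm_ge0.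
have NE : sublinear N.
  split=> [v w|t v t0]; rewrite /N; first rewrite -big_split /=.
    by apply: ler_sum => p _; apply: nrmD.
  rewrite mulr_sumr; apply: ler_sum => p _.
  by rewrite -[(_ *: v) p]/(t%:C * v p) nrmM_C nrm_realC ger0_norm.
have S0 : S 0.
  exists 'I_0, (zero_hom _ _), (fun=> 0); apply/funext => p.
  by rewrite /val /= mv0 ip_0l.
(* Direct sums of representations add the values and rescaling [eta] by a square root multiplies
   them, so [S] is a convex cone. *)
have SD v w : S v -> S w -> S (v + w).
  move=> [J [s [eta ->]]] [J' [s' [eta' ->]]].
  exists (J + J')%type, (dsum s s'), (fun a => vsum (eta a) (eta' a)).
  by apply/funext => p; rewrite /val ip_dsum.
have SZ (t : R) v : 0 < t -> S v -> S (t%:C *: v).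
  move=> t0 [J [s [eta ->]]]; exists J, s, (fun a => (Num.sqrt t)%:C *: eta a).
  apply/funext => p; rewrite /val mvZ ipZ ip_Zr.
  rewrite conj_realC mulrA -rmorphM -expr2 sqr_sqrtr ?(ltW t0) //.
have [f [lf fN fS fw0]] := cone_separation NE N0 S0 SD SZ d0 far.
pose c p := complexify f (fun q => (q == p)%:R : R[i]).
have fE w : complexify f w = \sum_p w p * c p.
  have wE : w = \sum_p w p *: (fun q => (q == p)%:R : R[i]).
    apply/funext => q; rewrite fct_sumE (bigD1 q) //= big1 ?addr0 => [|p pq].
      by rewrite -[RHS]/(_ * _) eqxx mulr1.
    by rewrite -[LHS]/(w p * _) eq_sym (negPf pq) mulr0.
  have sumE (s : seq (L * (I * I))%type) (F : (L * (I * I))%type -> W) :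
      complexify f (\sum_(p <- s) F p) = \sum_(p <- s) complexify f (F p).
    apply: (big_morph _ (complexifyD lf)).
    by rewrite -(scale0r (0 : W)) complexifyZ // mul0r.
  by rewrite [in LHS]wE sumE; apply: eq_bigr => p _; rewrite complexifyZ.
(* The sign turns nonpositivity of [f] on [S] into positivity. Adding [star Y] passes to twice the
   real part, the only part that [f] controls. *)
pose Y : fmat I O := [ffun q => - \sum_l c (l, (q.2, q.1)) *: o l].
pose Yt : rmat I ho sep := Y + star Y.
have pair (w : W) : \sum_a \sum_b - \sum_l c (l, (a, b)) * w (l, (a, b))
    = - complexify f w.
  have -> : complexify f w = \sum_l \sum_a \sum_b w (l, (a, b)) * c (l, (a, b)).
    rewrite fE; transitivity (\sum_l \sum_q w (l, q) * c (l, q)).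
      by rewrite pair_bigA; apply: eq_bigr => -[].
    by apply: eq_bigr => l _; rewrite pair_bigA; apply: eq_bigr => -[].
  rewrite [in RHS]exchange_big /= -sumrN; apply: eq_bigr => a _.
  rewrite exchange_big /= -sumrN; apply: eq_bigr => b _.
  by congr (- _); apply: eq_bigr => l _; rewrite mulrC.
have sYt : star Yt = Yt by rewrite starD starK addrC.
have posYt : Pos Yt.
  have rmat1 : @is_unit R (rmat I ho sep) (fmat1 I o1) := fmat1_unit ho.
  pose f_ (i : {n & starhom O (fmat 'I_n (scal R))}) :
    starhom (rmat I ho sep) (fmat (I * 'I_(tag i))%type (scal R)) := amp I (tagged i).
  apply: (Pos_detect rmat1 (f := f_)) => //.
    move=> a ha; apply/ffunP => -[i j]; rewrite fmat0; apply: sep => n s.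
    apply/ffunP => -[x y]; have := congr1 (fun m : fmat _ (scal R) =>
      m ((i, x), (j, y))) (ha (existT _ n s)).
    by rewrite ffunE !fmat0.
  move=> [n s] e z /=; apply: psd_detect => v.
  have hY : ip (mv (amp I s Y) v) v = - complexify f (val _ s (slice v)).
    rewrite -pair ip_slice [RHS]exchange_big /=. apply: eq_bigr => b _.
    rewrite slice_mv_amp ip_suml; apply: eq_bigr => a _.
    rewrite ffunE starhomN mvNl ip_Nl; congr (- _).
    rewrite starhom_sum; elim/big_rec2: _ => [|l y x _ <-].
      by rewrite mv0l ip_0l.
    by rewrite starhomZ mvDl ipD mvZl ipZ.
  suff : 0 <= ip (mv (amp I s (Y + star Y)) v) v by [].
  rewrite starhomD mvDl ipD.
  have -> : ip (mv (amp I s (star Y)) v) v = Num.conj (ip (mv (amp I s Y) v) v).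
    by rewrite -ipC starhom_star ip_mv starK.
  rewrite hY -[Num.conj _]/(conjc _) addcJ mulr_ge0 // ler0c.
  rewrite -[X in complex.Re X]add0r ReB sub0r Re_complexify oppr_ge0; apply: fS.
  by exists _, s, (slice v).
have [Z sZ YZ] := posYt.
have := tauP Z; rewrite sZ -YZ.
have hY : \sum_a \sum_b tau (Y (b, a)) a b = - complexify f w0.
  rewrite -pair; apply: eq_bigr => a _; apply: eq_bigr => b _.
  rewrite ffunE -scaleN1r tauZ mulN1r tau_sum; congr (- _).
  by apply: eq_bigr => l _; rewrite tauZ.
have -> : \sum_a \sum_b tau (Yt (b, a)) a b
    = - complexify f w0 + Num.conj (- complexify f w0).
  rewrite -hY rmorph_sum /=.
  under [X in _ = _ + X]eq_bigr do rewrite rmorph_sum /=.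
  rewrite [X in _ = _ + X]exchange_big -big_split; apply: eq_bigr => a _.
  rewrite -big_split; apply: eq_bigr => b _ /=.
  by rewrite fmatD tauD fmat_starE tauC.
rewrite -[Num.conj _]/(conjc _) addcJ => h.
have : 0 <= complex.Re (- complexify f w0).
  by rewrite -ler0c -(pmulr_rge0 _ (ltr0Sn R[i] 1)).
rewrite -[X in complex.Re X]add0r ReB sub0r Re_complexify.
by move: fw0; lra.
Qed.

End Approximation.

Section UnitalCompression.
Variables (R : realType) (O : starAlgType R) (o1 : O) (ho : is_unit o1).
Variables (J : finType) (s : starhom O (fmat J (scal R))).

Let p := s o1.
Let sp : star p = p. Proof. by rewrite -starhom_star (star_uniq_unit ho). Qed.
Let pp v : mv p (mv p v) = mv p v.
Proof. by rewrite -mvM -starhomM; case: (ho o1) => ->. Qed.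
Let ps o v : mv p (mv (s o) v) = mv (s o) v.
Proof. by rewrite -mvM -starhomM; case: (ho o) => ->. Qed.
Let sp' o v : mv (s o) (mv p v) = mv (s o) v.
Proof. by rewrite -mvM -starhomM; case: (ho o) => _ ->. Qed.

(* The compression to the range of the projection [s o1], in an orthonormal
   basis of that range. *)
Lemma unital_compression : exists n (t : starhom O (fmat 'I_n (scal R)))
    (c : (J -> R[i]) -> ('I_n -> R[i])),
  is_unit (t o1) /\
  forall o v w, ip (mv (t o) (c v)) (c w) = ip (mv (s o) v) w.
Proof.
pose B v w := ip (mv p v) w.
have BD u v w : B (u + v) w = B u w + B v w by rewrite /B mvD ipD.
have BZ k u v : B (k *: u) v = k * B u v by rewrite /B mvZ ipZ.
have BC u v : B u v = Num.conj (B v u) by rewrite /B ip_mv sp ipC.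
have BE u v : B u v = ip (mv p u) (mv p v) by rewrite /B -{1}pp ip_mv sp.
have B0 u : 0 <= B u u by rewrite BE ip_ge0.
(* This family is orthonormal for the degenerate form [<p v, w>]; its image under [p] is an
   orthonormal basis of the range of [p]. *)
have [n [f [of_ hf]]] := gram_schmidt BD BZ BC B0 [seq delta R j | j <- enum J].
pose g i := mv p (f i).
have og i j : ip (g i) (g j) = (i == j)%:R by rewrite -BE of_.
have pg i : mv p (g i) = g i by rewrite /g pp.
have pE v : mv p v = \sum_i ip v (g i) *: g i.
  have hd j : mv p (delta R j) = \sum_i ip (delta R j) (g i) *: g i.
    have := hf (delta R j) (map_f _ (mem_enum _ j)).
    set w := delta R j - _ => w0; have : mv p w = 0.
      apply: vn_eq0; apply/eqP; rewrite -sqrf_eq0; apply/eqP.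
      by apply: (@complexI R); rewrite -ip_vn -BE (sqnE B0) w0.
    rewrite /w -scaleN1r mvD mvZ scaleN1r => /eqP; rewrite subr_eq0 => /eqP ->.
    rewrite mv_sum; apply: eq_bigr => i _; rewrite mvZ /B.
    by rewrite ip_mv sp.
  have vE : v = \sum_j v j *: delta R j.
    apply/funext => i; rewrite fct_sumE (bigD1 i) //= big1 ?addr0 => [|j ji].
      by rewrite -[RHS]/(v i * delta R i i) /delta eqxx mulr1.
    by rewrite -[LHS]/(v j * delta R j i) /delta eq_sym (negPf ji) mulr0.
  rewrite {1}vE mv_sum; under eq_bigr do rewrite mvZ hd scaler_sumr.
  rewrite exchange_big; apply: eq_bigr => i _ /=.
  under eq_bigr do rewrite scalerA -ipZ; rewrite -scaler_suml; congr (_ *: _).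
  by rewrite -ip_suml -vE.
have sum_g (F : 'I_n -> R[i]) w : ip (\sum_i F i *: g i) w = \sum_i F i * ip (g i) w.
  by rewrite ip_suml; apply: eq_bigr => i _; rewrite ipZ.
pose t_fun (o : O) : fmat 'I_n (scal R) := [ffun q => ip (mv (s o) (g q.2)) (g q.1)].
have tD a b : t_fun (a + b) = t_fun a + t_fun b.
  by apply/ffunP => q; rewrite !ffunE starhomD mvDl ipD.
have tZ (k : R[i]) a : t_fun (k *: a) = k *: t_fun a.
  by apply/ffunP => q; rewrite !ffunE starhomZ mvZl ipZ.
have tM a b : t_fun (a ** b) = t_fun a ** t_fun b.
  apply/ffunP => -[i j]; rewrite fmatM ffunE /= starhomM mvM.
  rewrite -[mv (s b) _]ps pE mv_sum ip_suml.
  by apply: eq_bigr => k _; rewrite !ffunE mvZ ipZ mulrC.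
have tS a : t_fun (star a) = star (t_fun a).
  apply/ffunP => -[i j]; rewrite fmat_starE !ffunE /= starhom_star.
  by rewrite -[RHS]ipC ip_mv starK.
exists n, (StarHom tD tZ tM tS), (fun v i => ip v (g i)); split.
  apply: unit_of_mv => v; apply/funext => i; rewrite /mv (bigD1 i) //= ffunE /=.
  rewrite pg og eqxx mul1r big1 ?addr0 // => j ji.
  by rewrite ffunE /= pg og (negPf ji) mul0r.
move=> o v w.
rewrite -[mv (s o) v]sp' pE mv_sum ip_suml.
rewrite /ip /mv; under eq_bigr do rewrite mulr_suml.
rewrite exchange_big; apply: eq_bigr => j _ /=.
rewrite -[RHS]/(ip (mv (s o) (ip v (g j) *: g j)) w) mvZ ipZ.
rewrite -[mv (s o) (g j)]ps pE sum_g mulr_sumr; apply: eq_bigr => i _.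
rewrite ffunE /= -mulrA mulrCA; congr (_ * (_ * _)).
by rewrite -ipC.
Qed.

End UnitalCompression.

Section ExactGram.
Variables (R : realType) (O : cstarAlgType R) (o1 : O) (ho : is_unit o1).
Hypothesis sep : separated O.
Variables (I : finType) (tau : O -> I -> I -> R[i]).
Hypotheses (tauD : forall x y a b, tau (x + y) a b = tau x a b + tau y a b)
  (tauZ : forall k x a b, tau (k *: x) a b = k * tau x a b)
  (tauC : forall x a b, tau (star x) a b = Num.conj (tau x b a))
  (tauP : forall Z : fmat I O,
    0 <= \sum_a \sum_b tau ((star Z ** Z) (b, a)) a b)
  (tau1 : forall a b, tau o1 a b = (a == b)%:R).

Lemma scal_separated : separated (scal R).
Proof.
pose k (x : scal R) : fmat 'I_1 (scal R) := [ffun=> x].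
have cD x y : k (x + y) = k x + k y by apply/ffunP => q; rewrite !ffunE.
have cZ (l : R[i]) x : k (l *: x) = l *: k x by apply/ffunP => q; rewrite !ffunE.
have cM x y : k (x ** y) = k x ** k y.
  by apply/ffunP => -[i j]; rewrite fmatM big_ord1 !ffunE.
have cS x : k (star x) = star (k x).
  by apply/ffunP => -[i j]; rewrite fmat_starE !ffunE.
move=> x /(_ 1%N (StarHom cD cZ cM cS)) /= /ffunP /(_ (ord0, ord0)).
by rewrite !ffunE.
Qed.

(** Matrices over the scalars are a C*-algebra, and [Pos_detect] with the identity as its only
    homomorphism converts positivity of the quadratic form into being a square. *)
Lemma psd_square (K : fmat I (scal R)) : star K = K -> psd K ->
  exists2 Q : fmat I (scal R), star Q = Q & K = Q ** Q.
Proof.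
move=> sK pK; pose A := rmat I (@scal_unit R) scal_separated.
have A1 : @is_unit R A (fmat1 I (1 : scal R)) := fmat1_unit (@scal_unit R).
pose idA : starhom A (fmat I (scal R)) :=
  @StarHom R A (fmat I (scal R)) id (fun _ _ => erefl) (fun _ _ => erefl)
    (fun _ _ => erefl) (fun _ => erefl).
have [||Q sQ KQ] := @Pos_detect R A _ A1 unit (fun=> fmat I (scal R)) (fun=> idA) K sK.
- by move=> a /(_ tt).
- by move=> _ d z /=; apply: psd_detect.
by exists Q.
Qed.

(* The Gram matrix of an approximation of [(1 - t) tau] is slightly smaller
   than the identity; the defect is the Gram matrix of vectors living in
   further copies of the representation. *)
Lemma exact_approximation (L : finType) (o : L -> O) (d : R) : 0 < d ->
  exists (J : finType) (s : starhom O (fmat J (scal R))) (eta : I -> J -> R[i]),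
  [/\ is_unit (s o1), forall a b, ip (eta a) (eta b) = (a == b)%:R &
  forall l a b, nrm (ip (mv (s (o l)) (eta a)) (eta b) - tau (o l) a b) <= d].
Proof.
move=> d0.
pose C : R := \sum_l (nrm (o l) + \sum_a \sum_b nrm (tau (o l) a b)).
have Ct l a b : nrm (o l) + nrm (tau (o l) a b) <= C.
  have nn l' : 0 <= nrm (o l') + \sum_a \sum_b nrm (tau (o l') a b).
    rewrite addr_ge0 ?nrm_ge0 //; apply: sumr_ge0 => a' _.
    by apply: sumr_ge0 => b' _; apply: nrm_ge0.
  rewrite /C (bigD1 l) //= -[leLHS]addr0 lerD ?sumr_ge0 // lerD2l.
  rewrite (bigD1 a) //= (bigD1 b) //= -addrA lerDl addr_ge0 //.
    by apply: sumr_ge0 => b' _; apply: nrm_ge0.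
  by apply: sumr_ge0 => a' _; apply: sumr_ge0 => b' _; apply: nrm_ge0.
have C0 : 0 <= C.
  apply: sumr_ge0 => l _; rewrite addr_ge0 ?nrm_ge0 //; apply: sumr_ge0 => a' _.
  by apply: sumr_ge0 => b' _; apply: nrm_ge0.
(* Three errors add up: at most [t] from the approximation, [t |tau|] from scaling [tau] by [1 - t],
   and [2 t |o|] from the correction. [4 t <= 1] keeps [1 - t] nonnegative and later excludes a zero
   representation space. *)
have [t [t0 t4 td]] : exists t : R, [/\ 0 < t, 4 * t <= 1 & t * (1 + 3 * C) <= d].
  have D0 : 0 < 4 * d + 1 + 3 * C by lra.
  exists (d / (4 * d + 1 + 3 * C)); split; first by rewrite divr_gt0.
    by rewrite mulrA ler_pdivrMr // mul1r; lra.
  by rewrite mulrAC ler_pdivrMr // ler_pM2l //; lra.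
(* An error of [t / m] in each entry changes the quadratic form by at most [t |v|^2], so the defect
   [K], which is close to [t] times the identity, stays positive. *)
pose m : R := #|I|%:R * #|I|%:R + 1.
have m1 : 1 <= m by rewrite lerDr mulr_ge0.
have m0 : 0 < m by apply: lt_le_trans m1.
pose t' := t / m.
have t'0 : 0 < t' by rewrite divr_gt0.
have t't : t' <= t by rewrite ler_pdivrMr // ler_peMr // ltW.
pose tau' x a b := (1 - t)%:C * tau x a b.
have t'1 : 0 <= 1 - t by lra.
(* The index [None] adds the unit to the list, so that the Gram matrix is approximated as well. *)
have [||||J0 [s0 [eta0 h0]]] := @fd_approximation R O o1 ho sep I tau' _ _ _ _
    (option L) (fun l => if l is Some l then o l else o1) t' t'0.
- by move=> x y a b; rewrite /tau' tauD mulrDr.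
- by move=> k x a b; rewrite /tau' tauZ mulrCA.
- by move=> x a b; rewrite /tau' tauC rmorphM /= conj_realC.
- move=> Z; have -> : \sum_a \sum_b tau' ((star Z ** Z) (b, a)) a b
      = (1 - t)%:C * \sum_a \sum_b tau ((star Z ** Z) (b, a)) a b.
    by rewrite mulr_sumr; apply: eq_bigr => a _; rewrite mulr_sumr.
  by rewrite mulr_ge0 // ler0c.
have [n [s1 [c [s1u hc]]]] := unital_compression ho s0.
pose eta1 a := c (eta0 a).
have h1 l a b : nrm (ip (mv (s1 (o l)) (eta1 a)) (eta1 b) - tau' (o l) a b) <= t'.
  by rewrite hc; exact: (h0 (Some l)).
pose K : fmat I (scal R) := [ffun q => (q.1 == q.2)%:R - ip (eta1 q.2) (eta1 q.1)].
have KE a b : nrm ((K (b, a) : R[i]) - t%:C * (a == b)%:R) <= t'.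
  have := h0 None a b; rewrite /tau' tau1 -hc mv_unit // => h.
  rewrite ffunE /= [b == a]eq_sym -nrmN; apply: le_trans h.
  rewrite le_eqVlt; apply/orP; left; apply/eqP; congr nrm.
  by rewrite rmorphB rmorph1 -/(eta1 a) -/(eta1 b); ring.
have sK : star K = K.
  apply/ffunP => -[a b]; rewrite fmat_starE !ffunE /= -[star _]/(Num.conj _).
  by rewrite rmorphB /= -ipC conjC_nat eq_sym.
have pK : psd K.
  move=> v; set z := ip (mv K v) v.
  have zr : z = (complex.Re z)%:C.
    by rewrite RRe_real // CrealE /z -ipC ip_mv sK.
  have hv a : nrm (v a) <= vn v.
    rewrite -[v a]ip_delta (le_trans (ip_cs _ _)) //.
    by rewrite -/(vn _) -/(vn _) vn_delta mulr1.
  have ze : z - (t * vn v ^+ 2)%:C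
      = \sum_b \sum_a ((K (b, a) : R[i]) - t%:C * (a == b)%:R) * v a * Num.conj (v b).
    rewrite rmorphM /= -ip_vn /z /ip mulr_sumr -sumrB; apply: eq_bigr => b _.
    rewrite -mulr_suml mulrA -mulrBl; congr (_ * _).
    under [RHS]eq_bigr do rewrite mulrBl.
    rewrite sumrB; congr (_ - _); rewrite (bigD1 b) //= eqxx mulr1 big1 ?addr0 //.
    by move=> a /negPf ->; rewrite mulr0 mul0r.
  have zn : nrm (z - (t * vn v ^+ 2)%:C) <= t * vn v ^+ 2.
    have bnd : nrm (z - (t * vn v ^+ 2)%:C)
        <= \sum_(b : I) \sum_(a : I) t' * vn v * vn v.
      rewrite ze; elim/big_ind2: _ => [|x x' y y' hx hy|b _]; first by rewrite nrm0.
        by rewrite (le_trans (nrmD _ _)) // lerD.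
      elim/big_ind2: _ => [|x x' y y' hx hy|a _]; first by rewrite nrm0.
        by rewrite (le_trans (nrmD _ _)) // lerD.
      rewrite !nrmM_C ler_pM ?mulr_ge0 ?nrm_ge0 //; first by rewrite ler_pM ?nrm_ge0.
      by rewrite /nrm norm_conjC; exact: hv.
    apply: le_trans bnd _; rewrite !sumr_const -mulrnA -[leLHS]mulr_natl natrM.
    have -> : #|I|%:R * #|I|%:R * (t' * vn v * vn v)
        = t' * (#|I|%:R * #|I|%:R) * vn v ^+ 2 by ring.
    rewrite ler_wpM2r ?sqr_ge0 // /t' mulrAC ler_pdivrMr // ler_pM2l //.
    by rewrite lerDl.
  rewrite zr ler0c.
  have := le_trans (nrm_Re _) zn; rewrite ReB /= ler_norml => /andP[+ _]; lra.
have [Q sQ KQ] := psd_square sK pK.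
have [a0 _|noI] := pickP I; last first.
  by exists 'I_n, s1, eta1; split=> [//|a|l a]; have := noI a.
have [e0] : exists e0 : 'I_n, True.
  case: (posnP n) => [n0|n0]; last by exists (Ordinal n0).
  have := KE a0 a0; rewrite ffunE /= eqxx /ip big1 => [|i _]; last first.
    by have := ltn_ord i; rewrite {2}n0.
  rewrite subr0 mulr1.
  rewrite -(rmorph1 (real_complex R)) -rmorphB nrm_realC ger0_norm; last lra.
  by move: t't t4; lra.
move=> _.
pose s := diag ('I_1 + I)%type s1.
(* The first copy keeps the original vector. In copy [b] the coordinate [Q (b, a)] is put on the
   basis vector [e0]; as [Q Q = K], these coordinates contribute exactly [K] to the Gram matrix. *)
pose eta a : ('I_1 + I) * 'I_n -> R[i] := fun p =>
  match p.1 with inl _ => eta1 a p.2 | inr b => (Q (b, a) : R[i]) * delta R e0 p.2 end.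
have slice_l a i : slice (eta a) (inl i) = eta1 a by [].
have slice_r a b : slice (eta a) (inr b) = (Q (b, a) : R[i]) *: delta R e0 by [].
have sumQ a b : \sum_x (Q (x, a) : R[i]) * Num.conj (Q (x, b) : R[i]) = K (b, a).
  rewrite KQ fmatM; apply: eq_bigr => x _; rewrite mulrC; congr (_ * _).
  by rewrite -{2}sQ fmat_starE.
have ipE (M : fmat 'I_n (scal R)) a b (f : ('I_1 + I) * 'I_n -> R[i]) :
    (forall i, slice f i = mv M (slice (eta a) i)) ->
    ip f (eta b) = ip (mv M (eta1 a)) (eta1 b) + K (b, a) * M (e0, e0).
  move=> hf; rewrite ip_slice big_sumType big_ord1 hf !slice_l /=; congr (_ + _).
  rewrite -sumQ mulr_suml; apply: eq_bigr => x _.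
  rewrite hf !slice_r mvZ ipZ ip_Zr mulrA.
  by rewrite ip_delta mv_delta.
exists (('I_1 + I) * 'I_n)%type, s, eta; split.
- exact: diag_unit.
- move=> a b; have s1o v : mv (s1 o1) v = v by exact: mv_unit.
  rewrite (ipE (s1 o1) a b) => [|i]; last by rewrite s1o.
  rewrite s1o -(mv_delta (s1 o1)) s1o /delta eqxx mulr1 ffunE /=.
  by rewrite addrC subrK eq_sym.
- move=> l a b; rewrite (ipE (s1 (o l)) a b) => [|i]; last exact: slice_mv_diag.
  set z := ip _ _; set w := (s1 (o l)) (e0, e0) : R[i].
  have -> : z + K (b, a) * w - tau (o l) a b
      = (z - tau' (o l) a b) + (- (t%:C * tau (o l) a b) + K (b, a) * w).
    by rewrite /tau' rmorphB rmorph1; ring.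
  have hw : nrm w <= nrm (o l).
    rewrite /w -mv_delta -[mv _ _ _]ip_delta.
    rewrite (le_trans (ip_cs _ _)) // -/(vn _) -/(vn _) vn_delta mulr1.
    by rewrite (le_trans (rep_contr _ _ _)) // vn_delta mulr1.
  have hK : nrm (K (b, a) : R[i]) <= 2 * t.
    rewrite -[X in nrm X](subrK (t%:C * (a == b)%:R)) (le_trans (nrmD _ _)) //.
    have : nrm (t%:C * (a == b)%:R : R[i]) <= t.
      rewrite -(rmorph_nat (real_complex R)) -rmorphM nrm_realC ger0_norm.
        by rewrite -[leRHS]mulr1 ler_pM2l // lern1 leq_b1.
      by rewrite mulr_ge0 // ltW.
    by have := KE a b; move: t't; lra.
  have htau : nrm (t%:C * tau (o l) a b) = t * nrm (tau (o l) a b).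
    by rewrite nrmM_C nrm_realC gtr0_norm.
  have hKw : nrm ((K (b, a) : R[i]) * w) <= 2 * t * nrm (o l).
    by rewrite nrmM_C ler_pM ?nrm_ge0.
  apply: le_trans (nrmD _ _) _; apply: le_trans td.
  have := h1 l a b; have := nrmD (- (t%:C * tau (o l) a b)) ((K (b, a) : R[i]) * w).
  rewrite nrmN htau; have := Ct l a b.
  have := nrm_ge0 (o l); have := nrm_ge0 (tau (o l) a b); rewrite -/z.
  move: t0 t't; clear -hKw; move=> *; nra.
Qed.

End ExactGram.

(** * Finite-dimensional models of the space of maps *)

Lemma tcoef_block_tensor (R : realType) (P : cstarAlgType R) (U : mxunits P)
    (X : cstarAlgType R) (u : X) (hu : is_unit u) (sep : separated X)
    (t : block_tensor U hu sep) : tcoef U hu t = csval t :> fmat _ X.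
Proof.
suff e : t = tmat (block_tensor U hu sep) (csval t : fmat _ X).
  by rewrite [in LHS]e tmatK //; exact: (csvalP t).
apply/csval_inj/ffunP => -[k l]; rewrite csval_sum sum_ffunE.
transitivity (\sum_i \sum_j (pcoef U (mu_e i j) (k, l) : R[i]) *: (csval t : fmat _ X) (i, j));
  last first.
  by apply: eq_bigr => i _; rewrite csval_sum sum_ffunE; apply: eq_bigr => j _;
    rewrite ffunE.
have h i j : (pcoef U (mu_e i j) (k, l) : R[i]) *: (csval t : fmat _ X) (i, j)
    = if (i == k) && (j == l) then (csval t : fmat _ X) (k, l) else 0.
  have [cij|cij] := eqVneq (mu_c i) (mu_c j).
    rewrite pcoef_e // xpair_eqE; case: (eqVneq i k) => [->|_]; last by rewrite scale0r.
    by case: (eqVneq j l) => [->|_]; rewrite ?scale1r ?scale0r.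
  have -> : (csval t : fmat _ X) (i, j) = 0 by exact: (csvalP t).
  rewrite scaler0; case: andP => // -[/eqP ik /eqP jl]; rewrite -ik -jl.
  by symmetry; exact: (csvalP t).
under eq_bigr do under eq_bigr do rewrite h.
rewrite (bigD1 k) //= [X in _ = _ + X]big1 ?addr0 => [|i ik]; last first.
  by rewrite big1 // => j _; rewrite (negPf ik).
by rewrite (bigD1 l) //= !eqxx big1 ?addr0 // => j jl; rewrite (negPf jl) andbF.
Qed.

Section Unflatten.
Variables (R : realType) (I F : finType).
Implicit Types (a b : fmat (I * F)%type (scal R)).

Definition unflat_fun a : fmat I (fmat F (scal R)) :=
  [ffun q => [ffun p => a ((q.1, p.1), (q.2, p.2))]].

Fact unflat_funD a b : unflat_fun (a + b) = unflat_fun a + unflat_fun b.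
Proof. by apply/ffunP => q; apply/ffunP => p; rewrite !ffunE. Qed.
Fact unflat_funZ (k : R[i]) a : unflat_fun (k *: a) = k *: unflat_fun a.
Proof. by apply/ffunP => q; apply/ffunP => p; rewrite !ffunE. Qed.
Fact unflat_funM a b : unflat_fun (a ** b) = unflat_fun a ** unflat_fun b.
Proof.
apply/ffunP => -[i j]; apply/ffunP => -[x y]; rewrite fmatM !ffunE sum_ffunE.
transitivity (\sum_k \sum_z a ((i, x), (k, z)) ** b ((k, z), (j, y))).
  by rewrite pair_bigA; apply: eq_bigr => -[].
by apply: eq_bigr => k _; rewrite fmatM; apply: eq_bigr => z _; rewrite !ffunE.
Qed.
Fact unflat_fun_star a : unflat_fun (star a) = star (unflat_fun a).
Proof.
by apply/ffunP => -[i j]; apply/ffunP => -[x y]; rewrite !fmat_starE !ffunE.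
Qed.

Definition unflat : starhom (fmat (I * F)%type (scal R)) (fmat I (fmat F (scal R))) :=
  StarHom unflat_funD unflat_funZ unflat_funM unflat_fun_star.

Lemma mv_unflat a i j w : mv (unflat a (i, j)) w = slice (mv a (unslice j w)) i.
Proof.
apply/funext => x; rewrite /slice /mv.
transitivity (\sum_k \sum_z (a ((i, x), (k, z)) : R[i]) * unslice j w (k, z));
  last by rewrite pair_bigA; apply: eq_bigr => -[].
rewrite (bigD1 j) //= [X in _ = _ + X]big1 ?addr0 => [|k kj].
  by apply: eq_bigr => z _; rewrite !ffunE /unslice /= eqxx.
by rewrite big1 // => z _; rewrite /unslice /= (negPf kj) mulr0.
Qed.

Lemma unflat_unit a : is_unit a -> is_unit (unflat a).
Proof.
move=> ha; rewrite (@unit_uniq _ _ _ _ ha (fmat1_unit (@scal_unit R))).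
suff -> : unflat (fmat1 (I * F)%type (1 : scal R)) = fmat1 I (fmat1 F (1 : scal R)).
  by apply: fmat1_unit; apply: fmat1_unit; exact: scal_unit.
apply/ffunP => -[i j]; apply/ffunP => -[x y]; rewrite !ffunE /= xpair_eqE.
by case: (i == j); rewrite /= ffunE.
Qed.

End Unflatten.

Lemma mvN (R : realType) (J : finType) (a : fmat J (scal R)) v :
  mv a (- v) = - mv a v.
Proof. by rewrite -scaleN1r mvZ scaleN1r. Qed.

Section Reflection.
Variables (R : realType) (H A : finType) (x y : A -> H -> R[i]).
Hypotheses (xx : orthonormal_family (@ip R H) x)
  (yy : orthonormal_family (@ip R H) y) (xy : forall a b, ip (x a) (y b) = 0).

(* The reflection in the span of the vectors [x a - y a] exchanges [x a] and
   [y a]. *)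
Definition reflection : fmat H (scal R) := [ffun q => (q.1 == q.2)%:R -
  \sum_a (x a - y a) q.1 * Num.conj ((x a - y a) q.2)].

(** The vectors [x a - y a] are pairwise orthogonal with squared norm 2, which absorbs the usual
    factor [2 / |w|^2] of a reflection. *)
Lemma mv_reflection v :
  mv reflection v = v - \sum_a ip v (x a - y a) *: (x a - y a).
Proof.
apply/funext => h; rewrite /mv.
have -> : (v - \sum_a ip v (x a - y a) *: (x a - y a)) h
    = v h - \sum_a ip v (x a - y a) * (x a - y a) h.
  by rewrite -[LHS]/(v h - (\sum_a _) h) fct_sumE.
under eq_bigr do rewrite ffunE /= mulrBl.
rewrite sumrB; congr (_ - _).
  rewrite (bigD1 h) //= eqxx mul1r big1 ?addr0 // => k kh.
  by rewrite eq_sym (negPf kh) mul0r.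
under eq_bigr do rewrite mulr_suml.
rewrite exchange_big; apply: eq_bigr => a _; rewrite /ip mulr_suml.
by apply: eq_bigr => k _; rewrite mulrC [RHS]mulrC mulrCA.
Qed.

Let yx a b : ip (y a) (x b) = 0. Proof. by rewrite ipC xy conjC0. Qed.

Lemma reflection_y a : mv reflection (y a) = x a.
Proof.
rewrite mv_reflection (bigD1 a) //= big1 ?addr0 => [|b ba].
  by rewrite ip_Dr ip_Nr yx yy eqxx mulr1n add0r scaleN1r opprK addrC subrK.
by rewrite ip_Dr ip_Nr yx yy eq_sym (negPf ba) subr0 scale0r.
Qed.

Lemma reflection_x a : mv reflection (x a) = y a.
Proof.
rewrite mv_reflection (bigD1 a) //= big1 ?addr0 => [|b ba].
  by rewrite ip_Dr ip_Nr xy xx eqxx mulr1n subr0 scale1r opprB addrC subrK.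
by rewrite ip_Dr ip_Nr xy xx eq_sym (negPf ba) subr0 scale0r.
Qed.

Lemma reflection_sa : star reflection = reflection.
Proof.
apply/ffunP => -[h k]; rewrite fmat_starE !ffunE /= -[star _]/(Num.conj _).
rewrite rmorphB rmorph_sum /= conjC_nat eq_sym; congr (_ - _).
by apply: eq_bigr => a _; rewrite rmorphM /= conjCK mulrC.
Qed.

Lemma reflectionK v : mv reflection (mv reflection v) = v.
Proof.
rewrite [mv _ v]mv_reflection mvD mvN mv_sum mv_reflection.
have -> : \sum_a mv reflection (ip v (x a - y a) *: (x a - y a))
    = - \sum_a ip v (x a - y a) *: (x a - y a).
  rewrite -sumrN; apply: eq_bigr => a _; rewrite mvZ mvD mvN.
  by rewrite reflection_x reflection_y -scalerN opprB.
by rewrite opprK subrK.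
Qed.

Definition reflect_fun (a : fmat H (scal R)) := reflection ** a ** reflection.

Let W2 : is_unit (reflection ** reflection).
Proof. by apply: unit_of_mv => v; rewrite mvM reflectionK. Qed.

Fact reflect_funD a b : reflect_fun (a + b) = reflect_fun a + reflect_fun b.
Proof. by rewrite /reflect_fun smulDr smulDl. Qed.
Fact reflect_funZ (k : R[i]) a : reflect_fun (k *: a) = k *: reflect_fun a.
Proof. by rewrite /reflect_fun smulZr smulZl. Qed.
Fact reflect_funM a b : reflect_fun (a ** b) = reflect_fun a ** reflect_fun b.
Proof.
rewrite /reflect_fun !smulA -[reflection ** a ** reflection ** reflection]smulA.
by have [_ ->] := W2 (reflection ** a).
Qed.
Fact reflect_fun_star a : reflect_fun (star a) = star (reflect_fun a).
Proof. by rewrite /reflect_fun !starM reflection_sa smulA. Qed.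

Definition reflect_hom : starhom (fmat H (scal R)) (fmat H (scal R)) :=
  StarHom reflect_funD reflect_funZ reflect_funM reflect_fun_star.

Lemma reflect_unit a : is_unit a -> is_unit (reflect_hom a).
Proof. by move=> ha; rewrite /= /reflect_fun; case: (ha reflection) => _ ->. Qed.

End Reflection.

Lemma ip_diag_unslice (R : realType) (O : starAlgType R) (L J : finType)
    (s : starhom O (fmat J (scal R))) o i j v w :
  ip (mv (diag L s o) (unslice i v)) (unslice j w)
  = if i == j then ip (mv (s o) v) w else 0.
Proof.
rewrite ip_slice (bigD1 j) //= big1 ?addr0 => [|k kj].
  rewrite !slice_unslice eqxx slice_mv_diag slice_unslice eq_sym.
  by case: ifP => // _; rewrite mv0 ip_0l.
by rewrite [slice (unslice j w) k]slice_unslice (negPf kj)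
  ip_0r.
Qed.

Section Reindex.
Variables (R : realType) (F : finType).

Definition reindex_fun (a : fmat F (scal R)) : fmat 'I_#|F| (scal R) :=
  [ffun q => a (enum_val q.1, enum_val q.2)].

Fact reindex_funD a b : reindex_fun (a + b) = reindex_fun a + reindex_fun b.
Proof. by apply/ffunP => q; rewrite !ffunE. Qed.
Fact reindex_funZ (k : R[i]) a : reindex_fun (k *: a) = k *: reindex_fun a.
Proof. by apply/ffunP => q; rewrite !ffunE. Qed.
Fact reindex_funM a b : reindex_fun (a ** b) = reindex_fun a ** reindex_fun b.
Proof.
apply/ffunP => -[i j]; rewrite fmatM ffunE fmatM /=.
rewrite (reindex (@enum_val F F)) /=; last exact/onW_bij/enum_val_bij.
by apply: eq_bigr => k _; rewrite !ffunE.
Qed.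
Fact reindex_fun_star a : reindex_fun (star a) = star (reindex_fun a).
Proof. by apply/ffunP => -[i j]; rewrite ffunE !fmat_starE ffunE. Qed.

Definition reindex_hom : starhom (fmat F (scal R)) (fmat 'I_#|F| (scal R)) :=
  StarHom reindex_funD reindex_funZ reindex_funM reindex_fun_star.

Lemma reindex_inj a : reindex_hom a = 0 -> a = 0.
Proof.
move=> /ffunP h; apply/ffunP => -[x y]; rewrite fmat0.
by have := h (enum_rank x, enum_rank y); rewrite ffunE fmat0 /= !enum_rankK.
Qed.

End Reindex.

Section Models.
Variables (R : realType) (P O M : cstarAlgType R) (U : mxunits P).
Variables (T : cstar_tensor P M) (Phi : starhom O T).
Variables (o1 : O) (ho : is_unit o1) (u : M) (hu : is_unit u).
Hypotheses (M_maps : is_quantum_space_of_maps Phi) (sep : separated O).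
Local Notation r := (mu_r U).
Local Notation c := (@mu_c _ _ U).
Local Notation e := (@mu_e _ _ U).
Local Notation mu := (Phi_coef U Phi hu).

Lemma mu_block o : isblock 0 (mu o).
Proof. exact: tcoef_block. Qed.

Lemma mu_unital i j : mu o1 (i, j) = (i == j)%:R *: u.
Proof.
have -> : mu o1 (i, j) = tcoef U hu (tens T (\sum_k e k k) u) (i, j).
  by rewrite (unit_uniq (tens_unit U hu (T := T)) (Phi_unit ho M_maps)).
rewrite tcoef_tens starhom_sum sum_ffunE (bigD1 i) //= pcoef_e // xpair_eqE eqxx.
rewrite big1 ?addr0 // => k ki.
by rewrite pcoef_e // xpair_eqE (negPf ki).
Qed.

(** A unital homomorphism into block matrices over the matrices of size [F] is a morphism into
    [block_tensor], and the universal property makes it a representation of [M] on [C^F]. *)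
Lemma realize (F : finType) (Y : starhom O (fmat 'I_r (fmat F (scal R)))) :
  (forall o, isblock 0 (Y o)) -> is_unit (Y o1) ->
  exists2 L : starhom M (fmat F (scal R)), is_unit (L u) &
    forall o q, L (mu o q) = Y o q.
Proof.
move=> bY Y1; pose X := rmat F (@scal_unit R) (@scal_separated R).
have hX : @is_unit R X (fmat1 F (1 : scal R)) := fmat1_unit (@scal_unit R).
have sepX : separated X.
  by move=> a h; apply: reindex_inj; exact: (h _ (reindex_hom R F)).
pose Y' : starhom O (rmat 'I_r hX sepX) := Y.
have YS o : csub_set (block_csub U hX sepX) (Y' o) by exact: bY.
pose psi : starhom O (block_tensor U hX sepX) := cores_hom YS.
have psi1 : is_unit (psi o1).
  move=> t; split; apply: csval_inj.
    by case: (Y1 (csval t)).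
  by case: (Y1 (csval t)).
have [L Lu hL] := universal_ex U hu M_maps hX psi1.
exists L; first by rewrite Lu.
by move=> o q; rewrite hL tcoef_block_tensor.
Qed.

Variable phi : M -> R[i].
Hypotheses (phiD : forall x y, phi (x + y) = phi x + phi y)
  (phiZ : forall k x, phi (k *: x) = k * phi x)
  (phiC : forall x, phi (star x) = Num.conj (phi x))
  (phiP : forall x, 0 <= phi (star x ** x)).

Definition gns x y := phi (star y ** x).

Lemma gnsD x y z : gns (x + y) z = gns x z + gns y z.
Proof. by rewrite /gns smulDr phiD. Qed.
Lemma gnsZ k x y : gns (k *: x) y = k * gns x y.
Proof. by rewrite /gns smulZr phiZ. Qed.
Lemma gnsC x y : gns x y = Num.conj (gns y x).
Proof. by rewrite /gns -phiC starM starK. Qed.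
Lemma gns_ge0 x : 0 <= gns x x. Proof. exact: phiP. Qed.

Lemma phi_sum (J : finType) (f : J -> M) : phi (\sum_j f j) = \sum_j phi (f j).
Proof.
apply: (big_morph phi phiD).
by rewrite -(scale0r (0 : M)) phiZ mul0r.
Qed.

(** [Lam] acts on [C^F] alone, so one vector [s a] has to serve for all rows, while the
    approximating vectors [eta (j, a)] depend on [j]. This is why they are rotated onto the vectors
    that have [s a] in row [j]. *)
Lemma models q (v : 'I_q -> M) (a0 : 'I_q) (L : finType) (o : L -> O) (d : R) :
  orthonormal_family gns v -> 0 < d ->
  exists (F : finType) (Lam : starhom M (fmat F (scal R))) (s : 'I_q -> F -> R[i]),
  [/\ is_unit (Lam u), orthonormal_family (@ip R F) s &
  forall l i j a b, nrm (ip (mv (Lam (mu (o l) (i, j))) (s a)) (s b)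
    - gns (mu (o l) (i, j) ** v a) (v b)) <= d].
Proof.
move=> ov d0.
(* Without matrix units the condition on entries is empty, and only a unital representation has to
   be exhibited. *)
have [j0 _|nor] := pickP 'I_r; last first.
  have [| |Lam Lamu _] := @realize 'I_q (zero_hom O _).
  - by move=> o' i; have := nor i.
  - by move=> b; split; apply/ffunP => -[i j]; have := nor i.
  exists 'I_q, Lam, (@delta R 'I_q); split=> //; first exact: delta_orthonormal.
  by move=> l i; have := nor i.
pose I := ('I_r * 'I_q)%type.
pose tau (x : O) (a b : I) := gns (mu x (b.1, a.1) ** v a.2) (v b.2).
have [|||||J [sg [eta [sg1 oeta heta]]]] := @exact_approximation R O o1 ho sep I tau
    _ _ _ _ _ L o d d0.
- by move=> x y a b; rewrite /tau starhomD fmatD smulDl gnsD.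
- by move=> k x a b; rewrite /tau starhomZ fmatZ smulZl gnsZ.
- move=> x a b; rewrite /tau starhom_star fmat_starE -gnsC /gns.
  by rewrite starM !smulA.
- move=> Z.
  (* The form is a sum of squares of these vectors, by [mu (Z1^* Z2) = mu(Z1)^* mu(Z2)] written in
     entries. *)
  pose y (g : I) k := \sum_(a : I) mu (Z (g, a)) (k, a.1) ** v a.2.
  rewrite (_ : \sum_a \sum_b _ = \sum_g \sum_k gns (y g k) (y g k)).
    by apply: sumr_ge0 => g _; apply: sumr_ge0 => k _; exact: gns_ge0.
  have yE g k : gns (y g k) (y g k) = \sum_(a : I) \sum_(b : I)
      gns (mu (Z (g, a)) (k, a.1) ** v a.2) (mu (Z (g, b)) (k, b.1) ** v b.2).
    rewrite (semi_suml gnsD gnsZ); apply: eq_bigr => a _.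
    by rewrite (semi_sumr gnsD gnsZ gnsC).
  under [RHS]eq_bigr do under eq_bigr do rewrite yE.
  under [RHS]eq_bigr do rewrite exchange_big.
  rewrite [RHS]exchange_big; apply: eq_bigr => a _ /=.
  under [RHS]eq_bigr do rewrite exchange_big.
  rewrite [RHS]exchange_big; apply: eq_bigr => b _ /=.
  rewrite /tau /gns fmatM starhom_sum sum_ffunE muls_suml muls_sumr phi_sum.
  apply: eq_bigr => g _; rewrite starhomM fmatM muls_suml muls_sumr phi_sum.
  apply: eq_bigr => k _; rewrite fmat_starE starhom_star fmat_starE starM.
  by rewrite !smulA.
- move=> [j a] [i b]; rewrite /tau /= mu_unital smulZl gnsZ.
  case: (hu (v a)) => -> _; rewrite ov xpair_eqE [i == j]eq_sym.
  by case: (j == i); rewrite ?mul1r ?mul0r.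
have [e0] : exists e0 : J, True.
  have [e0 _|noJ] := pickP J; first by exists e0.
  have := oeta (j0, a0) (j0, a0); rewrite eqxx /ip big1 => [/esym/eqP|z].
    by rewrite oner_eq0.
  by have := noJ z.
move=> _.
(* The copy [None] of [sg] hosts the vectors [eta]; the copies [Some a] host the standard vectors,
   orthogonal to all of them. *)
pose F := (option 'I_q * J)%type.
pose s a : F -> R[i] := unslice (Some a) (delta R e0).
(* The row [c a.1] lies in the block of [a.1], so the reflection preserves the blocks. Rows of one
   block share it, so [x (j, a)] and [x (i, b)] are paired by a single copy of [sg]. *)
pose x (a : I) : 'I_r * F -> R[i] := unslice (c a.1) (unslice None (eta a)).
pose y (a : I) : 'I_r * F -> R[i] := unslice a.1 (s a.2).
have os : orthonormal_family (@ip R F) s.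
  move=> a b; rewrite ip_unslice slice_unslice (inj_eq Some_inj).
  case: ifP => _; last by rewrite ip_0r.
  by rewrite delta_orthonormal eqxx.
have oy : orthonormal_family (@ip R ('I_r * F)%type) y.
  move=> [j a] [i b]; rewrite ip_unslice slice_unslice xpair_eqE /=.
  case: ifP => _; last by rewrite ip_0r.
  by rewrite os.
have ox : orthonormal_family (@ip R ('I_r * F)%type) x.
  move=> [j a] [i b]; rewrite ip_unslice slice_unslice /=.
  case: ifP => [_|/eqP cij].
    by rewrite ip_unslice slice_unslice eqxx oeta.
  rewrite ip_0r xpair_eqE.
  by case: eqP => // ji; rewrite ji in cij.
have xy a b : ip (x a) (y b) = 0.
  rewrite ip_unslice slice_unslice; case: ifP => _.
    by rewrite ip_unslice slice_unslice /= ip_0r.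
  by rewrite ip_0r.
pose D := diag 'I_r (diag (option 'I_q) sg).
pose rho := comp_hom (reflect_hom ox oy xy) D.
pose Y := comp_hom (unflat R 'I_r F) rho.
pose hb (a : fmat ('I_r * F)%type (scal R)) :=
  forall i j f f', c i != c j -> a ((i, f), (j, f')) = 0.
have hbM a b : hb a -> hb b -> hb (a ** b).
  move=> ba bb i j f f' ij; rewrite fmatM big1 // => -[k g] _.
  have [ik|ik] := eqVneq (c i) (c k); last by rewrite ba // mulr0s.
  by rewrite bb ?muls0 // -ik.
have bx a i f : c i != c a.1 -> (x a - y a) (i, f) = 0.
  move=> ia; rewrite -[LHS]/(x a (i, f) - y a (i, f)) /x /y /unslice /=.
  case: eqP => [ic|_]; first by rewrite ic mu_cc eqxx in ia.
  by case: eqP => [ic|_]; [rewrite ic eqxx in ia|rewrite subr0].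
have bW : hb (reflection x y).
  move=> i j f f' ij; rewrite ffunE /= xpair_eqE.
  case: eqP => [eij|_]; first by rewrite eij eqxx in ij.
  rewrite sub0r big1 ?oppr0 // => a _.
  have [ia|ia] := eqVneq (c i) (c a.1); last by rewrite bx // mul0r.
  by rewrite [(x a - y a) (j, f')]bx ?conjC0 ?mulr0 // -ia eq_sym.
have bD o' : hb (D o').
  move=> i j f f' ij; rewrite ffunE /=; case: eqP => // eij.
  by rewrite eij eqxx in ij.
have [||Lam Lamu hLam] := @realize F Y.
- move=> o' i j ij; apply/ffunP => -[f f'].
  have -> : Y o' (i, j) (f, f') = rho o' ((i, f), (j, f')) by rewrite !ffunE.
  rewrite fmat0; have hr := hbM _ _ (hbM _ _ bW (bD o')) bW.
  exact: hr.
- apply: unflat_unit; apply: reflect_unit; apply: diag_unit; exact: diag_unit.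
exists F, Lam, s; split=> // l i j a b.
have [cij|cij] := eqVneq (c i) (c j); last first.
  rewrite mu_block // starhom0 mv0l mulr0s ip_0l (semi_0l gnsZ).
  by rewrite subrr nrm0 ltW.
rewrite hLam -[Y (o l)]/(unflat R 'I_r F (rho (o l))) mv_unflat.
have -> : ip (slice (mv (rho (o l)) (unslice j (s a))) i) (s b)
    = ip (mv (rho (o l)) (y (j, a))) (y (i, b)).
  by rewrite [RHS]ipC [ip (y _) _]ip_unslice -ipC.
have -> : ip (mv (rho (o l)) (y (j, a))) (y (i, b))
    = ip (mv (D (o l)) (x (j, a))) (x (i, b)).
  rewrite -[rho (o l)]/(reflection x y ** D (o l) ** reflection x y) !mvM.
  by rewrite (reflection_y oy xy) ip_mv reflection_sa (reflection_y oy xy).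
rewrite /x !ip_diag_unslice /= cij eqxx.
exact: (heta l (j, a) (i, b)).
Qed.

End Models.

(** * Asymptotic intertwining and detection of a nonzero element *)

Section Generation.
Variables (R : realType) (P O M : cstarAlgType R) (U : mxunits P).
Variables (T : cstar_tensor P M) (Phi : starhom O T).
Variables (o1 : O) (ho : is_unit o1) (u : M) (hu : is_unit u).
Hypotheses (M_maps : is_quantum_space_of_maps Phi) (sep : separated O).
Local Notation r := (mu_r U).
Local Notation mu := (Phi_coef U Phi hu).

Variable phi : M -> R[i].
Hypotheses (phiD : forall x y, phi (x + y) = phi x + phi y)
  (phiZ : forall k x, phi (k *: x) = k * phi x)
  (phiC : forall x, phi (star x) = Num.conj (phi x))
  (phiP : forall x, 0 <= phi (star x ** x)).
Variables (x0 : M) (x0_neq0 : 0 < phi (star x0 ** x0)).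

Local Notation B := (gns phi).
Let BD := gnsD phiD.
Let BZ := gnsZ phiZ.
Let BC := gnsC phiC.
Let B0 := gns_ge0 phiP.
Local Notation gn := (sn B).

Lemma gns_mulE x y z : B (x ** y) z = B y (star x ** z).
Proof. by rewrite /gns starM starK smulA. Qed.

Lemma gns_nulll y z : sqn B y = 0 -> B y z = 0.
Proof.
move=> y0; apply: nrm0_eq0; apply/le_anti; rewrite nrm_ge0 andbT.
by rewrite (le_trans (cauchy_schwarz BD BZ BC B0 _ _)) // /sn y0 sqrtr0 mul0r.
Qed.

(** Left multiplication is moved to the other argument, after which Cauchy-Schwarz disposes of the
    null vectors. *)
Lemma gns_eq w w' x y y' : sqn B (w - w') = 0 -> sqn B (y - y') = 0 ->
  B (x ** w) y = B (x ** w') y'.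
Proof.
move=> ww yy; apply: (@etrans _ _ (B (x ** w') y)).
  apply/eqP; rewrite -subr_eq0 -(semi_Nl BZ) -BD -mulsBr gns_mulE.
  by rewrite gns_nulll.
apply/eqP; rewrite -subr_eq0 -(semi_Nr BZ BC) -(semi_Dr BD BC) BC.
by rewrite gns_nulll // conjC0.
Qed.

(** Write [|x|^2 - x^* x = s^2]; then [phi] is nonnegative at [(s w)^* (s w)]. *)
Lemma gn_mul x w : gn (x ** w) <= nrm x * gn w.
Proof.
rewrite -(@ler_pXn2r _ 2) ?nnegrE ?mulr_ge0 ?nrm_ge0 ?sn_ge0 // exprMn.
rewrite !(sn_sqr B0) -lecR rmorphM /= -!(sqnE B0) /gns -phiZ -subr_ge0.
have [s ss se] : Pos ((nrm x ^+ 2)%:C *: u - star x ** x).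
  by apply: (Pos_nrm_sub hu); rewrite ?nrm_cstar // starM starK.
have -> : phi ((nrm x ^+ 2)%:C *: (star w ** w)) - phi (star (x ** w) ** (x ** w))
    = phi (star (s ** w) ** (s ** w)); last exact: phiP.
rewrite -[- phi _]mulN1r -phiZ -phiD scaleN1r; congr phi.
have -> : star (s ** w) ** (s ** w) = star w ** (s ** s) ** w.
  by rewrite starM ss !smulA.
rewrite -se mulsBr mulsBl smulZr smulZl starM.
by have [_ ->] := hu (star w); rewrite !smulA.
Qed.

Section ApproxForm.
Variables (q : nat) (v : 'I_q -> M) (F : finType) (s : 'I_q -> F -> R[i]).
Hypotheses (ov : orthonormal_family B v) (os : orthonormal_family (@ip R F) s).

(** The orthogonal projection onto the span of [v], followed by the isometry that sends [v k] to
    [s k]. *)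
Definition transfer (w : M) : F -> R[i] := \sum_k B w (v k) *: s k.
Definition l1norm (w : M) : R := \sum_k nrm (B w (v k)).
Definition in_span (w : M) := sqn B (w - \sum_k B w (v k) *: v k) = 0.

Lemma l1norm_ge0 w : 0 <= l1norm w.
Proof. by apply: sumr_ge0 => k _; apply: nrm_ge0. Qed.

Lemma transferD w w' : transfer (w + w') = transfer w + transfer w'.
Proof.
by rewrite /transfer -big_split; apply: eq_bigr => k _; rewrite BD scalerDl.
Qed.

Lemma transferZ (k : R[i]) w : transfer (k *: w) = k *: transfer w.
Proof.
by rewrite /transfer scaler_sumr; apply: eq_bigr => l _; rewrite BZ scalerA.
Qed.

Lemma vn_transfer w : vn (transfer w) ^+ 2 = \sum_k nrm (B w (v k)) ^+ 2.
Proof.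
apply: (@complexI R); rewrite -ip_vn /transfer.
rewrite ip_suml rmorph_sum /=; apply: eq_bigr => k _.
rewrite ip_sumr (bigD1 k) //= big1 ?addr0.
  by rewrite ipZ ip_Zr os eqxx mulr1 -normCK normE rmorphXn.
move=> l lk; rewrite ipZ ip_Zr os eq_sym (negPf lk).
by rewrite !mulr0.
Qed.

Lemma vn_transfer_le w : vn (transfer w) <= gn w.
Proof.
rewrite -(@ler_pXn2r _ 2) ?nnegrE ?vn_ge0 ?sn_ge0 // vn_transfer (sn_sqr B0).
exact: (bessel BD BZ BC B0 w ov).
Qed.

Lemma vn_transfer_span w : in_span w -> vn (transfer w) = gn w.
Proof.
rewrite /in_span (sqn_proj BD BZ BC B0 w ov) => /eqP; rewrite subr_eq0 => /eqP h.
apply/eqP; rewrite -(@eqrXn2 _ 2) ?vn_ge0 ?sn_ge0 //.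
by rewrite vn_transfer (sn_sqr B0) h.
Qed.

Lemma approx_form (a : fmat F (scal R)) (x : M) (d : R) w w' :
  (forall k l, nrm (ip (mv a (s k)) (s l) - B (x ** v k) (v l)) <= d) ->
  in_span w -> in_span w' ->
  nrm (ip (mv a (transfer w)) (transfer w') - B (x ** w) w')
    <= l1norm w * l1norm w' * d.
Proof.
move=> ax sw sw'; rewrite (gns_eq x sw sw').
have -> : B (x ** \sum_k B w (v k) *: v k) (\sum_k B w' (v k) *: v k)
    = \sum_k \sum_l B w (v k) * (Num.conj (B w' (v l)) * B (x ** v k) (v l)).
  rewrite muls_sumr (semi_suml BD BZ); apply: eq_bigr => k _.
  rewrite smulZr BZ (semi_sumr BD BZ BC) mulr_sumr; apply: eq_bigr => l _.
  by rewrite (semi_Zr BZ BC).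
have -> : ip (mv a (transfer w)) (transfer w')
    = \sum_k \sum_l B w (v k) * (Num.conj (B w' (v l)) * ip (mv a (s k)) (s l)).
  rewrite mv_sum ip_suml; apply: eq_bigr => k _.
  rewrite mvZ ipZ ip_sumr mulr_sumr.
  by apply: eq_bigr => l _; rewrite ip_Zr.
rewrite -sumrB /l1norm mulr_suml mulr_suml.
elim/big_ind2: _ => [|y y' z z' hy hz|k _]; first by rewrite nrm0.
  by rewrite (le_trans (nrmD _ _)) // lerD.
rewrite -sumrB mulr_sumr mulr_suml.
elim/big_ind2: _ => [|y y' z z' hy hz|l _]; first by rewrite nrm0.
  by rewrite (le_trans (nrmD _ _)) // lerD.
rewrite -mulrBr -mulrBr !nrmM_C -mulrA ler_wpM2l ?nrm_ge0 //.
by rewrite {1}/nrm norm_conjC -/(nrm _) ler_wpM2l ?nrm_ge0.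
Qed.

End ApproxForm.

(* [w |-> V w] maps the vectors of the representation attached to [phi] to
   those of [Lam], where [close] says that [V] almost intertwines the action of
   finitely many generators of [M]. *)
Definition model (F : finType) (Lam : starhom M (fmat F (scal R)))
    (V : M -> F -> R[i]) :=
  [/\ is_unit (Lam u), forall x y, V (x + y) = V x + V y,
      forall k x, V (k *: x) = k *: V x & forall x, vn (V x) <= gn x].

Definition close (D : seq (O * 'I_r * M)) (d : R) (F : finType)
    (Lam : starhom M (fmat F (scal R))) (V : M -> F -> R[i]) :=
  forall o j w, (o, j, w) \in D -> forall i,
    vn (mv (Lam (mu o (i, j))) (V w) - V (mu o (i, j) ** w)) <= d.

(** Expand [|A_i - p_i|^2] for [A_i = Lam(mu o (i, j)) V w] and [p_i = V(mu o (i, j) w)]. The cross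
    terms are coefficients at [o], and the sum of [|A_i|^2] over the column is the coefficient of
    the entry [(j, j)] at [o^* o]. Since [V] is isometric on the span used, everything is close to
    the sum of [|p_i|^2] and cancels. *)
Lemma good_models (D : seq (O * 'I_r * M)) (z : M) (d : R) : 0 < d ->
  exists (F : finType) (Lam : starhom M (fmat F (scal R))) (V : M -> F -> R[i]),
  [/\ model Lam V, close D d Lam V & vn (V z) = gn z].
Proof.
move=> d0.
pose images (x : O * 'I_r * M) := [seq mu x.1.1 (i, x.1.2) ** x.2 | i <- enum 'I_r].
(* [x0] guarantees a nonempty orthonormal family and [z] an exact value of [|V z|]; the remaining
   vectors are those to which the coefficient estimates are applied. *)
pose S := x0 :: z :: flatten [seq x.2 :: images x | x <- D].
have [q [v [ov hv]]] := gram_schmidt BD BZ BC B0 S.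
have sp w : w \in S -> in_span v w by exact: hv.
have spD x : x \in D -> in_span v x.2.
  move=> xD; apply: sp; rewrite !inE; apply/orP; right; apply/orP; right.
  by apply/flattenP; exists (x.2 :: images x); [exact: map_f|rewrite inE eqxx].
have spI x i : x \in D -> in_span v (mu x.1.1 (i, x.1.2) ** x.2).
  move=> xD; apply: sp; rewrite !inE; apply/orP; right; apply/orP; right.
  apply/flattenP; exists (x.2 :: images x); first exact: map_f.
  by rewrite inE; apply/orP; right; apply: map_f; rewrite mem_enum.
have [a0 _] : exists a0 : 'I_q, True.
  case: (posnP q) => [q0|q0]; last by exists (Ordinal q0).
  have := hv x0 (mem_head _ _); rewrite big1 ?subr0 => [x00|i _]; last first.
    by have := ltn_ord i; rewrite {2}q0.
  by move: x0_neq0; rewrite -[phi _]/(B x0 x0) (sqnE B0) x00 ltxx.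
pose l1 := l1norm v.
have l10 w : 0 <= l1 w by apply: l1norm_ge0.
(* The first summand bounds the error in the sum of [|A_i|^2], the second the doubled cross terms.
   [N] dominates these constants over [D], and the tolerance [d^2 / N] is quadratic because squares
   are estimated. *)
pose cst (x : O * 'I_r * M) : R := l1 x.2 * l1 x.2
  + 2 * l1 x.2 * \sum_i l1 (mu x.1.1 (i, x.1.2) ** x.2).
have cst0 x : 0 <= cst x.
  by rewrite addr_ge0 ?mulr_ge0 // sumr_ge0.
pose N : R := 1 + \sum_(x <- D) cst x.
have N0 : 0 < N by rewrite ltr_wpDr // sumr_ge0.
have cstN x : x \in D -> cst x <= N.
  move=> xD; rewrite /N (big_rem x) //= addrCA lerDl addr_ge0 // sumr_ge0 //.
pose t := d ^+ 2 / N.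
have t0 : 0 < t by rewrite divr_gt0 // exprn_gt0.
pose D' := [seq x.1.1 | x <- D] ++ [seq star x.1.1 ** x.1.1 | x <- D].
have [F [Lam [s [Lamu os hs]]]] := @models _ _ _ _ U T Phi o1 ho u hu M_maps sep
  phi phiD phiZ phiC phiP q v a0 'I_(size D') (fun l => nth o1 D' l) t ov t0.
have hD' o : o \in D' -> forall i j k l,
    nrm (ip (mv (Lam (mu o (i, j))) (s k)) (s l) - B (mu o (i, j) ** v k) (v l)) <= t.
  by move=> /(nthP o1)[n nD <-] i j k l; exact: (hs (Ordinal nD)).
pose V := transfer v s.
exists F, Lam, V; split; last by apply: vn_transfer_span => //; apply: sp;
  rewrite !inE eqxx orbT.
  split=> //; [exact: transferD|exact: transferZ|].
  by move=> x; apply: vn_transfer_le.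
move=> o j w xD i.
have oD : o \in D' by rewrite mem_cat; apply/orP; left; apply/mapP; exists (o, j, w).
have ooD : star o ** o \in D'.
  by rewrite mem_cat; apply/orP; right; apply/mapP; exists (o, j, w).
have sw : in_span v w := spD _ xD.
have sI i' : in_span v (mu o (i', j) ** w) := spI _ i' xD.
pose A i' := mv (Lam (mu o (i', j))) (V w).
pose p i' := V (mu o (i', j) ** w).
pose g i' := sqn B (mu o (i', j) ** w).
have pp i' : vn (p i') ^+ 2 = g i'.
  by rewrite vn_transfer_span // (sn_sqr B0).
have Ap i' : nrm (ip (A i') (p i') - (g i')%:C)
    <= l1 w * l1 (mu o (i', j) ** w) * t.
  by rewrite /g -(sqnE B0); apply: approx_form => // k l; apply: hD'.
have AA : nrm (\sum_i' ip (A i') (A i') - \sum_i' (g i')%:C) <= l1 w * l1 w * t.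
  have mu_oo : \sum_i' star (mu o (i', j)) ** mu o (i', j) = mu (star o ** o) (j, j).
    rewrite starhomM starhom_star fmatM; apply: eq_bigr => i' _.
    by rewrite fmat_starE.
  have -> : \sum_i' ip (A i') (A i') = ip (mv (Lam (mu (star o ** o) (j, j))) (V w)) (V w).
    rewrite -mu_oo starhom_sum.
    have -> : mv (\sum_i' Lam (star (mu o (i', j)) ** mu o (i', j))) (V w)
        = \sum_i' mv (Lam (star (mu o (i', j)) ** mu o (i', j))) (V w).
      by apply: (big_morph (fun a => mv a (V w))) => [a b|]; rewrite ?mvDl ?mv0l.
    rewrite ip_suml; apply: eq_bigr => i' _.
    by rewrite starhomM starhom_star mvM ip_mv starK.
  have -> : \sum_i' (g i')%:C = B (mu (star o ** o) (j, j) ** w) w.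
    rewrite -mu_oo muls_suml (semi_suml BD BZ); apply: eq_bigr => i' _.
    rewrite /g -(sqnE B0) /gns.
    by rewrite !starM !smulA.
  by apply: approx_form => // k l; apply: hD'.
have dist i' : vn (A i' - p i') ^+ 2
    = vn (A i') ^+ 2 - 2 * complex.Re (ip (A i') (p i')) + g i'.
  apply: (@complexI R); rewrite -ip_vn ipD !ip_Dr.
  rewrite !ip_Nr !ip_Nl opprK.
  rewrite !ip_vn pp (ipC (p i') (A i')).
  case: (ip (A i') (p i')) => a b.
  by apply/eqP; rewrite eq_complex /=; apply/andP; split; apply/eqP; ring.
have total : \sum_i' vn (A i' - p i') ^+ 2 <= cst (o, j, w) * t.
  under eq_bigr do rewrite dist.
  rewrite big_split sumrB /=.
  have h1 : \sum_i' vn (A i') ^+ 2 <= \sum_i' g i' + l1 w * l1 w * t.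
    have := le_trans (nrm_Re _) AA; rewrite -rmorph_sum ReB /=.
    have -> : complex.Re (\sum_i' ip (A i') (A i')) = \sum_i' vn (A i') ^+ 2.
      by under eq_bigr do rewrite ip_vn; rewrite -rmorph_sum.
    by rewrite ler_norml => /andP[_]; lra.
  have h2 : 2 * \sum_i' g i' - 2 * l1 w * (\sum_i' l1 (mu o (i', j) ** w)) * t
      <= \sum_i' 2 * complex.Re (ip (A i') (p i')).
    rewrite mulr_sumr mulr_sumr mulr_suml -sumrB; apply: ler_sum => i' _.
    have := le_trans (nrm_Re _) (Ap i'); rewrite ReB /= ler_norml => /andP[+ _].
    lra.
  have -> : cst (o, j, w) * t = l1 w * l1 w * t
      + 2 * l1 w * (\sum_i' l1 (mu o (i', j) ** w)) * t by rewrite /cst /= mulrDl.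
  move: h1 h2; lra.
rewrite -(@ler_pXn2r _ 2) ?nnegrE ?vn_ge0 ?(ltW d0) //.
apply: (@le_trans _ _ (\sum_i' vn (A i' - p i') ^+ 2)).
  by rewrite (bigD1 i) //= lerDl sumr_ge0 // => i' _; rewrite sqr_ge0.
apply: le_trans total _; rewrite /t mulrA ler_pdivrMr // mulrC.
by rewrite ler_wpM2l ?sqr_ge0 // cstN.
Qed.

(** A limit along all models expressed by finite data: [D] and the tolerance depend on [m], [w] and
    [d], but not on the model. *)
Definition asymptotic (m : M) := forall w d, 0 < d -> exists D t,
  0 < t /\ forall F (Lam : starhom M (fmat F (scal R))) V,
    model Lam V -> close D t Lam V -> vn (mv (Lam m) (V w) - V (m ** w)) <= d.

Lemma close_cat D1 D2 t1 t2 F (Lam : starhom M (fmat F (scal R))) V :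
  close (D1 ++ D2) (Num.min t1 t2) Lam V -> close D1 t1 Lam V /\ close D2 t2 Lam V.
Proof.
move=> h; split=> o j w hw i; have := h o j w; rewrite mem_cat hw ?orbT.
  by move=> /(_ isT i) /le_trans; apply; rewrite ge_min lexx.
by move=> /(_ isT i) /le_trans; apply; rewrite ge_min lexx orbT.
Qed.

Lemma asymptoticD x y : asymptotic x -> asymptotic y -> asymptotic (x + y).
Proof.
move=> hx hy w d /half_gt0 d0; have [D1 [t1 [t10 h1]]] := hx w _ d0.
have [D2 [t2 [t20 h2]]] := hy w _ d0.
exists (D1 ++ D2), (Num.min t1 t2); split; first by rewrite lt_min t10.
move=> F Lam V mo /close_cat[c1 c2]; have [_ VD _ _] := mo.
rewrite starhomD mvDl smulDl VD opprD addrACA (le_trans (vnD _ _)) //.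
by rewrite (splitr d) lerD ?h1 ?h2.
Qed.

Lemma asymptoticZ (k : R[i]) x : asymptotic x -> asymptotic (k *: x).
Proof.
move=> hx w d d0; have k0 : 0 < nrm k + 1 by rewrite ltr_wpDl ?nrm_ge0.
have [D [t [t0 h]]] := hx w _ (divr_gt0 d0 k0).
exists D, t; split=> // F Lam V mo cl; have [_ _ VZ _] := mo.
rewrite starhomZ mvZl smulZl VZ -scalerBr vnZ.
apply: le_trans (ler_wpM2l (nrm_ge0 k) (h F Lam V mo cl)) _.
by rewrite mulrCA -[leRHS]mulr1 ler_wpM2l ?(ltW d0) // ler_pdivrMr // mul1r lerDl.
Qed.

Lemma asymptoticM x y : asymptotic x -> asymptotic y -> asymptotic (x ** y).
Proof.
move=> hx hy w d /half_gt0 d0; have k0 : 0 < nrm x + 1 by rewrite ltr_wpDl ?nrm_ge0.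
have [D1 [t1 [t10 h1]]] := hx (y ** w) _ d0.
have [D2 [t2 [t20 h2]]] := hy w _ (divr_gt0 d0 k0).
exists (D1 ++ D2), (Num.min t1 t2); split; first by rewrite lt_min t10.
move=> F Lam V mo /close_cat[c1 c2].
have -> : mv (Lam (x ** y)) (V w) - V (x ** y ** w)
    = mv (Lam x) (mv (Lam y) (V w) - V (y ** w))
      + (mv (Lam x) (V (y ** w)) - V (x ** (y ** w))).
  by rewrite starhomM mvM mvD mvN addrA subrK smulA.
rewrite (le_trans (vnD _ _)) // (splitr d) lerD ?h1 //.
apply: le_trans (rep_contr _ _ _) _.
apply: le_trans (ler_wpM2l (nrm_ge0 x) (h2 F Lam V mo c2)) _.
by rewrite mulrCA -[leRHS]mulr1 ler_wpM2l ?(ltW d0) // ler_pdivrMr // mul1r lerDl.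
Qed.

Lemma asymptotic0 : asymptotic 0.
Proof.
move=> w d d0; exists [::], 1; split=> // F Lam V [_ _ VZ _] _.
by rewrite starhom0 mv0l mulr0s -(scale0r (0 : M)) VZ scale0r subrr vn0 ltW.
Qed.

(** [Lam] is contractive, [V] does not increase the seminorm and left multiplication is bounded for
    it; replacing [f n] by [l] costs [d / 4] on each side, uniformly in the model. *)
Lemma asymptotic_closed f l : (forall n, asymptotic (f n)) -> cvs f l -> asymptotic l.
Proof.
move=> hf fl w d d0.
have k0 : 0 < 4 * (gn w + 1) by rewrite mulr_gt0 // ltr_wpDl ?sn_ge0.
have [n /(_ n (leqnn n)) hn] := fl _ (divr_gt0 d0 k0).
have [D [t [t0 h]]] := hf n w _ (half_gt0 d0).
exists D, t; split=> // F Lam V mo cl; have [_ VD VZ Vle] := mo.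
have -> : mv (Lam l) (V w) - V (l ** w) = mv (Lam (l - f n)) (V w)
    + (mv (Lam (f n)) (V w) - V (f n ** w)) + V ((f n - l) ** w).
  rewrite starhomB mvDl mvNl mulsBl -[- (l ** w)]scaleN1r VD VZ scaleN1r.
  by rewrite !addrA addrNK addrNK.
have small x : nrm x <= d / (4 * (gn w + 1)) -> nrm x * gn w <= d / 4.
  move=> hx; have g0 := sn_ge0 B w.
  apply: le_trans (ler_wpM2r g0 hx) _; rewrite mulrAC ler_pdivrMr //.
  have -> : d / 4 * (4 * (gn w + 1)) = d * (gn w + 1) by field.
  by rewrite ler_wpM2l ?(ltW d0) // lerDl.
have h1 : vn (mv (Lam (l - f n)) (V w)) <= d / 4.
  apply: le_trans (rep_contr _ _ _) _.
  apply: le_trans (ler_wpM2l (nrm_ge0 _) (Vle w)) _.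
  by apply: small; rewrite nrmB.
have h3 : vn (V ((f n - l) ** w)) <= d / 4.
  apply: le_trans (Vle _) _; apply: le_trans (gn_mul _ _) _; exact: small.
have := vnD (mv (Lam (l - f n)) (V w) + (mv (Lam (f n)) (V w) - V (f n ** w)))
  (V ((f n - l) ** w)).
have := vnD (mv (Lam (l - f n)) (V w)) (mv (Lam (f n)) (V w) - V (f n ** w)).
have := h F Lam V mo cl; move: h1 h3; lra.
Qed.

(** The intertwining is one-sided, so the adjoint is included in the condition; this is harmless for
    the generators because [mu o (i, j)] has adjoint [mu (star o) (j, i)]. *)
Definition asymptotic_csub : csubalg M.
Proof.
refine (@CSubAlg R M [set m | asymptotic m /\ asymptotic (star m)] _ _ _ _ _ _).
- by split; rewrite ?star0; exact: asymptotic0.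
- by move=> x y [h1 h2] [h3 h4]; split; rewrite ?starD; exact: asymptoticD.
- by move=> k x [h1 h2]; split; rewrite ?starZ; exact: asymptoticZ.
- by move=> x y [h1 h2] [h3 h4]; split; rewrite ?starM; exact: asymptoticM.
- by move=> x [h1 h2]; split; rewrite ?starK.
- move=> f l hf fl; split; apply: asymptotic_closed.
  + by move=> n; exact: (hf n).1.
  + exact: fl.
  + by move=> n; exact: (hf n).2.
  + exact: cvs_star.
Defined.

Lemma all_asymptotic m : asymptotic m.
Proof.
suff [] : csub_set asymptotic_csub m by [].
have asu : asymptotic u.
  move=> w d d0; exists [::], 1; split=> // F Lam V [Lu _ _ _] _.
  by rewrite mv_unit //; case: (hu w) => -> _; rewrite subrr vn0 ltW.
have asmu o q : asymptotic (mu o q).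
  case: q => i j w d d0; exists [:: (o, j, w)], d; split=> // F Lam V _ cl.
  by apply: cl; rewrite inE.
apply: (@generated _ _ _ _ U T Phi o1 ho u hu M_maps asymptotic_csub) => [|o q].
  by split; rewrite ?(star_uniq_unit hu).
split=> //; case: q => i j.
by rewrite -fmat_starE -starhom_star.
Qed.

(** At the vector [u], intertwining says that [Lam(x0) V u] is within half the seminorm of [x0] of
    [V x0]. A model that preserves the length of [x0] thus cannot send [x0] to 0. *)
Lemma detecting_representation :
  exists (F : finType) (Lam : starhom M (fmat F (scal R))), Lam x0 != 0.
Proof.
have g0 : 0 < gn x0.
  by rewrite sqrtr_gt0 -ltcR -(sqnE B0).
have [D [t [t0 h]]] := all_asymptotic x0 u (half_gt0 g0).
have [F [Lam [V [mo cl Vx]]]] := good_models D x0 t0.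
exists F, Lam; apply/eqP => L0; have := h F Lam V mo cl.
rewrite L0 mv0l sub0r; case: (hu x0) => _ ->.
have -> : vn (- V x0) = vn (V x0) by apply: (snN (@ipZ _ _) (@ipC _ _)).
by rewrite Vx; move: g0; lra.
Qed.

End Generation.

Lemma rfd_separated (R : realType) (O : cstarAlgType R) :
  residually_finite_dimensional O -> separated O.
Proof.
move=> rfd o h; apply/eqP; apply: contraT => /rfd[n [pi /negP[]]].
have mD (a b : 'M[R[i]]_n) : [ffun q => (a + b) q.1 q.2] =
    [ffun q => a q.1 q.2] + [ffun q => b q.1 q.2] :> fmat 'I_n (scal R).
  by apply/ffunP => q; rewrite fmatD !ffunE mxE.
have mZ (k : R[i]) (a : 'M[R[i]]_n) : [ffun q => (k *: a) q.1 q.2] =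
    k *: [ffun q => a q.1 q.2] :> fmat 'I_n (scal R).
  by apply/ffunP => q; rewrite fmatZ !ffunE mxE.
pose k (a : 'M[R[i]]_n) : fmat 'I_n (scal R) := [ffun q => a q.1 q.2].
have mM a b : k (a ** b) = k a ** k b.
  apply/ffunP => -[i j]; rewrite fmatM ffunE /= mxE.
  by apply: eq_bigr => l _; rewrite !ffunE.
have mS a : k (star a) = star (k a).
  by apply/ffunP => -[i j]; rewrite fmat_starE !ffunE /= !mxE.
have /ffunP h0 := h n (comp_hom (@StarHom R 'M[R[i]]_n (fmat 'I_n (scal R)) k mD mZ mM mS) pi).
apply/eqP/matrixP => i j; have := h0 (i, j).
by rewrite ffunE fmat0 mxE.
Qed.

Theorem theorem2p11 (R : realType) (P O M : cstarAlgType R)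
    (T : cstar_tensor P M) (Phi : starhom O T)
    (O_compact : unital O)
    (O_rfd : residually_finite_dimensional O)
    (P_finite : finite_dimensional P)
    (M_maps : is_quantum_space_of_maps Phi) :
  residually_finite_dimensional M.
Proof.
have [ o1 ho] := O_compact; have [[u hu] _ _ _] := M_maps.
have [r [c [e [off st mul nz [cc span]]]]] := matrix_units P_finite.
pose U := @MxUnits R P r c e off st mul nz cc span.
move=> x x0; have [phi [phiD phiZ phiC phiP phix]] := exists_state hu x0.
have [F [Lam Lx]] := @detecting_representation R P O M U T Phi o1 ho u hu M_maps
  (rfd_separated O_rfd) phi phiD phiZ phiC phiP x phix.
pose m (a : fmat F (scal R)) : 'M[R[i]]_#|F| :=
  \matrix_(i, j) reindex_hom R F a (i, j).
have mD a b : m (a + b) = m a + m b.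
  by apply/matrixP => i j; rewrite !mxE starhomD fmatD.
have mZ (k : R[i]) a : m (k *: a) = k *: m a.
  by apply/matrixP => i j; rewrite !mxE starhomZ fmatZ.
have mM a b : m (a ** b) = m a ** m b.
  apply/matrixP => i j; rewrite !mxE starhomM fmatM.
  by apply: eq_bigr => l _; rewrite !mxE.
have mS a : m (star a) = star (m a).
  by apply/matrixP => i j; rewrite !mxE starhom_star fmat_starE.
exists #|F|, (comp_hom (@StarHom R (fmat F (scal R)) 'M[R[i]]_#|F| m mD mZ mM mS) Lam).
apply: contra Lx => /eqP /matrixP h; apply/eqP/reindex_inj/ffunP => -[i j].
by have := h i j; rewrite !mxE fmat0.
Qed.
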